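(* Let $C$ be a $C^4$ oval and let $p\in\operatorname{int}(C)$. If $P_k=\operatorname{PPOS}_{\nu_k}(C)$ is a quasi-uniform sequence with $\delta_k=\operatorname{mesh}(\nu_k)\to0$, then $$d_H\bigl(\operatorname{ART}_{P_k}(p),\operatorname{ART}_C(p)\bigr)\to0,$$ where $d_H$ is the Hausdorff distance.
   Context: A $C^4$ oval is a strictly convex simple closed curve $C\subset\mathbb{R}^2$ of class $C^4$ with positive curvature; $\operatorname{int}(C)$ is the open region it bounds. For $x\in C$, $\iota_C(x)\in C$ is the unique point different from $x$ whose tangent is parallel to $T_xC$. For $p\in\operatorname{int}(C)$, let $\Lambda_p$ be the pencil of lines through $p$; a line meeting $C$ at $x\neq y$ is sent by $\Phi_C$ to the line through $\iota_C(x)$ and $\iota_C(y)$. $\operatorname{ART}_C(p)$ is the envelope of the lines $\Phi_C(\Lambda_p)$: if $\boldsymbol\ell(t)\in\mathbb{R}^3\setminus\{0\}$ are homogeneous line coordinates, the envelope point is $[\boldsymbol\ell\times\boldsymbol\ell']$. Let $C$ be parametrised by tangent angle. The $\nu_k\subset[0,\pi)$ are finite sets of directions, used together with their opposite directions $\nu_k+\pi$. $\operatorname{PPOS}_{\nu_k}(C)$ is the circumscribed convex polygon obtained by intersecting consecutive tangent lines of $C$ at the sampled directions $\nu_k\cup(\nu_k+\pi)$; its opposite sides are parallel. $\operatorname{mesh}(\nu_k)$ is the largest angular gap between consecutive sampled directions. The sequence is quasi-uniform if the ratio of the largest to the smallest consecutive angular gap is bounded independently of $k$. A CPPOS is a positively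 oriented convex polygon $P=(P_0,\dots,P_{2n-1})$, indices modulo $2n$, with consecutive edge vectors $e_i=P_{i+1}-P_i$ linearly independent and $e_{i+n}\parallel e_i$. Its boundary involution is $\sigma_P(P_i+se_i)=P_{i+n}+se_{i+n}$, $0\le s\le 1$. For a line $\ell$ meeting $\operatorname{int}(P)$ with boundary intersection points $x_\ell,y_\ell$, $\Phi_P(\ell)=\overline{\sigma_P(x_\ell)\sigma_P(y_\ell)}$. For $p\in\operatorname{int}(P)$, $\operatorname{ART}_P(p)$ is the completed envelope of the line family $\Phi_P(\Lambda_p)$: on each smooth arc of this family (where the chord endpoints lie in two fixed open sides) take the ordinary envelope $[\boldsymbol\ell\times\boldsymbol\ell']$; at a corner of the family (a line of $\Lambda_p$ through a vertex) the two one-sided envelope points lie on the same reflected line and the segment between them is included. *)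

(* Defs.v *)
From Coquelicot Require Import Coquelicot.
From Stdlib Require Import Reals RList List Sorted.
Open Scope R_scope.

(* The plane is [R * R]; Coquelicot's [norm] on it is the Euclidean norm.
   A line is given by homogeneous coordinates [(a, b, c)], not all zero. *)

Definition det (v w : R * R) : R := fst v * snd w - snd v * fst w.

Definition unit_vec (t : R) : R * R := (cos t, sin t).

Definition cross (a b : R * R * R) : R * R * R :=
  let '(a1, a2, a3) := a in
  let '(b1, b2, b3) := b in
  (a2 * b3 - a3 * b2, a3 * b1 - a1 * b3, a1 * b2 - a2 * b1).

Definition on_line (l : R * R * R) (x : R * R) : Prop :=
  let '(a, b, c) := l in a * fst x + b * snd x + c = 0.

(* The line [{z | det (unit_vec t) (z - p) = 0}] up to sign. *)
Definition pencil (p : R * R) (t : R) : R * R * R :=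
  (sin t, - cos t, cos t * snd p - sin t * fst p).

Definition class_C (n : nat) (f : R -> R) : Prop :=
  forall x, (forall k, (k <= n)%nat -> ex_derive_n f k x) /\
            continuous (Derive_n f n) x.

Definition velocity (c : R -> R * R) (t : R) : R * R :=
  (Derive (fun s => fst (c s)) t, Derive (fun s => snd (c s)) t).

Definition acceleration (c : R -> R * R) (t : R) : R * R :=
  (Derive_n (fun s => fst (c s)) 2 t, Derive_n (fun s => snd (c s)) 2 t).

Definition curvature (c : R -> R * R) (t : R) : R :=
  det (velocity c t) (acceleration c t) / norm (velocity c t) ^ 3.

(* An oval is carried by a counterclockwise regular parametrisation, not
   necessarily by tangent angle: reparametrising a curve of class C^4 by tangent
   angle loses one derivative.  Strict convexity: the curve lies strictly on one
   side (the left one, by the choice of orientation) of each of its tangent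
   lines, except for the point of tangency. *)
Record C4_oval := {
  curve :> R -> R * R;
  period : R;
  period_pos : 0 < period;
  curve_closed : forall t, curve (t + period) = curve t;
  curve_simple : forall s t, 0 <= s < period -> 0 <= t < period ->
    curve s = curve t -> s = t;
  curve_C4 : class_C 4 (fun t => fst (curve t)) /\
             class_C 4 (fun t => snd (curve t));
  curve_regular : forall t, velocity curve t <> (0, 0);
  curvature_pos : forall t, 0 < curvature curve t;
  curve_strictly_convex : forall s t, curve t <> curve s ->
    0 < det (velocity curve s) (minus (curve t) (curve s))
}.

Definition on_curve (C : C4_oval) (x : R * R) : Prop := exists t, x = C t.

(* The bounded component of the complement: all points that can be joined to
   [p] by a path avoiding the curve stay within a bounded region. *)
Definition inside (C : C4_oval) (p : R * R) : Prop :=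
  ~ on_curve C p /\
  exists M, forall f : R -> R * R,
    (forall s, continuous f s) -> f 0 = p ->
    (forall s, 0 <= s <= 1 -> ~ on_curve C (f s)) -> norm (f 1) <= M.

(* [y] is iota_C(x). *)
Definition antipode (C : C4_oval) (x y : R * R) : Prop :=
  exists s t, x = C s /\ y = C t /\ y <> x /\
    det (velocity C s) (velocity C t) = 0.

(* [m] is Phi_C(l). *)
Definition Phi_oval (C : C4_oval) (l m : R * R * R) : Prop :=
  exists x y x' y', x <> y /\ on_curve C x /\ on_curve C y /\
    on_line l x /\ on_line l y /\
    antipode C x x' /\ antipode C y y' /\
    m <> (0, 0, 0) /\ on_line m x' /\ on_line m y'.

(* [l] gives homogeneous coordinates of the image under [Phi] of the pencil of
   lines through [p], parametrised by direction angle. *)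
Definition line_family (Phi : R * R * R -> R * R * R -> Prop) (p : R * R)
    (l : R -> R * R * R) : Prop :=
  forall t, Phi (pencil p t) (l t).

(* [[z : 1] = [l x l']] at [t], where [l'] is the derivative along the filter
   [F]: the usual one for [locally t] (this is then [is_derive]), the one-sided
   ones for [at_left t] and [at_right t]. *)
Definition envelope_point (F : (R -> Prop) -> Prop) {FF : Filter F}
    (l : R -> R * R * R) (t : R) (z : R * R) : Prop :=
  exists l' : R * R * R, filterdiff l F (fun h => scal h l') /\
    exists w : R, w <> 0 /\ cross (l t) l' = (w * fst z, w * snd z, w).

Definition ART_oval (C : C4_oval) (p z : R * R) : Prop :=
  exists l t, line_family (Phi_oval C) p l /\ envelope_point (locally t) l t z.

(* A 2n-gon is given by its 2n-periodic sequence of vertices [P]. *)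

Definition edge (P : nat -> R * R) (i : nat) : R * R := minus (P (S i)) (P i).

Definition inside_polygon (n : nat) (P : nat -> R * R) (z : R * R) : Prop :=
  forall i, (i < 2 * n)%nat -> 0 < det (edge P i) (minus z (P i)).

(* [y] is sigma_P(x). *)
Definition boundary_involution (n : nat) (P : nat -> R * R) (x y : R * R) : Prop :=
  exists i s, (i < 2 * n)%nat /\ 0 <= s <= 1 /\
    x = plus (P i) (scal s (edge P i)) /\
    y = plus (P (i + n)%nat) (scal s (edge P (i + n)%nat)).

(* [m] is Phi_P(l). *)
Definition Phi_polygon (n : nat) (P : nat -> R * R) (l m : R * R * R) : Prop :=
  (exists z, inside_polygon n P z /\ on_line l z) /\
  exists x y x' y', x <> y /\ on_line l x /\ on_line l y /\
    boundary_involution n P x x' /\ boundary_involution n P y y' /\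
    m <> (0, 0, 0) /\ on_line m x' /\ on_line m y'.

Definition corner (n : nat) (P : nat -> R * R) (p : R * R) (t : R) : Prop :=
  exists i, (i < 2 * n)%nat /\ on_line (pencil p t) (P i).

Definition ART_polygon (n : nat) (P : nat -> R * R) (p z : R * R) : Prop :=
  exists l t, line_family (Phi_polygon n P) p l /\
    ((~ corner n P p t /\ envelope_point (locally t) l t z) \/
     (corner n P p t /\ exists z1 z2 s,
        envelope_point (at_left t) l t z1 /\
        envelope_point (at_right t) l t z2 /\
        0 <= s <= 1 /\ z = plus z1 (scal s (minus z2 z1)))).

(* A finite set of directions is its strictly increasing enumeration; two
   directions at least are needed for a bounded circumscribed polygon. *)
Definition direction_set (nu : list R) : Prop :=
  Sorted Rlt nu /\ Forall (fun a => 0 <= a < PI) nu /\ (2 <= length nu)%nat.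

(* For [i < 2 * length nu] this enumerates [nu] followed by [nu + PI]; then it
   goes on with period [2 * length nu] modulo [2 * PI]. *)
Definition direction (nu : list R) (i : nat) : R :=
  nth (i mod length nu) nu 0 + INR (i / length nu) * PI.

Definition gaps (nu : list R) : list R :=
  map (fun i => direction nu (S i) - direction nu i) (seq 0 (2 * length nu)).

Definition mesh (nu : list R) : R := MaxRlist (gaps nu).

Definition quasi_uniform (nu : nat -> list R) : Prop :=
  exists K, forall k, MaxRlist (gaps (nu k)) / MinRlist (gaps (nu k)) <= K.

(* [x] is on the tangent line of [C] at its point of tangent angle [theta]. *)
Definition on_tangent (C : C4_oval) (theta : R) (x : R * R) : Prop :=
  exists t, velocity C t = scal (norm (velocity C t)) (unit_vec theta) /\
    det (velocity C t) (minus x (C t)) = 0.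

(* [P] is the sequence of vertices of PPOS_nu(C); the edge from [P i] to
   [P (S i)] has direction angle [direction nu (S i)]. *)
Definition PPOS (C : C4_oval) (nu : list R) (P : nat -> R * R) : Prop :=
  forall i, on_tangent C (direction nu i) (P i) /\
            on_tangent C (direction nu (S i)) (P i).

(* With values in [Rbar]: [p_infty] when no neighbourhood is large enough. *)
Definition hausdorff_dist (A B : R * R -> Prop) : Rbar :=
  Glb_Rbar (fun r => 0 <= r /\
    (forall a, A a -> exists b, B b /\ norm (minus a b) <= r) /\
    (forall b, B b -> exists a, A a /\ norm (minus a b) <= r)).

(* Main.v *)
Require Import Defs.
From Stdlib Require Import Reals RList Sorted ZArith List Lra Lia Psatz.
From Stdlib Require Import Classical ClassicalChoice ClassicalEpsilon FunctionalExtensionality.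
From Coquelicot Require Import Coquelicot.
Open Scope R_scope.

(** Let [u] be [unit_vec].  Parametrised by tangent angle, the oval is a
    [2 * PI]-periodic curve [c] with [c' = rho u] and [rho > 0] continuous, and
    its involution is [c th -> c (th + PI)].  Let [alpha t] be the tangent angle
    of the oval at the point seen from [p] in the direction [t].  Then [Phi]
    maps the line of direction [t] to the line through [G t] and [G (t + PI)],
    where [G t = c (alpha t + PI)].  The envelope point of a moving chord is the
    point of the chord that moves along it.  It is a rational function of the
    two end points and their velocities ([envelope_of]), whose denominator
    ([weight]) is positive here, because both ends run around the oval in the
    same sense and the chord enters the interior at each of them
    ([reflected_weight]).

    The polygon has the same structure.  Where the ray of direction [t] meets
    the edge of direction [th], the point of intersection has velocity
    [h / sin (th - t) ^ 2 * u th], with [h] the distance from [p] to the line of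
    the edge.  As that line is a tangent of the oval, this is the formula that
    holds on the oval, with [th] in place of [alpha t].  The involution of the
    polygon multiplies the velocity by minus the ratio of the lengths of the
    opposite edges.  By the mean value theorems an edge between gaps [a] and [b]
    of the directions has length [rho z * (tan (a / 2) + tan (b / 2))], with [z]
    between the neighbouring directions ([edge_mean_radius]).  Opposite gaps are
    equal, so the ratio is [rho (z' + PI) / rho z], where the oval has
    [rho (alpha t + PI) / rho (alpha t)].  Finally [alpha t] also lies between the
    neighbours of [th] ([cell_alpha]).  So the data of the polygon at [t], from
    either side, are those of the oval up to an error controlled by the mesh
    ([cell_approximates]).

    By continuity and compactness the envelope points of the polygon, including
    the one-sided ones at corners, converge to those of the oval uniformly in
    [t] ([envelope_uniform]).  A segment between two one-sided points stays in
    the same ball.  Comparing points with equal [t] bounds the Hausdorff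
    distance.

    Since the definitions speak of arbitrary homogeneous coordinates of the
    lines, it also has to be shown that the envelope point does not depend on
    their choice ([envelope_unique]). *)

(** * Angles and derivatives *)

Lemma trig_shift (t : R) (m : Z) :
  cos (t + 2 * PI * IZR m) = cos t /\ sin (t + 2 * PI * IZR m) = sin t.
Proof.
  assert (H : forall x (k : nat), cos (x + 2 * PI * INR k) = cos x /\
    sin (x + 2 * PI * INR k) = sin x).
  { intros x k.
    replace (x + 2 * PI * INR k) with (x + 2 * INR k * PI) by ring.
    split; [apply cos_period | apply sin_period]. }
  destruct (Z_le_gt_dec 0 m) as [h | h].
  - rewrite <- (Z2Nat.id m h), <- INR_IZR_INZ. apply H.
  - destruct (H (t + 2 * PI * IZR m) (Z.to_nat (- m))) as [H1 H2].
    assert (E : INR (Z.to_nat (- m)) = - IZR m).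
    { rewrite INR_IZR_INZ, Z2Nat.id by lia. now rewrite opp_IZR. }
    rewrite E in H1, H2.
    replace (t + 2 * PI * IZR m + 2 * PI * - IZR m) with t in H1, H2 by ring.
    now rewrite H1, H2.
Qed.

Lemma shift_into (t a : R) : exists m : Z, a < t + 2 * PI * IZR m <= a + 2 * PI.
Proof.
  pose proof PI_RGT_0 as hpi.
  destruct (archimed ((a - t) / (2 * PI))) as [h1 h2].
  exists (up ((a - t) / (2 * PI))).
  set (u := IZR (up ((a - t) / (2 * PI)))) in *.
  assert (E : (a - t) = 2 * PI * ((a - t) / (2 * PI))) by (field; lra).
  set (v := (a - t) / (2 * PI)) in *. clearbody u v.
  split; nra.
Qed.

(** The window of length [2 * PI] is a parameter, so that angles can be chosen
    close to a given direction. *)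
Lemma polar_angle (x y a : R) : 0 < x * x + y * y ->
  exists t, a < t <= a + 2 * PI /\
    x = sqrt (x * x + y * y) * cos t /\ y = sqrt (x * x + y * y) * sin t.
Proof.
  intros hpos.
  set (r := sqrt (x * x + y * y)).
  assert (hr : 0 < r) by (apply sqrt_lt_R0; exact hpos).
  assert (hrr : r * r = x * x + y * y) by (apply sqrt_sqrt; lra).
  assert (hx : -1 <= x / r <= 1).
  { split; [apply Rmult_le_reg_r with r | apply Rmult_le_reg_r with r];
    try assumption; field_simplify; nra. }
  assert (hs : forall s, (s = 1 \/ s = -1) -> 0 <= s * y ->
    exists t, x = r * cos t /\ y = r * sin t).
  { intros s hs hy. exists (s * acos (x / r)).
    assert (E : sin (acos (x / r)) = s * y / r).
    { rewrite sin_acos by exact hx.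
      rewrite <- (sqrt_Rsqr (s * y / r)).
      - f_equal. unfold Rsqr. apply Rmult_eq_reg_r with (r * r); [ | nra].
        replace ((1 - x / r * (x / r)) * (r * r)) with (r * r - x * x)
          by (field; lra).
        replace (s * y / r * (s * y / r) * (r * r)) with ((s * s) * (y * y))
          by (field; lra).
        destruct hs; subst s; nra.
      - apply Rmult_le_pos; [exact hy | left; now apply Rinv_0_lt_compat]. }
    destruct hs; subst s.
    - rewrite Rmult_1_l, E, cos_acos by exact hx. split; field; lra.
    - replace (-1 * acos (x / r)) with (- acos (x / r)) by ring.
      rewrite cos_neg, sin_neg, E, cos_acos by exact hx. split; field; lra. }
  assert (H : exists t, x = r * cos t /\ y = r * sin t).
  { destruct (Rle_dec 0 y); [apply (hs 1) | apply (hs (-1))]; lra. }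
  destruct H as [t [h1 h2]].
  destruct (shift_into t a) as [m hm].
  exists (t + 2 * PI * IZR m). destruct (trig_shift t m) as [-> ->]. tauto.
Qed.

Lemma is_derive_value (f : R -> R) (x l l' : R) :
  is_derive f x l -> l = l' -> is_derive f x l'.
Proof. intros H <-; exact H. Qed.

Lemma is_derive_continuous (f : R -> R) (x l : R) :
  is_derive f x l -> continuous f x.
Proof. intros H; apply (ex_derive_continuous f x); now exists l. Qed.

Lemma mean_value (f df : R -> R) (a b : R) :
  (forall x, is_derive f x (df x)) -> a < b ->
  exists c, a < c < b /\ f b - f a = df c * (b - a).
Proof.
  intros H hab.
  destruct (MVT_cor2 f df a b hab) as [c [E hc]].
  - intros x _. apply is_derive_Reals, H.
  - now exists c.
Qed.

Lemma derive_zero_constant (f : R -> R) :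
  (forall x, is_derive f x 0) -> forall x y, f x = f y.
Proof.
  intros H x y.
  assert (Hab : forall a b, a < b -> f a = f b).
  { intros a b hab. destruct (mean_value f (fun _ => 0) a b H hab) as [c [_ E]]. lra. }
  destruct (Rtotal_order x y) as [h | [-> | h]]; [ | | symmetry]; auto.
Qed.

Lemma derive_pos_increasing (f df : R -> R) (a b : R) :
  (forall x, is_derive f x (df x)) -> (forall x, a < x < b -> 0 < df x) ->
  a < b -> f a < f b.
Proof.
  intros H hpos hab.
  destruct (mean_value f df a b H) as [c [hc E]]; [exact hab | ].
  specialize (hpos c hc). nra.
Qed.

Lemma ivt (f : R -> R) (a b y : R) :
  (forall x, continuous f x) -> a <= b -> f a <= y <= f b ->
  exists x, a <= x <= b /\ f x = y.
Proof.
  intros hc hab hy.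
  destruct (IVT_gen f a b y) as [x [hx E]].
  - intros x. apply continuity_pt_filterlim. apply hc.
  - rewrite Rmin_left, Rmax_right; lra.
  - exists x. rewrite Rmin_left, Rmax_right in hx by exact hab. tauto.
Qed.

(** By the mean value theorem a difference quotient of [g] is [/ df xi] with
    [xi] close to [g y]. *)
Lemma inverse_derivative (f df g : R -> R) :
  (forall x, is_derive f x (df x)) -> (forall x, continuous df x) ->
  (forall x, 0 < df x) -> (forall y, f (g y) = y) ->
  forall y, is_derive g y (/ df (g y)).
Proof.
  intros hf hdf hpos hg y.
  assert (hinc : forall a b, f a < f b -> a < b).
  { intros a b h. destruct (Rlt_dec a b) as [ | n]; [assumption | ].
    destruct (Req_dec a b) as [-> | ne]; [lra | ].
    assert (f b < f a); [ | lra].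
    apply (derive_pos_increasing f df); auto; lra. }
  assert (hmono : forall a b, a < b -> f a < f b).
  { intros a b h. apply (derive_pos_increasing f df); auto. }
  assert (hcont : forall eps : posreal, locally y (fun z => Rabs (g z - g y) < eps)).
  { intros eps. pose proof (cond_pos eps) as he.
    assert (h1 : f (g y - eps) < y) by (rewrite <- (hg y) at 2; apply hmono; lra).
    assert (h2 : y < f (g y + eps)) by (rewrite <- (hg y) at 1; apply hmono; lra).
    assert (hd : 0 < Rmin (y - f (g y - eps)) (f (g y + eps) - y))
      by (apply Rmin_glb_lt; lra).
    exists (mkposreal _ hd). intros z hz.
    change (Rabs (z - y) < Rmin (y - f (g y - eps)) (f (g y + eps) - y)) in hz.
    pose proof (Rmin_l (y - f (g y - eps)) (f (g y + eps) - y)).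
    pose proof (Rmin_r (y - f (g y - eps)) (f (g y + eps) - y)).
    apply Rabs_def2 in hz.
    apply Rabs_def1.
    - assert (g z < g y + eps); [ | lra]. apply hinc. rewrite hg. lra.
    - assert (g y - eps < g z); [ | lra]. apply hinc. rewrite hg. lra. }
  apply is_derive_Reals. intros eps heps.
  assert (hpos' : 0 < df (g y)) by apply hpos.
  assert (hinv : continuous (fun x => / df x) (g y)).
  { apply continuous_Rinv_comp; [apply hdf | lra]. }
  destruct (proj1 (filterlim_locally _ _) hinv (mkposreal _ heps)) as [d hd].
  destruct (hcont d) as [d' hd'].
  exists d'. intros h hne hh.
  assert (hb : Rabs (g (y + h) - g y) < d).
  { apply hd'. change (Rabs (y + h - y) < d'). now replace (y + h - y) with h by ring. }
  assert (hxi : exists xi, Rabs (xi - g y) < d /\ h = df xi * (g (y + h) - g y)).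
  { destruct (Rtotal_order (g y) (g (y + h))) as [hlt | [heq | hlt]].
    - destruct (mean_value f df _ _ hf hlt) as [xi [hxi E]]. exists xi.
      rewrite !hg in E. split; [ | lra].
      apply Rabs_def2 in hb. apply Rabs_def1; lra.
    - pose proof (hg (y + h)) as E. rewrite <- heq, hg in E. lra.
    - destruct (mean_value f df _ _ hf hlt) as [xi [hxi E]]. exists xi.
      rewrite !hg in E. split; [ | lra].
      apply Rabs_def2 in hb. apply Rabs_def1; lra. }
  destruct hxi as [xi [hxi E]].
  specialize (hpos xi).
  replace ((g (y + h) - g y) / h) with (/ df xi).
  - exact (hd xi hxi).
  - assert (g (y + h) - g y <> 0) by (intros E'; rewrite E' in E; lra).
    rewrite E at 2. field. lra.
Qed.

(** A nonvanishing vector that turns at the same rate as a rotating frame has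
    constant normalised coordinates in that frame. *)
Lemma rotating_coordinate_constant (w1 w2 psi : R -> R) (s a1 a2 k : R) :
  is_derive w1 s a1 -> is_derive w2 s a2 -> is_derive psi s k ->
  0 < w1 s * w1 s + w2 s * w2 s ->
  k * (w1 s * w1 s + w2 s * w2 s) = w1 s * a2 - w2 s * a1 ->
  is_derive (fun s => (w1 s * cos (psi s) + w2 s * sin (psi s)) /
                      sqrt (w1 s * w1 s + w2 s * w2 s)) s 0.
Proof.
  intros hw1 hw2 hpsi hn hk.
  pose proof (sqrt_lt_R0 _ hn) as hr. pose proof (sqrt_sqrt _ (Rlt_le _ _ hn)) as hrr.
  auto_derive; [repeat split; try (eexists; eassumption); lra | ].
  replace (Derive (fun x => w1 x) s) with a1 by (symmetry; now apply is_derive_unique).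
  replace (Derive (fun x => w2 x) s) with a2 by (symmetry; now apply is_derive_unique).
  replace (Derive (fun x => psi x) s) with k by (symmetry; now apply is_derive_unique).
  set (r := sqrt (w1 s * w1 s + w2 s * w2 s)) in *.
  set (x := w1 s) in *; set (y := w2 s) in *.
  set (c := cos (psi s)); set (d := sin (psi s)). clearbody c d x y r.
  apply Rmult_eq_reg_r with (r * (r * r));
    [ | apply Rgt_not_eq; repeat apply Rmult_lt_0_compat; assumption].
  rewrite Rmult_0_l.
  match goal with |- ?L = 0 => transitivity
    ((a1 * c + a2 * d + k * (y * c - x * d)) * (r * r) -
     (x * c + y * d) * (x * a1 + y * a2)) end; [field; lra | ].
  rewrite hrr.
  transitivity ((k * (x * x + y * y)) * (y * c - x * d) +
    (a1 * c + a2 * d) * (x * x + y * y) - (x * c + y * d) * (x * a1 + y * a2)); [ring | ].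
  rewrite hk. ring.
Qed.

(** A closed curve [w] that turns counterclockwise around the origin can be
    parametrised by its polar angle.  The angle [psi] is obtained by integrating
    [det w w' / |w| ^ 2]; it increases by a fixed positive amount over a period,
    hence is onto.  This serves twice: for the velocity of the oval, and for the
    oval seen from an interior point. *)
Lemma angular_inverse (w1 w2 a1 a2 : R -> R) (T : R) :
  0 < T ->
  (forall s, is_derive w1 s (a1 s)) -> (forall s, is_derive w2 s (a2 s)) ->
  (forall s, continuous a1 s) -> (forall s, continuous a2 s) ->
  (forall s, w1 (s + T) = w1 s /\ w2 (s + T) = w2 s /\
             a1 (s + T) = a1 s /\ a2 (s + T) = a2 s) ->
  (forall s, 0 < w1 s * a2 s - w2 s * a1 s) ->
  exists psi sig : R -> R,
    (forall s, w1 s = sqrt (w1 s * w1 s + w2 s * w2 s) * cos (psi s) /\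
               w2 s = sqrt (w1 s * w1 s + w2 s * w2 s) * sin (psi s)) /\
    (forall t, psi (sig t) = t) /\ (forall s, sig (psi s) = s) /\
    (forall t, is_derive sig t
       ((w1 (sig t) * w1 (sig t) + w2 (sig t) * w2 (sig t)) /
        (w1 (sig t) * a2 (sig t) - w2 (sig t) * a1 (sig t)))).
Proof.
  intros hT hw1 hw2 ha1 ha2 hper hdet.
  set (n := fun s => w1 s * w1 s + w2 s * w2 s).
  assert (hn : forall s, 0 < n s).
  { intros s. unfold n. specialize (hdet s).
    assert (w1 s <> 0 \/ w2 s <> 0) as [h | h].
    { destruct (Req_dec (w1 s) 0) as [e1 | ]; [ | tauto].
      destruct (Req_dec (w2 s) 0) as [e2 | ]; [ | tauto].
      rewrite e1, e2 in hdet. lra. }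
    - pose proof (Rsqr_pos_lt _ h) as h'; unfold Rsqr in h'. nra.
    - pose proof (Rsqr_pos_lt _ h) as h'; unfold Rsqr in h'. nra. }
  assert (hc1 : forall s, continuous w1 s) by (intros s; eapply is_derive_continuous; apply hw1).
  assert (hc2 : forall s, continuous w2 s) by (intros s; eapply is_derive_continuous; apply hw2).
  set (k := fun s => (w1 s * a2 s - w2 s * a1 s) / n s).
  assert (hk : forall s, continuous k s).
  { intros s. unfold k, Rdiv. apply (continuous_mult (K := R_AbsRing)).
    - apply (continuous_minus (V := R_NormedModule));
        apply (continuous_mult (K := R_AbsRing)); auto.
    - apply continuous_Rinv_comp; [ | specialize (hn s); lra].
      apply (continuous_plus (V := R_NormedModule));
        apply (continuous_mult (K := R_AbsRing)); auto. }
  assert (hkpos : forall s, 0 < k s).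
  { intros s. apply Rdiv_lt_0_compat; auto. }
  destruct (polar_angle (w1 0) (w2 0) 0 (hn 0)) as [t0 [_ [h01 h02]]].
  set (psi := fun s => t0 + RInt k 0 s).
  assert (hpsi : forall s, is_derive psi s (k s)).
  { intros s. apply is_derive_value with (0 + k s); [ | ring].
    unfold psi. apply (is_derive_plus (fun _ => t0) (fun s => RInt k 0 s)).
    - auto_derive; [exact I | ring].
    - apply (is_derive_RInt k _ 0 s); [ | apply hk].
      apply filter_forall. intros x. apply (RInt_correct (V := R_CompleteNormedModule)).
      apply (ex_RInt_continuous (V := R_CompleteNormedModule)). intros; apply hk. }
  assert (hpsi0 : psi 0 = t0) by (unfold psi; rewrite RInt_point; unfold zero; simpl; ring).
  (* The components of w/|w| in the frame rotating with psi are constant. *)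
  set (N := fun s => (w1 s * cos (psi s) + w2 s * sin (psi s)) / sqrt (w1 s * w1 s + w2 s * w2 s)).
  set (M := fun s => (w2 s * cos (psi s) - w1 s * sin (psi s)) / sqrt (w1 s * w1 s + w2 s * w2 s)).
  assert (hconst : forall s, is_derive N s 0 /\ is_derive M s 0).
  { intros s. pose proof (hn s) as hns. unfold n in hns.
    assert (hks : k s * (w1 s * w1 s + w2 s * w2 s) = w1 s * a2 s - w2 s * a1 s)
      by (unfold k, n; field; lra).
    split; [now apply (rotating_coordinate_constant w1 w2 psi s (a1 s) (a2 s) (k s)) | ].
    apply is_derive_ext with (fun s => (w2 s * cos (psi s) + - w1 s * sin (psi s)) /
      sqrt (w2 s * w2 s + - w1 s * - w1 s)).
    { intros x. unfold M. f_equal; [ring | f_equal; ring]. }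
    apply (rotating_coordinate_constant w2 (fun x => - w1 x) psi s (a2 s) (- a1 s) (k s)); auto.
    - apply (is_derive_opp w1); auto.
    - lra.
    - transitivity (k s * (w1 s * w1 s + w2 s * w2 s)); [ring | ]. rewrite hks. ring. }
  assert (hN : forall s, N s = 1).
  { intros s. rewrite (derive_zero_constant N (fun x => proj1 (hconst x)) s 0).
    unfold N. rewrite hpsi0.
    pose proof (sqrt_lt_R0 _ (hn 0)) as hr. unfold n in hr.
    set (r := sqrt (w1 0 * w1 0 + w2 0 * w2 0)) in *. clearbody r. rewrite h01, h02.
    pose proof (sin2_cos2 t0) as h; unfold Rsqr in h.
    field_simplify_eq; [ | lra]. replace (cos t0 ^ 2) with (1 - sin t0 * sin t0) by (rewrite <- h; ring). ring. }
  assert (hM : forall s, M s = 0).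
  { intros s. rewrite (derive_zero_constant M (fun x => proj2 (hconst x)) s 0).
    unfold M. rewrite hpsi0.
    pose proof (sqrt_lt_R0 _ (hn 0)) as hr. unfold n in hr.
    set (r := sqrt (w1 0 * w1 0 + w2 0 * w2 0)) in *. clearbody r. rewrite h01, h02.
    field. lra. }
  assert (hmono : forall a b, a < b -> psi a < psi b).
  { intros a b h. apply (derive_pos_increasing psi k); auto. }
  assert (hstep : forall s, psi (s + T) = psi s + (psi T - psi 0)).
  { intros s.
    assert (E : psi (s + T) - psi s = psi (0 + T) - psi 0).
    { apply (derive_zero_constant (fun s => psi (s + T) - psi s)). intros x.
      apply is_derive_value with (k (x + T) - k x).
      - apply (is_derive_minus (fun s => psi (s + T)) psi); [ | apply hpsi].
        apply is_derive_value with (1 * k (x + T)); [ | ring].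
        apply (is_derive_comp psi (fun s => s + T)); [apply hpsi | ].
        auto_derive; [exact I | ring].
      - unfold k, n. destruct (hper x) as (-> & -> & -> & ->). ring. }
    rewrite Rplus_0_l in E. lra. }
  assert (hD : 0 < psi T - psi 0) by (specialize (hmono 0 T hT); lra).
  assert (hnat : forall j : nat, psi (INR j * T) = psi 0 + INR j * (psi T - psi 0) /\
                      psi (- (INR j * T)) = psi 0 - INR j * (psi T - psi 0)).
  { induction j as [ | j [IH1 IH2]].
    - simpl. rewrite !Rmult_0_l, Ropp_0. split; ring.
    - rewrite S_INR. split.
      + replace ((INR j + 1) * T) with (INR j * T + T) by ring. rewrite hstep, IH1. ring.
      + pose proof (hstep (- ((INR j + 1) * T))) as E.
        replace (- ((INR j + 1) * T) + T) with (- (INR j * T)) in E by ring. lra. }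
  assert (hsurj : forall t, exists s, psi s = t).
  { intros t. destruct (INR_unbounded (Rabs (t - psi 0) / (psi T - psi 0))) as [j hj].
    assert (hj' : Rabs (t - psi 0) < INR j * (psi T - psi 0)).
    { apply Rmult_lt_reg_r with (/ (psi T - psi 0)); [now apply Rinv_0_lt_compat | ].
      rewrite Rmult_assoc, Rinv_r by lra. rewrite Rmult_1_r. exact hj. }
    apply Rabs_def2 in hj'. destruct (hnat j) as [h1 h2].
    destruct (ivt psi (- (INR j * T)) (INR j * T) t) as [s [_ hs]].
    - intros s. eapply is_derive_continuous; apply hpsi.
    - pose proof (pos_INR j). nra.
    - lra.
    - now exists s. }
  destruct (choice (fun t s => psi s = t) hsurj) as [sig hsig].
  exists psi, sig. split; [ | split; [exact hsig | split]].
  - intros s. pose proof (hn s) as hns. unfold n in hns.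
    pose proof (sqrt_lt_R0 _ hns) as hr.
    specialize (hN s); specialize (hM s). unfold N, M in hN, hM.
    set (r := sqrt (w1 s * w1 s + w2 s * w2 s)) in *. clearbody r.
    assert (e1 : w1 s * cos (psi s) + w2 s * sin (psi s) = r).
    { apply Rmult_eq_reg_r with (/ r); [ | apply Rinv_neq_0_compat; lra].
      rewrite Rinv_r by lra. exact hN. }
    assert (e2 : w2 s * cos (psi s) - w1 s * sin (psi s) = 0).
    { apply Rmult_eq_reg_r with (/ r); [ | apply Rinv_neq_0_compat; lra].
      rewrite Rmult_0_l. exact hM. }
    pose proof (sin2_cos2 (psi s)) as h; unfold Rsqr in h.
    set (c := cos (psi s)) in *; set (d := sin (psi s)) in *. clearbody c d.
    split; rewrite <- e1.
    + transitivity (w1 s * (d * d + c * c) + d * (w2 s * c - w1 s * d)); [rewrite h, e2 | ]; ring.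
    + transitivity (w2 s * (d * d + c * c) - c * (w2 s * c - w1 s * d)); [rewrite h, e2 | ]; ring.
  - intros s. specialize (hsig (psi s)).
    destruct (Rtotal_order (sig (psi s)) s) as [h | [h | h]]; auto;
      apply hmono in h; lra.
  - intros t. apply is_derive_value with (/ k (sig t)).
    + apply (inverse_derivative psi k); auto.
    + unfold k, n. specialize (hdet (sig t)). specialize (hn (sig t)). unfold n in hn. field. lra.
Qed.

(** * Vectors of the plane *)

Lemma norm_pair (x : R * R) : norm x = sqrt (fst x * fst x + snd x * snd x).
Proof.
  unfold norm; simpl; unfold prod_norm, norm; simpl; unfold abs; simpl.
  f_equal. rewrite !Rmult_1_r, <- !Rabs_mult, !Rabs_pos_eq; nra.
Qed.

Lemma fst_minus (x y : R * R) : fst (minus x y) = fst x - fst y.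
Proof. reflexivity. Qed.
Lemma snd_minus (x y : R * R) : snd (minus x y) = snd x - snd y.
Proof. reflexivity. Qed.
Lemma fst_plus (x y : R * R) : fst (plus x y) = fst x + fst y.
Proof. reflexivity. Qed.
Lemma snd_plus (x y : R * R) : snd (plus x y) = snd x + snd y.
Proof. reflexivity. Qed.
Lemma fst_scal (k : R) (x : R * R) : fst (scal k x) = k * fst x.
Proof. reflexivity. Qed.
Lemma snd_scal (k : R) (x : R * R) : snd (scal k x) = k * snd x.
Proof. reflexivity. Qed.

(** The second pass reaches the projections that the first one uncovers. *)
Ltac coords := unfold det, unit_vec in *;
  do 2 rewrite ?fst_minus, ?snd_minus, ?fst_plus, ?snd_plus, ?fst_scal, ?snd_scal in *;
  cbn [fst snd] in *.

(** * Curves parametrised by tangent angle *)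

Record angular_curve (c : R -> R * R) (rho : R -> R) : Prop := {
  angular_x : forall th, is_derive (fun s => fst (c s)) th (rho th * cos th);
  angular_y : forall th, is_derive (fun s => snd (c s)) th (rho th * sin th);
  angular_continuous : forall th, continuous rho th;
  angular_pos : forall th, 0 < rho th;
  angular_periodic : forall th, c (th + 2 * PI) = c th }.

Lemma periodic_shift {A : Type} (f : R -> A) :
  (forall x, f (x + 2 * PI) = f x) -> forall x m, f (x + 2 * PI * IZR m) = f x.
Proof.
  intros H.
  assert (Hn : forall (k : nat) x, f (x + 2 * PI * INR k) = f x).
  { induction k as [ | k IH]; intros x.
    - change (INR 0) with 0. f_equal. ring.
    - rewrite S_INR, <- (IH x), <- (H (x + 2 * PI * INR k)). f_equal. ring. }
  intros x m. destruct (Z_le_gt_dec 0 m) as [h | h].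
  - rewrite <- (Z2Nat.id m h), <- INR_IZR_INZ. apply Hn.
  - rewrite <- (Hn (Z.to_nat (- m)) (x + 2 * PI * IZR m)). f_equal.
    rewrite INR_IZR_INZ, Z2Nat.id, opp_IZR by lia. ring.
Qed.

Section AngularCurve.

Variables (c : R -> R * R) (rho : R -> R).
Hypothesis hc : angular_curve c rho.

Lemma chord_component_derive (a : R * R) (q : R * R) (s : R) :
  is_derive (fun s => det a (minus (c s) q)) s
    (rho s * (fst a * sin s - snd a * cos s)).
Proof.
  assert (H : forall (x y : R -> R) x' y', is_derive x s x' -> is_derive y s y' ->
    is_derive (fun s => fst a * (y s - snd q) - snd a * (x s - fst q)) s
      (fst a * y' - snd a * x')).
  { intros x y x' y' hx hy.
    auto_derive; [split; [now exists y' | split; [now exists x' | exact I]] | ].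
    replace (Derive (fun s => x s) s) with x' by (symmetry; now apply is_derive_unique).
    replace (Derive (fun s => y s) s) with y' by (symmetry; now apply is_derive_unique).
    ring. }
  eapply is_derive_value.
  - exact (H _ _ _ _ (angular_x c rho hc s) (angular_y c rho hc s)).
  - ring.
Qed.

(** The distance from [c s] to the tangent at [phi] has derivative
    [rho s * sin (s - phi)]: it increases from [0] for half a turn, and then
    decreases back to [0]. *)
Lemma angular_convex (phi psi : R) : phi < psi < phi + 2 * PI ->
  0 < det (unit_vec phi) (minus (c psi) (c phi)).
Proof.
  intros h.
  set (f := fun s => det (unit_vec phi) (minus (c s) (c phi))).
  assert (hf : forall s, is_derive f s (rho s * sin (s - phi))).
  { intros s. eapply is_derive_value; [apply chord_component_derive | ].
    simpl. rewrite sin_minus. ring. }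
  assert (h0 : f phi = 0) by (unfold f; coords; ring).
  assert (h2 : f (phi + 2 * PI) = 0).
  { unfold f. rewrite (angular_periodic c rho hc). exact h0. }
  pose proof (angular_pos c rho hc) as hpos.
  pose proof PI_RGT_0 as hpi.
  change (0 < f psi). destruct (Rle_dec psi (phi + PI)) as [hle | hgt].
  - rewrite <- h0. apply (derive_pos_increasing f _ phi psi hf); [ | lra].
    intros x hx. apply Rmult_lt_0_compat; [apply hpos | apply sin_gt_0; lra].
  - apply Ropp_lt_cancel. rewrite Ropp_0, <- Ropp_0, <- h2.
    apply (derive_pos_increasing (fun s => - f s) (fun s => - (rho s * sin (s - phi))) psi); [ | | lra].
    + intros x. apply (is_derive_opp f), hf.
    + intros x hx. specialize (hpos x).
      assert (sin (x - phi) < 0); [ | nra]. apply sin_lt_0; lra.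
Qed.

Lemma angular_shift (th : R) (m : Z) : c (th + 2 * PI * IZR m) = c th.
Proof. apply periodic_shift, (angular_periodic c rho hc). Qed.

Lemma angular_injective (phi psi : R) : c phi = c psi ->
  exists m : Z, psi = phi + 2 * PI * IZR m.
Proof.
  intros E. destruct (shift_into psi phi) as [m hm].
  destruct (Req_dec (psi + 2 * PI * IZR m) (phi + 2 * PI)) as [e | ne].
  - assert (E' : psi = phi + 2 * PI * (1 + - IZR m)) by lra.
    exists (1 - m)%Z. rewrite minus_IZR. lra.
  - exfalso. assert (h : phi < psi + 2 * PI * IZR m < phi + 2 * PI) by lra.
    apply angular_convex in h. rewrite angular_shift, <- E in h.
    coords. lra.
Qed.
End AngularCurve.

(** * The tangent angle of an oval *)

Lemma derive_periodic (f df : R -> R) (T : R) :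
  (forall s, is_derive f s (df s)) -> (forall s, f (s + T) = f s) ->
  forall s, df (s + T) = df s.
Proof.
  intros hf hT s.
  assert (h : is_derive f s (df (s + T))).
  { apply is_derive_ext with (fun s => f (s + T)); [exact hT | ].
    apply is_derive_value with (1 * df (s + T)); [ | ring].
    apply (is_derive_comp f (fun s => s + T)); [apply hf | ].
    auto_derive; [exact I | ring]. }
  apply is_derive_unique in h. rewrite <- h. now apply is_derive_unique.
Qed.

Lemma sin_zero_cases (a b : R) : sin (b - a) = 0 ->
  exists m : Z, b = a + 2 * PI * IZR m \/ b = a + PI + 2 * PI * IZR m.
Proof.
  intros h. destruct (sin_eq_0_0 _ h) as [k hk].
  destruct (Z.Even_or_Odd k) as [[m ->] | [m ->]]; exists m.
  - left. rewrite mult_IZR in hk. lra.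
  - right. rewrite plus_IZR, mult_IZR in hk. lra.
Qed.

Section Oval.

Variable C : C4_oval.

Let x s := fst (C s).
Let y s := snd (C s).
Let v1 := Derive x.
Let v2 := Derive y.
Let a1 := Derive_n x 2.
Let a2 := Derive_n y 2.

Lemma oval_derivatives : forall s,
  (is_derive x s (v1 s) /\ is_derive y s (v2 s)) /\
  (is_derive v1 s (a1 s) /\ is_derive v2 s (a2 s)) /\
  (continuous a1 s /\ continuous a2 s).
Proof.
  intros s. destruct (curve_C4 C) as [h1 h2].
  destruct (h1 s) as [k1 _]; destruct (h2 s) as [k2 _].
  refine (conj (conj _ _) (conj (conj _ _) (conj _ _))).
  - apply Derive_correct. apply (k1 1%nat). lia.
  - apply Derive_correct. apply (k2 1%nat). lia.
  - apply (Derive_correct (Derive_n x 1)). apply (k1 2%nat). lia.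
  - apply (Derive_correct (Derive_n y 1)). apply (k2 2%nat). lia.
  - apply (ex_derive_continuous (Derive_n x 2)). apply (k1 3%nat). lia.
  - apply (ex_derive_continuous (Derive_n y 2)). apply (k2 3%nat). lia.
Qed.

Lemma oval_speed_pos (s : R) : 0 < v1 s * v1 s + v2 s * v2 s.
Proof.
  pose proof (curve_regular C s) as h. change (velocity C s) with (v1 s, v2 s) in h.
  destruct (Req_dec (v1 s) 0) as [e1 | n1].
  - destruct (Req_dec (v2 s) 0) as [e2 | n2].
    + exfalso. apply h. now rewrite e1, e2.
    + pose proof (Rsqr_pos_lt _ n2) as h'; unfold Rsqr in h'. nra.
  - pose proof (Rsqr_pos_lt _ n1) as h'; unfold Rsqr in h'. nra.
Qed.

Lemma oval_turns_left (s : R) : 0 < v1 s * a2 s - v2 s * a1 s.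
Proof.
  pose proof (curvature_pos C s) as h. unfold curvature in h.
  assert (hn : 0 < norm (velocity C s)).
  { rewrite norm_pair. apply sqrt_lt_R0, oval_speed_pos. }
  assert (h3 : 0 < norm (velocity C s) ^ 3) by now apply pow_lt.
  change (det (velocity C s) (acceleration C s)) with (v1 s * a2 s - v2 s * a1 s) in h.
  apply Rmult_lt_reg_r with (/ norm (velocity C s) ^ 3); [now apply Rinv_0_lt_compat | ].
  rewrite Rmult_0_l. exact h.
Qed.

(** The curve lies on one side of both tangents, which are parallel and
    equally oriented: they coincide, and touch the curve at the same point. *)
Lemma oval_same_tangent (s t r r' th : R) : 0 < r -> 0 < r' ->
  velocity C s = scal r (unit_vec th) -> velocity C t = scal r' (unit_vec th) ->
  C s = C t.
Proof.
  intros hr hr' hs ht. apply NNPP. intros ne.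
  pose proof (curve_strictly_convex C s t (fun e => ne (eq_sym e))) as h1.
  pose proof (curve_strictly_convex C t s ne) as h2.
  rewrite hs in h1. rewrite ht in h2. coords.
  set (z := cos th * (snd (C t) - snd (C s)) - sin th * (fst (C t) - fst (C s))) in *.
  assert (0 < r * z) by (unfold z; lra). assert (0 < r' * - z) by (unfold z; lra).
  assert (0 < z) by (apply Rmult_lt_reg_l with r; lra). nra.
Qed.

(** The velocity turns counterclockwise, so [angular_inverse] applies to it; that
    the resulting curve is periodic is [oval_same_tangent].  As to the last
    clause: from a point that is not strictly to the left of some tangent one
    can leave to infinity along the outer normal. *)
Lemma oval_angular : exists c rho, angular_curve c rho /\
  (forall z, on_curve C z <-> exists th, z = c th) /\
  (forall th z, antipode C (c th) z <-> z = c (th + PI)) /\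
  (forall th z, on_tangent C th z -> det (unit_vec th) (minus z (c th)) = 0) /\
  (forall p, inside C p -> forall th, 0 < det (unit_vec th) (minus p (c th))).
Proof.
  pose proof (fun s => proj1 (proj1 (oval_derivatives s))) as dx.
  pose proof (fun s => proj2 (proj1 (oval_derivatives s))) as dy.
  pose proof (fun s => proj1 (proj1 (proj2 (oval_derivatives s)))) as dv1.
  pose proof (fun s => proj2 (proj1 (proj2 (oval_derivatives s)))) as dv2.
  pose proof (fun s => proj1 (proj2 (proj2 (oval_derivatives s)))) as ca1.
  pose proof (fun s => proj2 (proj2 (proj2 (oval_derivatives s)))) as ca2.
  assert (px : forall s, x (s + period C) = x s) by (intros s; unfold x; now rewrite curve_closed).
  assert (py : forall s, y (s + period C) = y s) by (intros s; unfold y; now rewrite curve_closed).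
  pose proof (derive_periodic x v1 _ dx px) as pv1.
  pose proof (derive_periodic y v2 _ dy py) as pv2.
  pose proof (derive_periodic v1 a1 _ dv1 pv1) as pa1.
  pose proof (derive_periodic v2 a2 _ dv2 pv2) as pa2.
  destruct (angular_inverse v1 v2 a1 a2 (period C) (period_pos C) dv1 dv2 ca1 ca2)
    as (psi & sig & hv & hps & hsp & dsig).
  { intros s; auto. }
  { apply oval_turns_left. }
  set (r := fun s => sqrt (v1 s * v1 s + v2 s * v2 s)).
  set (k := fun s => (v1 s * v1 s + v2 s * v2 s) / (v1 s * a2 s - v2 s * a1 s)).
  assert (hr : forall s, 0 < r s) by (intros s; apply sqrt_lt_R0, oval_speed_pos).
  assert (hk : forall s, 0 < k s)
    by (intros s; apply Rdiv_lt_0_compat; [apply oval_speed_pos | apply oval_turns_left]).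
  assert (hvel : forall s, velocity C s = scal (r s) (unit_vec (psi s))).
  { intros s. destruct (hv s) as [e1 e2].
    change (velocity C s) with (v1 s, v2 s).
    apply injective_projections; [exact e1 | exact e2]. }
  assert (hvel' : forall th, velocity C (sig th) = scal (r (sig th)) (unit_vec th)).
  { intros th. now rewrite hvel, hps. }
  set (c := fun th => C (sig th)).
  set (rho := fun th => r (sig th) * k (sig th)).
  assert (hsame : forall s m, C s = c (psi s + 2 * PI * IZR m)).
  { intros s m. apply (oval_same_tangent s _ (r s) (r (sig (psi s + 2 * PI * IZR m))) (psi s)); auto.
    rewrite hvel'. unfold unit_vec. now destruct (trig_shift (psi s) m) as [-> ->]. }
  assert (cv1 : forall s, continuous v1 s) by (intros s; eapply is_derive_continuous; apply dv1).
  assert (cv2 : forall s, continuous v2 s) by (intros s; eapply is_derive_continuous; apply dv2).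
  assert (hc : angular_curve c rho).
  { constructor.
    - intros th. apply is_derive_value with (k (sig th) * v1 (sig th)).
      + apply (is_derive_comp x sig); [apply dx | apply dsig].
      + destruct (hv (sig th)) as [e _]. rewrite hps in e. rewrite e. unfold rho, r. ring.
    - intros th. apply is_derive_value with (k (sig th) * v2 (sig th)).
      + apply (is_derive_comp y sig); [apply dy | apply dsig].
      + destruct (hv (sig th)) as [_ e]. rewrite hps in e. rewrite e. unfold rho, r. ring.
    - intros th. apply (continuous_comp sig (fun s => r s * k s)).
      + eapply is_derive_continuous; apply dsig.
      + assert (cn : continuous (fun s => v1 s * v1 s + v2 s * v2 s) (sig th)).
        { apply (continuous_plus (V := R_NormedModule));
            apply (continuous_mult (K := R_AbsRing)); auto. }
        apply (continuous_mult (K := R_AbsRing)).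
        * apply (continuous_comp _ sqrt); [exact cn | ].
          apply continuity_pt_filterlim, continuity_pt_sqrt. left; apply oval_speed_pos.
        * apply (continuous_mult (K := R_AbsRing)); [exact cn | ].
          apply continuous_Rinv_comp.
          -- apply (continuous_minus (V := R_NormedModule));
               apply (continuous_mult (K := R_AbsRing)); auto.
          -- pose proof (oval_turns_left (sig th)). lra.
    - intros th. apply Rmult_lt_0_compat; auto.
    - intros th. unfold c at 2. rewrite (hsame (sig th) 1%Z), hps. f_equal. ring. }
  assert (hC : forall s, C s = c (psi s)).
  { intros s. unfold c. now rewrite hsp. }
  exists c, rho. split; [exact hc | ]. split; [ | split; [ | split]].
  - intros z. split.
    + intros [s ->]. exists (psi s). apply hC.
    + intros [th ->]. now exists (sig th).
  - intros th z. split.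
    + intros (s & t & e & -> & ne & hd). rewrite !hvel in hd. rewrite hC in e, ne |- *.
      assert (hs : sin (psi t - psi s) = 0).
      { rewrite sin_minus. coords. pose proof (hr s); pose proof (hr t).
        apply Rmult_eq_reg_l with (r s * r t); [ | nra]. lra. }
      destruct (angular_injective c rho hc _ _ e) as [m hm].
      destruct (sin_zero_cases _ _ hs) as [j [hj | hj]].
      * exfalso. apply ne. rewrite e, hj. apply (angular_shift c rho hc).
      * rewrite hj, (angular_shift c rho hc), hm.
        replace (th + 2 * PI * IZR m + PI) with (th + PI + 2 * PI * IZR m) by ring.
        apply (angular_shift c rho hc).
    + intros ->. exists (sig th), (sig (th + PI)). split; [reflexivity | split; [reflexivity | split]].
      * intros e. pose proof PI_RGT_0.
        assert (h : th < th + PI < th + 2 * PI) by lra.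
        apply (angular_convex c rho hc) in h. rewrite e in h. coords. lra.
      * rewrite !hvel'. coords. rewrite neg_cos, neg_sin. ring.
  - intros th z (t & hvt & hd).
    assert (e : C t = c th).
    { apply (oval_same_tangent t (sig th) (norm (velocity C t)) (r (sig th)) th); auto.
      rewrite norm_pair. apply sqrt_lt_R0, oval_speed_pos. }
    rewrite hvt, e in hd.
    assert (hn : 0 < norm (velocity C t)) by (rewrite norm_pair; apply sqrt_lt_R0, oval_speed_pos).
    set (q := norm (velocity C t)) in *. clearbody q. coords.
    apply Rmult_eq_reg_l with q; lra.
  - intros p [hp [M hM]] th. apply Rnot_le_lt. intros hle.
    (* Otherwise the ray leaving [p] along the outer normal avoids the curve;
       at speed [|M| + |p| + 1] it is out of the ball of radius [M] at time 1. *)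
    set (f := fun s : R => (fst p + s * (Rabs M + norm p + 1) * sin th,
                            snd p - s * (Rabs M + norm p + 1) * cos th)).
    assert (hb : 0 < Rabs M + norm p + 1).
    { pose proof (Rabs_pos M). pose proof (norm_ge_0 p). lra. }
    set (b := Rabs M + norm p + 1) in *.
    assert (hfM : norm (f 1) <= M).
    { apply hM.
      - intros s. apply (continuous_comp_2 (fun s => fst p + s * b * sin th)
          (fun s => snd p - s * b * cos th) (fun u w => (u, w))).
        + apply is_derive_continuous with (b * sin th). auto_derive; [exact I | ring].
        + apply is_derive_continuous with (- (b * cos th)). auto_derive; [exact I | ring].
        + apply continuous_ext with (fun z : R * R => z); [now intros [] | apply continuous_id].
      - unfold f. rewrite !Rmult_0_l, Rplus_0_r, Rminus_0_r. now destruct p.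
      - intros s hs [t e].
        destruct (Req_dec s 0) as [-> | hs0].
        + apply hp. exists t. rewrite <- e. unfold f.
          rewrite !Rmult_0_l, Rplus_0_r, Rminus_0_r. now destruct p.
        + rewrite hC in e.
          assert (hge : 0 <= det (unit_vec th) (minus (c (psi t)) (c th))).
          { destruct (shift_into (psi t) th) as [m hm].
            rewrite <- (angular_shift c rho hc (psi t) m).
            destruct (Req_dec (psi t + 2 * PI * IZR m) (th + 2 * PI)) as [-> | ne].
            - rewrite (angular_periodic c rho hc). coords. lra.
            - left. apply (angular_convex c rho hc). lra. }
          rewrite <- e in hge. unfold f in hge. coords.
          pose proof (sin2_cos2 th) as h1; unfold Rsqr in h1.
          assert (0 < s * b) by nra.
          assert (cos th * (snd p - s * b * cos th - snd (c th)) - sin th * (fst p + s * b * sin th - fst (c th))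
             = cos th * (snd p - snd (c th)) - sin th * (fst p - fst (c th)) - s * b) as E.
          { transitivity (cos th * (snd p - snd (c th)) - sin th * (fst p - fst (c th)) - s * b * (sin th * sin th + cos th * cos th)); [ring | rewrite h1; ring]. }
          lra. }
    assert (hf1 : b <= norm (f 1) + norm p).
    { replace b with (norm (minus (f 1) p)).
      - unfold minus. eapply Rle_trans; [apply (norm_triangle (f 1) (opp p)) | ].
        apply Rplus_le_compat_l. right. apply (norm_opp p).
      - rewrite norm_pair, fst_minus, snd_minus. unfold f; cbn [fst snd].
        pose proof (sin2_cos2 th) as h1; unfold Rsqr in h1.
        transitivity (sqrt (Rsqr b)); [ | apply sqrt_Rsqr; lra]. f_equal. unfold Rsqr.
        transitivity (b * b * (sin th * sin th + cos th * cos th)); [ring | rewrite h1; ring]. }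
    pose proof (Rle_abs M). unfold b in hf1. lra.
Qed.

End Oval.

(** * The oval seen from an interior point *)

(** Both the denominator of the envelope point of the chord [a b], whose ends move
    with velocities [da] and [db], and the expression whose sign says that the
    chord turns. *)
Definition weight (a b da db : R * R) : R := det (minus b a) (minus db da).

Section Radial.

Variables (c : R -> R * R) (rho : R -> R) (p : R * R).
Hypothesis hc : angular_curve c rho.

(** The distance from [p] to the tangent of direction [th]. *)
Definition height (th : R) : R := det (unit_vec th) (minus p (c th)).

Hypothesis hp : forall th, 0 < height th.

Lemma height_shift (th : R) (m : Z) : height (th + 2 * PI * IZR m) = height th.
Proof.
  unfold height. rewrite (angular_shift c rho hc). coords.
  now destruct (trig_shift th m) as [-> ->].
Qed.

Lemma height_continuous (th : R) : continuous height th.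
Proof.
  apply continuous_ext with
    (fun th => cos th * (snd p - snd (c th)) - sin th * (fst p - fst (c th))).
  { reflexivity. }
  pose proof (is_derive_continuous _ _ _ (angular_x c rho hc th)) as h1.
  pose proof (is_derive_continuous _ _ _ (angular_y c rho hc th)) as h2.
  apply (continuous_minus (V := R_NormedModule)); apply (continuous_mult (K := R_AbsRing)).
  - apply continuous_cos.
  - apply (continuous_minus (V := R_NormedModule)); [apply continuous_const | exact h2].
  - apply continuous_sin.
  - apply (continuous_minus (V := R_NormedModule)); [apply continuous_const | exact h1].
Qed.

(** Of two points of the curve on one ray, each is on the inner side of the
    tangent at the other, so neither is farther from [p]. *)
Lemma radial_unique (phi psi t r r' : R) : 0 < r -> 0 < r' ->
  c phi = plus p (scal r (unit_vec t)) -> c psi = plus p (scal r' (unit_vec t)) ->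
  c phi = c psi.
Proof.
  assert (Hle : forall phi psi r r', 0 < r -> 0 < r' ->
    c phi = plus p (scal r (unit_vec t)) -> c psi = plus p (scal r' (unit_vec t)) -> r' <= r).
  { clear phi psi r r'. intros phi psi r r' hr hr' e1 e2.
    assert (h1 : 0 < sin (phi - t)).
    { pose proof (hp phi) as h. unfold height in h. rewrite e1 in h. coords.
      apply Rmult_lt_reg_l with r; [exact hr | ]. rewrite sin_minus. lra. }
    assert (hge : 0 <= det (unit_vec phi) (minus (c psi) (c phi))).
    { destruct (shift_into psi phi) as [m hm].
      rewrite <- (angular_shift c rho hc psi m).
      destruct (Req_dec (psi + 2 * PI * IZR m) (phi + 2 * PI)) as [-> | ne].
      - rewrite (angular_periodic c rho hc). coords. lra.
      - left. apply (angular_convex c rho hc). lra. }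
    rewrite e1, e2 in hge. coords.
    assert (0 <= (r - r') * sin (phi - t)) by (rewrite sin_minus; lra).
    nra. }
  intros hr hr' e1 e2.
  assert (r = r') as -> by (apply Rle_antisym; eapply Hle; eassumption).
  now rewrite e1, e2.
Qed.

(** [angular_inverse] applied to [c - p] gives [alpha] up to a multiple of
    [2 * PI].  That [alpha t - t] stays between [0] and [PI] holds by continuity:
    at these values the tangent at [c (alpha t)] would contain [p]. *)
Lemma radial_angle : exists alpha : R -> R,
  (forall t, t < alpha t < t + PI) /\
  (forall t, c (alpha t) =
     plus p (scal (height (alpha t) / sin (alpha t - t)) (unit_vec t))) /\
  (forall t, is_derive alpha t
     (height (alpha t) / (rho (alpha t) * (sin (alpha t - t) * sin (alpha t - t))))).
Proof.
  pose proof PI_RGT_0 as hpi.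
  set (w1 := fun s => fst (c s) - fst p). set (w2 := fun s => snd (c s) - snd p).
  set (a1 := fun s => rho s * cos s). set (a2 := fun s => rho s * sin s).
  assert (d1 : forall s, is_derive w1 s (a1 s)).
  { intros s. apply is_derive_value with (a1 s - 0); [ | ring].
    apply (is_derive_minus (fun s => fst (c s)) (fun _ => fst p)).
    - apply (angular_x c rho hc).
    - auto_derive; [exact I | ring]. }
  assert (d2 : forall s, is_derive w2 s (a2 s)).
  { intros s. apply is_derive_value with (a2 s - 0); [ | ring].
    apply (is_derive_minus (fun s => snd (c s)) (fun _ => snd p)).
    - apply (angular_y c rho hc).
    - auto_derive; [exact I | ring]. }
  assert (p1 : forall s, w1 (s + 2 * PI) = w1 s)
    by (intros s; unfold w1; now rewrite (angular_periodic c rho hc)).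
  assert (p2 : forall s, w2 (s + 2 * PI) = w2 s)
    by (intros s; unfold w2; now rewrite (angular_periodic c rho hc)).
  pose proof (derive_periodic w1 a1 _ d1 p1) as q1.
  pose proof (derive_periodic w2 a2 _ d2 p2) as q2.
  assert (hdet : forall s, w1 s * a2 s - w2 s * a1 s = rho s * height s).
  { intros s. unfold w1, w2, a1, a2, height. coords. ring. }
  destruct (angular_inverse w1 w2 a1 a2 (2 * PI)) as (psi & sig & hw & hps & _ & dsig); auto.
  { lra. }
  { intros s. apply (continuous_mult (K := R_AbsRing));
      [apply (angular_continuous c rho hc) | apply continuous_cos]. }
  { intros s. apply (continuous_mult (K := R_AbsRing));
      [apply (angular_continuous c rho hc) | apply continuous_sin]. }
  { intros s. rewrite hdet. apply Rmult_lt_0_compat; [apply (angular_pos c rho hc) | apply hp]. }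
  set (r := fun t => sqrt (w1 (sig t) * w1 (sig t) + w2 (sig t) * w2 (sig t))).
  assert (hrt : forall t, w1 (sig t) = r t * cos t /\ w2 (sig t) = r t * sin t).
  { intros t. destruct (hw (sig t)) as [e1 e2]. rewrite hps in e1, e2. now split. }
  assert (hr0 : forall t, 0 <= r t) by (intros t; apply sqrt_pos).
  assert (hH : forall t, height (sig t) = r t * sin (sig t - t)).
  { intros t. destruct (hrt t) as [e1 e2]. unfold w1, w2 in e1, e2.
    unfold height. coords. rewrite sin_minus.
    replace (fst p) with (fst (c (sig t)) - r t * cos t) by lra.
    replace (snd p) with (snd (c (sig t)) - r t * sin t) by lra. ring. }
  assert (hs : forall t, 0 < sin (sig t - t)).
  { intros t. specialize (hH t). pose proof (hp (sig t)) as h. specialize (hr0 t). nra. }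
  destruct (shift_into (sig 0) 0) as [m hm].
  assert (hsm : forall t, sin (sig t + 2 * PI * IZR m - t) = sin (sig t - t)).
  { intros t. replace (sig t + 2 * PI * IZR m - t) with (sig t - t + 2 * PI * IZR m) by ring.
    apply trig_shift. }
  exists (fun t => sig t + 2 * PI * IZR m).
  assert (hcont : continuity (fun t => sig t + 2 * PI * IZR m - t)).
  { intros t. apply continuity_pt_filterlim.
    apply (continuous_minus (V := R_NormedModule)); [ | apply continuous_id].
    apply (continuous_plus (V := R_NormedModule)); [ | apply continuous_const].
    eapply is_derive_continuous; apply dsig. }
  assert (h0 : 0 < sig 0 + 2 * PI * IZR m - 0 < PI).
  { split; [lra | ]. apply Rnot_le_lt. intros h.
    assert (sin (sig 0 + 2 * PI * IZR m - 0) <= 0) by (apply sin_le_0; lra).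
    specialize (hsm 0); specialize (hs 0). lra. }
  split; [ | split].
  - intros t.
    assert (hno : forall y, sin y = 0 -> forall t, sig t + 2 * PI * IZR m - t <> y).
    { intros y hy s e. specialize (hsm s); specialize (hs s). rewrite e in hsm. lra. }
    split; apply Rnot_le_lt; intros h.
    + destruct (IVT_gen _ 0 t 0 hcont) as [s [_ e]].
      * rewrite Rmin_right, Rmax_left by lra. lra.
      * exact (hno 0 sin_0 s e).
    + destruct (IVT_gen _ 0 t PI hcont) as [s [_ e]].
      * rewrite Rmin_left, Rmax_right by lra. lra.
      * exact (hno PI sin_PI s e).
  - intros t. rewrite (angular_shift c rho hc), height_shift, hsm, hH.
    specialize (hs t). destruct (hrt t) as [e1 e2]. unfold w1, w2 in e1, e2.
    replace (r t * sin (sig t - t) / sin (sig t - t)) with (r t) by (field; lra).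
    apply injective_projections; coords; lra.
  - intros t. rewrite height_shift, hsm.
    assert (hrho : rho (sig t + 2 * PI * IZR m) = rho (sig t)).
    { (* [q1] and [q2] are the periodicity of [rho cos] and [rho sin]. *)
      apply periodic_shift. clear t. intros s.
      specialize (q1 s); specialize (q2 s). unfold a1, a2 in q1, q2.
      rewrite cos_2PI_plus in q1 || rewrite cos_plus, cos_2PI, sin_2PI in q1.
      rewrite sin_plus, cos_2PI, sin_2PI in q2.
      pose proof (sin2_cos2 s) as h; unfold Rsqr in h.
      transitivity (rho (s + 2 * PI) * (sin s * sin s + cos s * cos s)); [rewrite h; ring | ].
      transitivity (sin s * (rho s * sin s) + cos s * (rho s * cos s));
        [rewrite <- q1, <- q2; ring | ].
      transitivity (rho s * (sin s * sin s + cos s * cos s)); [ring | rewrite h; ring]. }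
    rewrite hrho.
    eapply is_derive_value.
    + apply (is_derive_plus sig (fun _ => 2 * PI * IZR m)); [apply dsig | ].
      instantiate (1 := 0). auto_derive; [exact I | ring].
    + rewrite hdet, hH. destruct (hrt t) as [-> ->].
      specialize (hs t). pose proof (angular_pos c rho hc (sig t)) as hrp.
      pose proof (hp (sig t)) as h. rewrite hH in h.
      assert (r t <> 0) by (intros e; rewrite e in h; lra).
      pose proof (sin2_cos2 t) as h1; unfold Rsqr in h1.
      replace (r t * cos t * (r t * cos t) + r t * sin t * (r t * sin t)) with (r t * r t)
        by (transitivity (r t * r t * (sin t * sin t + cos t * cos t)); [rewrite h1 | ]; ring).
      unfold plus; simpl. field. lra.
Qed.

Variable alpha : R -> R.
Hypothesis alpha_range : forall t, t < alpha t < t + PI.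
Hypothesis alpha_ray : forall t, c (alpha t) =
  plus p (scal (height (alpha t) / sin (alpha t - t)) (unit_vec t)).
Hypothesis alpha_derive : forall t, is_derive alpha t
  (height (alpha t) / (rho (alpha t) * (sin (alpha t - t) * sin (alpha t - t)))).

Lemma alpha_sin (t : R) : 0 < sin (alpha t - t).
Proof. specialize (alpha_range t). apply sin_gt_0; lra. Qed.

Lemma alpha_radius (t : R) : 0 < height (alpha t) / sin (alpha t - t).
Proof. apply Rdiv_lt_0_compat; [apply hp | apply alpha_sin]. Qed.

Lemma alpha_shift (t : R) (m : Z) : alpha (t + 2 * PI * IZR m) = alpha t + 2 * PI * IZR m.
Proof.
  assert (e : c (alpha (t + 2 * PI * IZR m)) = c (alpha t)).
  { eapply (radial_unique _ _ t);
      [apply alpha_radius | apply alpha_radius | | apply alpha_ray].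
    rewrite alpha_ray at 1. unfold unit_vec. now destruct (trig_shift t m) as [-> ->]. }
  destruct (angular_injective c rho hc _ _ e) as [j hj].
  pose proof PI_RGT_0 as hpi.
  pose proof (alpha_range t) as h1. pose proof (alpha_range (t + 2 * PI * IZR m)) as h2.
  assert (hz : (-1 < m + j < 1)%Z).
  { split; apply lt_IZR; rewrite plus_IZR; nra. }
  assert (E : IZR (m + j) = 0) by (apply f_equal; lia). rewrite plus_IZR in E. nra.
Qed.

Lemma ray_side_derive (t s : R) :
  is_derive (fun s => det (unit_vec t) (minus (c s) p)) s (rho s * sin (s - t)).
Proof.
  eapply is_derive_value; [apply (chord_component_derive c rho hc) | ].
  simpl. rewrite sin_minus. ring.
Qed.

Lemma ray_side_alpha (t : R) : det (unit_vec t) (minus (c (alpha t)) p) = 0.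
Proof. rewrite alpha_ray. coords. ring. Qed.

(** The ray of direction [t] has [c th] on its right for [th] just before
    [alpha t], and on its left just after; the sign changes only once in a half
    turn.  This compares [alpha t] with the direction of an edge without any
    estimate. *)
Lemma le_alpha (t th : R) : th <= t + PI ->
  det (unit_vec t) (minus (c th) p) <= 0 -> th <= alpha t.
Proof.
  intros h hd. apply Rnot_lt_le. intros hlt.
  pose proof (ray_side_alpha t) as e. pose proof (alpha_range t).
  assert (0 < det (unit_vec t) (minus (c th) p)); [ | lra].
  rewrite <- e. apply (derive_pos_increasing _ _ _ _ (ray_side_derive t)); [ | exact hlt].
  intros x hx. apply Rmult_lt_0_compat; [apply (angular_pos c rho hc) | apply sin_gt_0; lra].
Qed.

Lemma alpha_le (t th : R) : t <= th ->
  0 <= det (unit_vec t) (minus (c th) p) -> alpha t <= th.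
Proof.
  intros h hd. apply Rnot_lt_le. intros hlt.
  pose proof (ray_side_alpha t) as e. pose proof (alpha_range t).
  assert (det (unit_vec t) (minus (c th) p) < 0); [ | lra].
  rewrite <- e. apply (derive_pos_increasing _ _ _ _ (ray_side_derive t)); [ | exact hlt].
  intros x hx. apply Rmult_lt_0_compat; [apply (angular_pos c rho hc) | apply sin_gt_0; lra].
Qed.

Definition reflected (t : R) : R * R := c (alpha t + PI).

(** The point seen in the direction [t] moves with velocity
    [height / sin ^ 2 * unit_vec (alpha t)], and the involution multiplies
    velocities by minus the ratio of the radii of curvature. *)
Definition reflected_velocity (t : R) : R * R :=
  scal (- (rho (alpha t + PI) / rho (alpha t) *
           (height (alpha t) / (sin (alpha t - t) * sin (alpha t - t)))))
       (unit_vec (alpha t)).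

Lemma reflected_derive (t : R) :
  is_derive (fun s => fst (reflected s)) t (fst (reflected_velocity t)) /\
  is_derive (fun s => snd (reflected s)) t (snd (reflected_velocity t)).
Proof.
  pose proof (angular_pos c rho hc (alpha t)). pose proof (alpha_sin t).
  assert (ha : is_derive (fun s => alpha s + PI) t
     (height (alpha t) / (rho (alpha t) * (sin (alpha t - t) * sin (alpha t - t))))).
  { eapply is_derive_value.
    - apply (is_derive_plus alpha (fun _ => PI)); [apply alpha_derive | ].
      instantiate (1 := 0). auto_derive; [exact I | ring].
    - unfold plus; simpl. ring. }
  split; eapply is_derive_value.
  - apply (is_derive_comp (fun s => fst (c s)) (fun s => alpha s + PI));
      [apply (angular_x c rho hc) | exact ha].
  - unfold reflected_velocity. coords. rewrite neg_cos. unfold scal; simpl; unfold mult; simpl.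
    field. lra.
  - apply (is_derive_comp (fun s => snd (c s)) (fun s => alpha s + PI));
      [apply (angular_y c rho hc) | exact ha].
  - unfold reflected_velocity. coords. rewrite neg_sin. unfold scal; simpl; unfold mult; simpl.
    field. lra.
Qed.

(** The ends of the reflected chord move counterclockwise along the oval, and at
    each of them the chord points to the left of the tangent; so both terms of
    the weight are positive. *)
Lemma reflected_weight (t : R) :
  0 < weight (reflected t) (reflected (t + PI))
             (reflected_velocity t) (reflected_velocity (t + PI)).
Proof.
  pose proof (alpha_range t) as h1. pose proof (alpha_range (t + PI)) as h2.
  unfold weight, reflected, reflected_velocity.
  set (a := alpha t) in *. set (b := alpha (t + PI)) in *.
  assert (k1 : 0 < rho (a + PI) / rho a * (height a / (sin (a - t) * sin (a - t)))).
  { pose proof (alpha_sin t).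
    repeat (apply Rdiv_lt_0_compat || apply Rmult_lt_0_compat); auto;
      apply (angular_pos c rho hc). }
  assert (k2 : 0 < rho (b + PI) / rho b * (height b / (sin (b - (t + PI)) * sin (b - (t + PI))))).
  { pose proof (alpha_sin (t + PI)).
    repeat (apply Rdiv_lt_0_compat || apply Rmult_lt_0_compat); auto;
      apply (angular_pos c rho hc). }
  set (x := rho (a + PI) / rho a * _) in *. set (y := rho (b + PI) / rho b * _) in *.
  assert (c1 : 0 < det (unit_vec (a + PI)) (minus (c (b + PI)) (c (a + PI)))).
  { apply (angular_convex c rho hc). lra. }
  assert (c2 : 0 < det (unit_vec (b + PI)) (minus (c (a + PI)) (c (b + PI)))).
  { rewrite <- (angular_periodic c rho hc (a + PI)). apply (angular_convex c rho hc). lra. }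
  clearbody x y. coords. rewrite neg_cos, neg_sin in c1, c2.
  pose proof (Rmult_lt_0_compat _ _ k1 c1). pose proof (Rmult_lt_0_compat _ _ k2 c2). lra.
Qed.

End Radial.

(** * Envelope points of moving chords *)

Definition chord (a b : R * R) : R * R * R := cross (fst a, snd a, 1) (fst b, snd b, 1).

Definition chord_velocity (a b da db : R * R) : R * R * R :=
  (snd da - snd db, fst db - fst da,
   fst da * snd b + fst a * snd db - (snd da * fst b + snd a * fst db)).

(** The point of the line [a b] whose velocity is parallel to the line when it is
    attached affinely to the ends. *)
Definition envelope_of (a b da db : R * R) : R * R :=
  scal (/ weight a b da db)
    (minus (scal (det (minus b a) db) a) (scal (det (minus b a) da) b)).

Lemma chord_envelope (a b da db : R * R) (mu : R) : weight a b da db <> 0 ->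
  cross (scal mu (chord a b)) (scal mu (chord_velocity a b da db)) =
  (mu * mu * weight a b da db * fst (envelope_of a b da db),
   mu * mu * weight a b da db * snd (envelope_of a b da db),
   mu * mu * weight a b da db).
Proof.
  intros hw. destruct a as [a1 a2], b as [b1 b2], da as [x1 x2], db as [y1 y2].
  unfold envelope_of. coords. set (w := weight _ _ _ _) in *.
  assert (hw' : w = (b1 - a1) * (y2 - x2) - (b2 - a2) * (y1 - x1)) by reflexivity.
  unfold chord, chord_velocity, cross; cbn.
  apply injective_projections; [apply injective_projections | ]; cbn;
    unfold scal, mult; cbn; unfold mult; cbn.
  - match goal with |- _ = mu * mu * w * (/ w * ?X) =>
      transitivity (mu * mu * X); [ring | field; exact hw] end.
  - match goal with |- _ = mu * mu * w * (/ w * ?X) =>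
      transitivity (mu * mu * X); [ring | field; exact hw] end.
  - rewrite hw'. ring.
Qed.

(** Speaking of the line, and not of coordinates of it, this also records that
    [Phi] is single-valued up to scaling. *)
Definition image_is (Phi : R * R * R -> R * R * R -> Prop) (l : R * R * R) (a b : R * R) : Prop :=
  a <> b /\ forall m, Phi l m <-> (m <> (0, 0, 0) /\ on_line m a /\ on_line m b).

Lemma line_through (a b : R * R) (m : R * R * R) : a <> b ->
  (m <> (0, 0, 0) /\ on_line m a /\ on_line m b) <->
  exists mu, mu <> 0 /\ m = scal mu (chord a b).
Proof.
  intros hab. destruct m as [[x y] z], a as [a1 a2], b as [b1 b2].
  unfold on_line, chord, cross. cbn [fst snd].
  assert (hne : a2 - b2 <> 0 \/ b1 - a1 <> 0).
  { destruct (Req_dec (a2 - b2) 0); [ | tauto]. destruct (Req_dec (b1 - a1) 0); [ | tauto].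
    exfalso. apply hab. f_equal; lra. }
  assert (E : forall mu, scal mu (a2 * 1 - 1 * b2, 1 * b1 - a1 * 1, a1 * b2 - a2 * b1) =
    (mu * (a2 - b2), mu * (b1 - a1), mu * (a1 * b2 - a2 * b1)) :> R * R * R).
  { intros mu. apply injective_projections; [apply injective_projections | ]; cbn;
      unfold scal, mult; cbn; unfold mult; cbn; ring. }
  split.
  - intros (hm & h1 & h2).
    assert (hxy : exists mu, x = mu * (a2 - b2) /\ y = mu * (b1 - a1)).
    { destruct hne as [hne | hne].
      - exists (x / (a2 - b2)). split; [field; exact hne | ].
        apply Rmult_eq_reg_r with (a2 - b2); [ | exact hne]. field_simplify; [lra | exact hne].
      - exists (y / (b1 - a1)). split; [ | field; exact hne].
        apply Rmult_eq_reg_r with (b1 - a1); [ | exact hne]. field_simplify; [lra | exact hne]. }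
    destruct hxy as (mu & -> & ->). exists mu.
    assert (hz : z = mu * (a1 * b2 - a2 * b1)) by lra.
    split; [ | now rewrite E, hz].
    intros ->. apply hm. rewrite hz. now rewrite !Rmult_0_l.
  - intros (mu & hmu & e). rewrite E in e. injection e as -> -> ->.
    split; [ | split; ring]. intros e. injection e as e1 e2 e3.
    destruct hne as [hne | hne]; apply hne; apply Rmult_eq_reg_l with mu; lra.
Qed.

Definition moves (g : R -> R * R) (t : R) (d : R * R) : Prop :=
  is_derive (fun s => fst (g s)) t (fst d) /\ is_derive (fun s => snd (g s)) t (snd d).

Lemma chord_moves (g1 g2 : R -> R * R) (t mu : R) (d1 d2 : R * R) :
  moves g1 t d1 -> moves g2 t d2 ->
  let l s := scal mu (chord (g1 s) (g2 s)) in
  let l' := scal mu (chord_velocity (g1 t) (g2 t) d1 d2) in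
  is_derive (fun s => fst (fst (l s))) t (fst (fst l')) /\
  is_derive (fun s => snd (fst (l s))) t (snd (fst l')) /\
  is_derive (fun s => snd (l s)) t (snd l').
Proof.
  intros [h1 h2] [h3 h4].
  set (x1 := fun s => fst (g1 s)) in *. set (y1 := fun s => snd (g1 s)) in *.
  set (x2 := fun s => fst (g2 s)) in *. set (y2 := fun s => snd (g2 s)) in *.
  assert (E : forall (f g : R -> R) (l l' : R), (forall s, f s = g s) -> is_derive f t l ->
    l = l' -> is_derive g t l').
  { intros f g l l' hfg hf <-. now apply is_derive_ext with f. }
  split; [ | split].
  - apply (E (fun s => mu * (y1 s - y2 s)) _ (mu * (snd d1 - snd d2))).
    + intros s. unfold y1, y2, chord, cross; cbn; unfold scal, mult; cbn; unfold mult; cbn. ring.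
    + apply (is_derive_scal (fun s => y1 s - y2 s)). now apply (is_derive_minus y1 y2).
    + reflexivity.
  - apply (E (fun s => mu * (x2 s - x1 s)) _ (mu * (fst d2 - fst d1))).
    + intros s. unfold x1, x2, chord, cross; cbn; unfold scal, mult; cbn; unfold mult; cbn. ring.
    + apply (is_derive_scal (fun s => x2 s - x1 s)). now apply (is_derive_minus x2 x1).
    + reflexivity.
  - apply (E (fun s => mu * (x1 s * y2 s - y1 s * x2 s)) _
      (mu * ((fst d1 * y2 t + x1 t * snd d2) - (snd d1 * x2 t + y1 t * fst d2)))).
    + intros s. reflexivity.
    + apply (is_derive_scal (fun s => x1 s * y2 s - y1 s * x2 s)).
      apply (is_derive_minus (fun s => x1 s * y2 s) (fun s => y1 s * x2 s)).
      * apply (is_derive_mult x1 y2); auto. intros; apply Rmult_comm.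
      * apply (is_derive_mult y1 x2); auto. intros; apply Rmult_comm.
    + reflexivity.
Qed.

Lemma norm_triple_le (v : R * R * R) :
  norm v <= Rabs (fst (fst v)) + Rabs (snd (fst v)) + Rabs (snd v).
Proof.
  assert (h : forall a b : R, 0 <= a -> 0 <= b -> sqrt (a ^ 2 + b ^ 2) <= a + b).
  { intros a b ha hb. rewrite <- (sqrt_Rsqr (a + b)) by lra. apply sqrt_le_1_alt.
    unfold Rsqr. nra. }
  destruct v as [[x y] z].
  change (sqrt (sqrt (Rabs x ^ 2 + Rabs y ^ 2) ^ 2 + Rabs z ^ 2) <= Rabs x + Rabs y + Rabs z).
  eapply Rle_trans; [apply h; [apply sqrt_pos | apply Rabs_pos] | ].
  apply Rplus_le_compat_r. apply h; apply Rabs_pos.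
Qed.

Lemma norm_triple_ge (v : R * R * R) :
  Rabs (fst (fst v)) <= norm v /\ Rabs (snd (fst v)) <= norm v /\ Rabs (snd v) <= norm v.
Proof.
  assert (h : forall a b : R, 0 <= a -> 0 <= b -> a <= sqrt (a ^ 2 + b ^ 2) /\ b <= sqrt (a ^ 2 + b ^ 2)).
  { intros a b ha hb. split.
    - rewrite <- (sqrt_Rsqr a) at 1 by lra. apply sqrt_le_1_alt. unfold Rsqr. nra.
    - rewrite <- (sqrt_Rsqr b) at 1 by lra. apply sqrt_le_1_alt. unfold Rsqr. nra. }
  destruct v as [[x y] z]. cbn [fst snd].
  change (norm (x, y, z)) with (sqrt (sqrt (Rabs x ^ 2 + Rabs y ^ 2) ^ 2 + Rabs z ^ 2)).
  destruct (h (Rabs x) (Rabs y)) as [h1 h2]; try apply Rabs_pos.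
  destruct (h (sqrt (Rabs x ^ 2 + Rabs y ^ 2)) (Rabs z)) as [h3 h4];
    [apply sqrt_pos | apply Rabs_pos | ].
  repeat split; lra.
Qed.

(** Makes the definition of [filterdiff] usable for one-sided filters, which
    converge to [t] only. *)
Lemma filter_lim_unique (F : (R -> Prop) -> Prop) (t x : R) {FF : ProperFilter F} :
  filter_le F (locally t) -> is_filter_lim F x -> x = t.
Proof.
  intros hF hx. apply NNPP. intros ne.
  assert (he : 0 < Rabs (x - t) / 2) by (assert (0 < Rabs (x - t)) by (apply Rabs_pos_lt; lra); lra).
  assert (h1 : F (fun s => Rabs (s - x) < Rabs (x - t) / 2))
    by (apply hx; now exists (mkposreal _ he)).
  assert (h2 : F (fun s => Rabs (s - t) < Rabs (x - t) / 2))
    by (apply hF; now exists (mkposreal _ he)).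
  destruct (filter_ex _ (filter_and _ _ h1 h2)) as [s [h3 h4]].
  rewrite Rabs_minus_sym in h3. pose proof (Rabs_triang (x - s) (s - t)) as h5.
  replace (x - s + (s - t)) with (x - t) in h5 by ring. lra.
Qed.

Lemma envelope_exists (F : (R -> Prop) -> Prop) {FF : ProperFilter F}
  (l : R -> R * R * R) (g1 g2 : R -> R * R) (t mu : R) (d1 d2 : R * R) :
  filter_le F (locally t) -> mu <> 0 -> moves g1 t d1 -> moves g2 t d2 ->
  weight (g1 t) (g2 t) d1 d2 <> 0 ->
  F (fun s => l s = scal mu (chord (g1 s) (g2 s))) -> l t = scal mu (chord (g1 t) (g2 t)) ->
  envelope_point F l t (envelope_of (g1 t) (g2 t) d1 d2).
Proof.
  intros hF hmu h1 h2 hw hl ht.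
  exists (scal mu (chord_velocity (g1 t) (g2 t) d1 d2)). split.
  - split.
    { apply (is_linear_scal_l (K := R_AbsRing) (V := prod_NormedModule R_AbsRing
        (prod_NormedModule R_AbsRing R_NormedModule R_NormedModule) R_NormedModule)). }
    intros x hx. rewrite (filter_lim_unique F t x hF hx). clear x hx.
    destruct (chord_moves g1 g2 t mu d1 d2 h1 h2) as (k1 & k2 & k3).
    intros eps. set (L := fun s => scal mu (chord (g1 s) (g2 s)) : R * R * R) in *.
    set (L' := scal mu (chord_velocity (g1 t) (g2 t) d1 d2) : R * R * R) in *.
    assert (he : 0 < eps / 3) by (pose proof (cond_pos eps); lra).
    assert (K : forall (f : R -> R) d, is_derive f t d ->
      F (fun s => Rabs (f s - f t - (s - t) * d) <= eps / 3 * Rabs (s - t))).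
    { intros f d hf. apply hF. destruct hf as [_ hf].
      exact (hf t (fun P H => H) (mkposreal _ he)). }
    generalize (filter_and _ _ hl (filter_and _ _ (K _ _ k1) (filter_and _ _ (K _ _ k2) (K _ _ k3)))).
    apply filter_imp. intros s (e & e1 & e2 & e3). rewrite e, ht.
    eapply Rle_trans; [apply norm_triple_le | ].
    change (Rabs (fst (fst (L s)) - fst (fst (L t)) - (s - t) * fst (fst L')) +
            Rabs (snd (fst (L s)) - snd (fst (L t)) - (s - t) * snd (fst L')) +
            Rabs (snd (L s) - snd (L t) - (s - t) * snd L') <= eps * Rabs (s - t)).
    change (Rabs (fst (fst (L s)) - fst (fst (L t)) - (s - t) * fst (fst L')) <=
            eps / 3 * Rabs (s - t)) in e1.
    change (Rabs (snd (fst (L s)) - snd (fst (L t)) - (s - t) * snd (fst L')) <=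
            eps / 3 * Rabs (s - t)) in e2.
    change (Rabs (snd (L s) - snd (L t) - (s - t) * snd L') <= eps / 3 * Rabs (s - t)) in e3.
    lra.
  - exists (mu * mu * weight (g1 t) (g2 t) d1 d2). split.
    + repeat apply Rmult_integral_contrapositive_currified; auto.
    + rewrite ht. now apply chord_envelope.
Qed.

Lemma punctured_le (t : R) : filter_le (locally' t) (locally t).
Proof.
  intros P h. unfold locally', within. revert h. apply filter_imp. intros; assumption.
Qed.

(** Along a filter that avoids [t] derivatives are limits of difference quotients,
    to which the rules for limits of sums and products apply. *)
Definition slope_to (F : (R -> Prop) -> Prop) (f : R -> R) (t d : R) : Prop :=
  filterlim (fun s => (f s - f t) / (s - t)) F (locally d).

Lemma slope_of_derive (F : (R -> Prop) -> Prop) (f : R -> R) (t d : R) :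
  filter_le F (locally' t) -> is_derive f t d -> slope_to F f t d.
Proof.
  intros hF hf P [eps hP]. unfold filtermap. apply hF.
  apply is_derive_Reals in hf. destruct (hf eps (cond_pos eps)) as [del hd].
  exists del. intros s hs hne. apply hP.
  change (Rabs ((f s - f t) / (s - t) - d) < eps).
  replace (f s) with (f (t + (s - t))) by (f_equal; ring).
  apply hd; [lra | exact hs].
Qed.

(** [k] stands for the three coordinates. *)
Lemma slope_of_filterdiff (F : (R -> Prop) -> Prop) {FF : Filter F} (k : R * R * R -> R)
  (l : R -> R * R * R) (l' : R * R * R) (t : R) :
  (forall u v, k (minus u v) = k u - k v) -> (forall h u, k (scal h u) = h * k u) ->
  (forall u, Rabs (k u) <= norm u) ->
  filter_le F (locally' t) -> filterdiff l F (fun h : R => scal h l') ->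
  slope_to F (fun s => k (l s)) t (k l').
Proof.
  intros hk1 hk2 hk3 hF [_ hd] P [eps hP].
  assert (hlt : is_filter_lim F t).
  { intros Q hQ. apply hF, punctured_le, hQ. }
  assert (he : 0 < eps / 2) by (pose proof (cond_pos eps); lra).
  specialize (hd t hlt (mkposreal _ he)).
  assert (hne : F (fun s => s <> t)) by (apply hF; unfold locally', within; apply filter_forall; auto).
  unfold filtermap. generalize (filter_and _ _ hd hne). apply filter_imp.
  intros s [h ne]. apply hP.
  change (Rabs ((k (l s) - k (l t)) / (s - t) - k l') < eps).
  assert (h' : Rabs (k (l s) - k (l t) - (s - t) * k l') <= eps / 2 * Rabs (s - t)).
  { eapply Rle_trans; [ | exact h]. rewrite <- hk1, <- hk2, <- hk1. apply hk3. }
  replace ((k (l s) - k (l t)) / (s - t) - k l')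
    with ((k (l s) - k (l t) - (s - t) * k l') / (s - t)) by (field; lra).
  assert (hpos : 0 < Rabs (s - t)) by (apply Rabs_pos_lt; lra).
  unfold Rdiv. rewrite Rabs_mult, Rabs_inv.
  apply Rle_lt_trans with (eps / 2 * Rabs (s - t) * / Rabs (s - t)).
  - apply Rmult_le_compat_r; [left; now apply Rinv_0_lt_compat | exact h'].
  - rewrite Rmult_assoc, Rinv_r by lra. pose proof (cond_pos eps); lra.
Qed.

(** The Leibniz rule, for an identity known only along [F] and at [t]. *)
Lemma slope_identity (F : (R -> Prop) -> Prop) {FF : ProperFilter F} (x y z w : R -> R)
  (t x' y' z' w' : R) :
  filter_le F (locally' t) ->
  slope_to F x t x' -> slope_to F y t y' -> slope_to F z t z' -> slope_to F w t w' ->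
  continuous y t -> continuous w t ->
  F (fun s => x s * y s = z s * w s) -> x t * y t = z t * w t ->
  x' * y t + x t * y' = z' * w t + z t * w'.
Proof.
  intros hF hx hy hz hw cy cw hs ht.
  assert (hFt : filter_le F (locally t)).
  { intros Q hQ. apply hF, punctured_le, hQ. }
  assert (K : forall f g f' g', slope_to F f t f' -> slope_to F g t g' -> continuous g t ->
    filterlim (fun s => (f s - f t) / (s - t) * g s + f t * ((g s - g t) / (s - t))) F
      (locally (f' * g t + f t * g'))).
  { intros f g f' g' hf hg cg.
    eapply filterlim_comp_2; [ | | apply (filterlim_plus (V := R_NormedModule))].
    - eapply filterlim_comp_2; [exact hf | | apply (filterlim_mult (K := R_AbsRing))].
      eapply filterlim_filter_le_1; [exact hFt | exact cg].
    - eapply filterlim_comp_2; [apply filterlim_const | exact hg |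
        apply (filterlim_mult (K := R_AbsRing))]. }
  apply (filterlim_locally_unique (K := R_AbsRing) (V := R_NormedModule)
    (F := F) (fun s => (x s - x t) / (s - t) * y s + x t * ((y s - y t) / (s - t)))).
  - now apply K.
  - apply filterlim_ext_loc with
      (fun s => (z s - z t) / (s - t) * w s + z t * ((w s - w t) / (s - t))); [ | now apply K].
    assert (hne : F (fun s => s <> t)) by (apply hF; unfold locally', within; apply filter_forall; auto).
    generalize (filter_and _ _ hs hne). apply filter_imp. intros s [e ne].
    apply Rmult_eq_reg_r with (s - t); [ | lra].
    transitivity (z s * w s - z t * w t); [field; lra | ].
    rewrite <- e, <- ht. field; lra.
Qed.

(** The given coordinates [l] are proportional to the chord, but the factor need
    not be known to be differentiable.  Differentiating the three equations
    [cross l chord = 0] instead determines [cross l l'] up to a nonzero factor. *)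
Lemma envelope_unique (F : (R -> Prop) -> Prop) {FF : ProperFilter F}
  (l : R -> R * R * R) (g1 g2 : R -> R * R) (t : R) (d1 d2 z : R * R) :
  filter_le F (locally' t) -> moves g1 t d1 -> moves g2 t d2 ->
  weight (g1 t) (g2 t) d1 d2 <> 0 ->
  F (fun s => exists mu, l s = scal mu (chord (g1 s) (g2 s))) ->
  (exists mu, mu <> 0 /\ l t = scal mu (chord (g1 t) (g2 t))) ->
  envelope_point F l t z -> z = envelope_of (g1 t) (g2 t) d1 d2.
Proof.
  intros hF h1 h2 hw hl (mu & hmu & ht) (l' & hd & w' & hw' & E).
  destruct (chord_moves g1 g2 t 1 d1 d2 h1 h2) as (k1 & k2 & k3).
  set (L := fun s => scal 1 (chord (g1 s) (g2 s)) : R * R * R) in *.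
  set (L' := scal 1 (chord_velocity (g1 t) (g2 t) d1 d2) : R * R * R) in *.
  pose proof (chord_envelope (g1 t) (g2 t) d1 d2 1 hw) as E'.
  fold L' in E'. change (scal 1 (chord (g1 t) (g2 t))) with (L t) in E'.
  assert (hL : forall s m, scal m (chord (g1 s) (g2 s)) =
     (m * fst (fst (L s)), m * snd (fst (L s)), m * snd (L s)) :> R * R * R).
  { intros s m. unfold L. destruct (chord (g1 s) (g2 s)) as [[u v] w].
    apply injective_projections; [apply injective_projections | ]; cbn;
      unfold scal, mult; cbn; unfold mult; cbn; ring. }
  assert (s1 : slope_to F (fun s => fst (fst (l s))) t (fst (fst l'))).
  { apply (slope_of_filterdiff F (fun v => fst (fst v)) l l' t); auto. apply norm_triple_ge. }
  assert (s2 : slope_to F (fun s => snd (fst (l s))) t (snd (fst l'))).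
  { apply (slope_of_filterdiff F (fun v => snd (fst v)) l l' t); auto. apply norm_triple_ge. }
  assert (s3 : slope_to F (fun s => snd (l s)) t (snd l')).
  { apply (slope_of_filterdiff F (fun v => snd v) l l' t); auto. apply norm_triple_ge. }
  pose proof (slope_of_derive F _ t _ hF k1) as r1.
  pose proof (slope_of_derive F _ t _ hF k2) as r2.
  pose proof (slope_of_derive F _ t _ hF k3) as r3.
  pose proof (is_derive_continuous _ _ _ k1) as c1.
  pose proof (is_derive_continuous _ _ _ k2) as c2.
  pose proof (is_derive_continuous _ _ _ k3) as c3.
  (* [l] and [L] are parallel; so are their first order variations. *)
  assert (i1 := slope_identity F _ _ _ _ t _ _ _ _ hF s2 r3 s3 r2 c3 c2).
  assert (i2 := slope_identity F _ _ _ _ t _ _ _ _ hF s3 r1 s1 r3 c1 c3).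
  assert (i3 := slope_identity F _ _ _ _ t _ _ _ _ hF s1 r2 s2 r1 c2 c1).
  cbv beta in i1, i2, i3.
  rewrite (eq_trans ht (hL t mu)) in E, i1, i2, i3. cbn [fst snd] in i1, i2, i3.
  assert (j1 : F (fun s => snd (fst (l s)) * snd (L s) = snd (l s) * snd (fst (L s)))).
  { revert hl. apply filter_imp. intros s [m e]. rewrite (eq_trans e (hL s m)). cbn [fst snd]. ring. }
  assert (j2 : F (fun s => snd (l s) * fst (fst (L s)) = fst (fst (l s)) * snd (L s))).
  { revert hl. apply filter_imp. intros s [m e]. rewrite (eq_trans e (hL s m)). cbn [fst snd]. ring. }
  assert (j3 : F (fun s => fst (fst (l s)) * snd (fst (L s)) = snd (fst (l s)) * fst (fst (L s)))).
  { revert hl. apply filter_imp. intros s [m e]. rewrite (eq_trans e (hL s m)). cbn [fst snd]. ring. }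
  assert (n1 : mu * snd (fst (L t)) * snd (L t) = mu * snd (L t) * snd (fst (L t))) by ring.
  assert (n2 : mu * snd (L t) * fst (fst (L t)) = mu * fst (fst (L t)) * snd (L t)) by ring.
  assert (n3 : mu * fst (fst (L t)) * snd (fst (L t)) = mu * snd (fst (L t)) * fst (fst (L t)))
    by ring.
  specialize (i1 j1 n1). specialize (i2 j2 n2). specialize (i3 j3 n3).
  change (snd (fst l') * snd (L t) + mu * snd (fst (L t)) * snd L' =
          snd l' * snd (fst (L t)) + mu * snd (L t) * snd (fst L')) in i1.
  change (snd l' * fst (fst (L t)) + mu * snd (L t) * fst (fst L') =
          fst (fst l') * snd (L t) + mu * fst (fst (L t)) * snd L') in i2.
  change (fst (fst l') * snd (fst (L t)) + mu * fst (fst (L t)) * snd (fst L') =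
          snd (fst l') * fst (fst (L t)) + mu * snd (fst (L t)) * fst (fst L')) in i3.
  set (W := weight _ _ _ _) in *. set (Z := envelope_of _ _ _ _) in *.
  clearbody Z W. clear - i1 i2 i3 E E' hw hw' hmu.
  destruct (L t) as [[a b] c]. clearbody L'. destruct L' as [[a' b'] c'], l' as [[x y] u].
  destruct z as [z1 z2], Z as [Z1 Z2].
  unfold cross in E, E'. cbn [fst snd] in *. injection E as e1 e2 e3. injection E' as f1 f2 f3.
  assert (q1 : w' * z1 = mu * mu * (W * Z1)) by (rewrite <- e1; nra).
  assert (q2 : w' * z2 = mu * mu * (W * Z2)) by (rewrite <- e2; nra).
  assert (q3 : w' = mu * mu * W) by (rewrite <- e3; nra).
  rewrite q3 in q1, q2.
  assert (mu * mu * W <> 0) by (rewrite <- q3; exact hw').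
  f_equal; apply Rmult_eq_reg_l with (mu * mu * W); lra.
Qed.

(** * Line families and their envelopes *)

Lemma at_left_le (t : R) : filter_le (at_left t) (locally' t).
Proof.
  intros P h. unfold at_left, locally', within in *. revert h. apply filter_imp.
  intros s h hs. apply h. lra.
Qed.

Lemma at_right_le (t : R) : filter_le (at_right t) (locally' t).
Proof.
  intros P h. unfold at_right, locally', within in *. revert h. apply filter_imp.
  intros s h hs. apply h. lra.
Qed.

Lemma two_sided_envelope (l : R -> R * R * R) (t : R) (z : R * R) :
  envelope_point (locally t) l t z -> envelope_point (at_right t) l t z.
Proof.
  intros (l' & [hlin hd] & hz). exists l'. split; [ | exact hz]. split; [exact hlin | ].
  intros x hx eps.
  rewrite (filter_lim_unique (at_right t) t x); [ | | exact hx].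
  - apply at_right_le, punctured_le. exact (hd t (fun P h => h) eps).
  - intros P h. now apply at_right_le, punctured_le.
Qed.

Section Family.

Variables (Phi : R * R * R -> R * R * R -> Prop) (p : R * R).

Definition image_along (F : (R -> Prop) -> Prop) (g1 g2 : R -> R * R) : Prop :=
  F (fun s => image_is Phi (pencil p s) (g1 s) (g2 s)).

Lemma family_envelope (F : (R -> Prop) -> Prop) {FF : ProperFilter F}
  (l : R -> R * R * R) (g1 g2 : R -> R * R) (t : R) (d1 d2 z : R * R) :
  filter_le F (locally' t) -> moves g1 t d1 -> moves g2 t d2 ->
  weight (g1 t) (g2 t) d1 d2 <> 0 ->
  image_is Phi (pencil p t) (g1 t) (g2 t) -> image_along F g1 g2 ->
  line_family Phi p l -> envelope_point F l t z ->
  z = envelope_of (g1 t) (g2 t) d1 d2.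
Proof.
  intros hF h1 h2 hw ht hs hl. apply (envelope_unique F); auto.
  - unfold image_along in hs. revert hs. apply filter_imp. intros s [hne hs].
    destruct (proj1 (line_through _ _ _ hne) (proj1 (hs _) (hl s))) as (mu & _ & e).
    now exists mu.
  - destruct ht as [hne ht]. exact (proj1 (line_through _ _ _ hne) (proj1 (ht _) (hl t))).
Qed.

Lemma image_chord (s mu : R) (a b : R * R) :
  image_is Phi (pencil p s) a b -> mu <> 0 -> Phi (pencil p s) (scal mu (chord a b)).
Proof.
  intros [hne h] hmu. apply h, (line_through a b _ hne). now exists mu.
Qed.

Hypothesis Phi_total : forall s, exists m, Phi (pencil p s) m.

(** The two one-sided chords at [t] are the same line, but not with the same
    coordinates; rescaling one of them by the constant [mu] makes the family
    continuous at [t].  Away from [t] any choice of coordinates will do. *)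
Lemma one_sided_envelopes (gl1 gl2 gr1 gr2 : R -> R * R) (t : R) (dl1 dl2 dr1 dr2 : R * R) :
  moves gl1 t dl1 -> moves gl2 t dl2 -> weight (gl1 t) (gl2 t) dl1 dl2 <> 0 ->
  image_is Phi (pencil p t) (gl1 t) (gl2 t) -> image_along (at_left t) gl1 gl2 ->
  moves gr1 t dr1 -> moves gr2 t dr2 -> weight (gr1 t) (gr2 t) dr1 dr2 <> 0 ->
  image_is Phi (pencil p t) (gr1 t) (gr2 t) -> image_along (at_right t) gr1 gr2 ->
  exists l, line_family Phi p l /\
    envelope_point (at_left t) l t (envelope_of (gl1 t) (gl2 t) dl1 dl2) /\
    envelope_point (at_right t) l t (envelope_of (gr1 t) (gr2 t) dr1 dr2).
Proof.
  intros hl1 hl2 hlw hlt hls hr1 hr2 hrw hrt hrs.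
  destruct (choice _ Phi_total) as [l0 hl0].
  pose proof (image_chord t 1 _ _ hlt R1_neq_R0) as hm.
  destruct (proj1 (line_through _ _ _ (proj1 hrt)) (proj1 (proj2 hrt _) hm)) as (mu & hmu & e).
  set (l := fun s => if Rlt_dec s t
    then if excluded_middle_informative (image_is Phi (pencil p s) (gl1 s) (gl2 s))
         then scal 1 (chord (gl1 s) (gl2 s)) else l0 s
    else if excluded_middle_informative (image_is Phi (pencil p s) (gr1 s) (gr2 s))
         then scal mu (chord (gr1 s) (gr2 s)) else l0 s).
  assert (ht : l t = scal mu (chord (gr1 t) (gr2 t))).
  { unfold l. destruct (Rlt_dec t t); [lra | ].
    destruct (excluded_middle_informative _); tauto. }
  exists l. split; [ | split].
  - intros s. unfold l. destruct (Rlt_dec s t);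
      destruct (excluded_middle_informative _) as [h | h]; auto;
      apply image_chord; auto using R1_neq_R0.
  - apply (envelope_exists (at_left t) l gl1 gl2 t 1); auto using R1_neq_R0.
    + intros P h. now apply at_left_le, punctured_le.
    + unfold image_along, at_left, within in hls |- *. revert hls. apply filter_imp.
      intros s h hs. specialize (h hs). unfold l. destruct (Rlt_dec s t); [ | tauto].
      destruct (excluded_middle_informative _); tauto.
    + now rewrite ht, <- e.
  - apply (envelope_exists (at_right t) l gr1 gr2 t mu); auto.
    + intros P h. now apply at_right_le, punctured_le.
    + unfold image_along, at_right, within in hrs |- *. revert hrs. apply filter_imp.
      intros s h hs. specialize (h hs). unfold l. destruct (Rlt_dec s t); [lra | ].
      destruct (excluded_middle_informative _); tauto.
Qed.

Lemma two_sided_envelope_exists (g1 g2 : R -> R * R) (t : R) (d1 d2 : R * R) :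
  moves g1 t d1 -> moves g2 t d2 -> weight (g1 t) (g2 t) d1 d2 <> 0 ->
  image_along (locally t) g1 g2 ->
  exists l, line_family Phi p l /\
    envelope_point (locally t) l t (envelope_of (g1 t) (g2 t) d1 d2).
Proof.
  intros h1 h2 hw hs.
  destruct (choice _ Phi_total) as [l0 hl0].
  set (l := fun s => if excluded_middle_informative (image_is Phi (pencil p s) (g1 s) (g2 s))
         then scal 1 (chord (g1 s) (g2 s)) else l0 s).
  exists l. split.
  - intros s. unfold l. destruct (excluded_middle_informative _) as [h | h]; auto.
    apply image_chord; auto using R1_neq_R0.
  - apply (envelope_exists (locally t) l g1 g2 t 1); auto using R1_neq_R0.
    + intros P h; exact h.
    + unfold image_along in hs. revert hs. apply filter_imp. intros s h. unfold l.
      destruct (excluded_middle_informative _); tauto.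
    + unfold image_along in hs. apply locally_singleton in hs. unfold l.
      destruct (excluded_middle_informative _); tauto.
Qed.

End Family.

Lemma weight_distinct (a b da db : R * R) : weight a b da db <> 0 -> a <> b.
Proof. intros h e. apply h. rewrite e. unfold weight. coords. ring. Qed.

Lemma moves_shift (g : R -> R * R) (t k : R) (v : R * R) :
  moves g (t + k) v -> moves (fun s => g (s + k)) t v.
Proof.
  assert (H : forall (f : R -> R) l, is_derive f (t + k) l -> is_derive (fun s => f (s + k)) t l).
  { intros f l h. apply is_derive_value with (1 * l); [ | ring].
    apply (is_derive_comp f (fun s => s + k)); [exact h | ].
    auto_derive; [exact I | ring]. }
  intros [h1 h2]. split; [apply (H _ _ h1) | apply (H _ _ h2)].
Qed.

Lemma locally_shift (t k : R) (Q : R -> Prop) :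
  locally (t + k) Q -> locally t (fun s => Q (s + k)).
Proof.
  intros [e h]. exists e. intros s hs. apply h.
  change (Rabs (s + k - (t + k)) < e). replace (s + k - (t + k)) with (s - t) by ring. exact hs.
Qed.

Lemma at_right_shift (t k : R) (Q : R -> Prop) :
  at_right (t + k) Q -> at_right t (fun s => Q (s + k)).
Proof.
  intros h. unfold at_right, within in *.
  generalize (locally_shift t k _ h). apply filter_imp. intros s hs hlt. apply hs. lra.
Qed.

Lemma at_left_shift (t k : R) (Q : R -> Prop) :
  at_left (t + k) Q -> at_left t (fun s => Q (s + k)).
Proof.
  intros h. unfold at_left, within in *.
  generalize (locally_shift t k _ h). apply filter_imp. intros s hs hlt. apply hs. lra.
Qed.

Lemma opposite_ray (p : R * R) (t r : R) :
  plus p (scal r (unit_vec t)) = plus p (scal (- r) (unit_vec (t + PI))) :> R * R.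
Proof. apply injective_projections; coords; rewrite ?neg_cos, ?neg_sin; ring. Qed.

(** * Tangents at nearby points *)

Lemma on_pencil (p x : R * R) (t : R) :
  on_line (pencil p t) x <-> exists r, x = plus p (scal r (unit_vec t)).
Proof.
  unfold on_line, pencil. split.
  - intros h. exists (cos t * (fst x - fst p) + sin t * (snd x - snd p)).
    pose proof (sin2_cos2 t) as h1; unfold Rsqr in h1.
    apply injective_projections; coords.
    + transitivity (fst p + (fst x - fst p) * (sin t * sin t + cos t * cos t)); [rewrite h1; ring | ].
      assert (sin t * (sin t * (fst x - fst p)) = sin t * (cos t * (snd x - snd p))) by (f_equal; lra).
      lra.
    + transitivity (snd p + (snd x - snd p) * (sin t * sin t + cos t * cos t)); [rewrite h1; ring | ].
      assert (cos t * (sin t * (fst x - fst p)) = cos t * (cos t * (snd x - snd p))) by (f_equal; lra).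
      lra.
  - intros [r ->]. coords. ring.
Qed.

Lemma pencil_shift (p : R * R) (t : R) (m : Z) : pencil p (t + 2 * PI * IZR m) = pencil p t.
Proof. unfold pencil. now destruct (trig_shift t m) as [-> ->]. Qed.

(** The tangent of [d / 2], in the form produced by the mean value theorem. *)
Definition half_tan (d : R) : R := (1 - cos d) / sin d.

Lemma half_tan_bounds (d : R) : 0 < d <= 1 -> 0 < half_tan d <= d.
Proof.
  intros h. pose proof PI2_1 as hpi.
  assert (hs : 0 < sin d) by (apply sin_gt_0; lra).
  assert (hs2 : 0 < sin (d / 2)) by (apply sin_gt_0; lra).
  assert (hc2 : 0 < cos (d / 2)) by (apply cos_gt_0; lra).
  assert (hlt : sin (d / 2) < d / 2) by (apply sin_lt_x; lra).
  assert (E1 : sin d = 2 * sin (d / 2) * cos (d / 2)).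
  { replace d with (2 * (d / 2)) at 1 by field. apply sin_2a. }
  assert (E2 : cos d = 1 - 2 * sin (d / 2) * sin (d / 2)).
  { replace d with (2 * (d / 2)) at 1 by field. apply cos_2a_sin. }
  assert (E : half_tan d = sin (d / 2) / cos (d / 2)).
  { unfold half_tan. rewrite E1, E2. field. lra. }
  assert (hc : 1 / 2 <= cos (d / 2)).
  { pose proof (sin2_cos2 (d / 2)) as h1; unfold Rsqr in h1. nra. }
  rewrite E. split; [now apply Rdiv_lt_0_compat | ].
  apply Rmult_le_reg_r with (cos (d / 2)); [exact hc2 | ].
  unfold Rdiv at 1. rewrite Rmult_assoc, Rinv_l by lra. nra.
Qed.

Section Tangents.

Variables (c : R -> R * R) (rho : R -> R).
Hypothesis hc : angular_curve c rho.

(** Cauchy's mean value theorem, applied to the distance from the line of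
    direction [k] through [c a] and to [- cos (s - k)], whose derivatives are
    [rho s * sin (s - k)] and [sin (s - k)]. *)
Lemma mean_radius (k a b : R) : a < b -> (forall s, a < s < b -> sin (s - k) <> 0) ->
  exists xi, a < xi < b /\
    det (unit_vec k) (minus (c b) (c a)) = rho xi * (cos (a - k) - cos (b - k)).
Proof.
  intros hab hs.
  set (f := fun s => det (unit_vec k) (minus (c s) (c a))).
  assert (hf : forall s, is_derive f s (rho s * sin (s - k))).
  { intros s. eapply is_derive_value; [apply (chord_component_derive c rho hc) | ].
    simpl. rewrite sin_minus. ring. }
  assert (hf0 : f a = 0) by (unfold f; coords; ring).
  set (m := cos (a - k) - cos (b - k)).
  destruct (mean_value (fun s => m * f s - (- cos (s - k)) * f b)
    (fun s => m * (rho s * sin (s - k)) - sin (s - k) * f b) a b) as [xi [hxi e]]; [ | exact hab | ].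
  { intros s. apply (is_derive_minus (fun s => m * f s) (fun s => - cos (s - k) * f b)).
    - apply (is_derive_scal f), hf.
    - auto_derive; [exact I | unfold Rminus; ring]. }
  exists xi. split; [exact hxi | ].
  change (f b = rho xi * m).
  assert (h0 : sin (xi - k) * (rho xi * m - f b) * (b - a) = 0).
  { transitivity ((m * (rho xi * sin (xi - k)) - sin (xi - k) * f b) * (b - a)); [ring | ].
    rewrite <- e, hf0. unfold m. ring. }
  specialize (hs xi hxi).
  apply Rmult_integral in h0. destruct h0 as [h0 | h0]; [ | lra].
  apply Rmult_integral in h0. destruct h0 as [h0 | h0]; [tauto | lra].
Qed.

Lemma tangents_meet (phi psi : R) (z : R * R) : phi < psi <= phi + 1 ->
  det (unit_vec phi) (minus z (c phi)) = 0 -> det (unit_vec psi) (minus z (c psi)) = 0 ->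
  (exists xi, phi < xi < psi /\
     z = plus (c phi) (scal (rho xi * half_tan (psi - phi)) (unit_vec phi))) /\
  (exists xi, phi < xi < psi /\
     z = minus (c psi) (scal (rho xi * half_tan (psi - phi)) (unit_vec psi))).
Proof.
  intros h h1 h2. pose proof PI2_1 as hpi.
  assert (hs : 0 < sin (psi - phi)) by (apply sin_gt_0; lra).
  assert (hon : forall t, det (unit_vec t) (minus z (c t)) = 0 ->
    exists x, z = plus (c t) (scal x (unit_vec t))).
  { intros t ht. apply (on_pencil (c t) z t). unfold on_line, pencil. coords. lra. }
  split.
  - destruct (mean_radius psi phi psi) as [xi [hxi e]]; [lra | | ].
    { intros s hs'. assert (sin (psi - s) <> 0).
      { apply Rgt_not_eq. apply sin_gt_0; lra. }
      rewrite sin_minus in *. lra. }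
    exists xi. split; [exact hxi | ].
    destruct (hon phi h1) as [x ex].
    assert (hx : x = rho xi * half_tan (psi - phi)); [ | now rewrite <- hx].
    rewrite ex in h2. unfold half_tan.
    replace (cos (phi - psi)) with (cos (psi - phi)) in e
      by (rewrite <- cos_neg; f_equal; ring).
    replace (cos (psi - psi)) with 1 in e by (rewrite Rminus_diag; now rewrite cos_0).
    apply Rmult_eq_reg_r with (sin (psi - phi)); [ | lra].
    transitivity (rho xi * (1 - cos (psi - phi))); [ | field; lra].
    rewrite sin_minus. coords. lra.
  - destruct (mean_radius phi phi psi) as [xi [hxi e]]; [lra | | ].
    { intros s hs'. apply Rgt_not_eq. apply sin_gt_0; lra. }
    exists xi. split; [exact hxi | ].
    destruct (hon psi h2) as [x ex].
    assert (hx : x = - (rho xi * half_tan (psi - phi))).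
    { rewrite ex in h1. unfold half_tan.
      replace (cos (phi - phi)) with 1 in e by (rewrite Rminus_diag; now rewrite cos_0).
      apply Rmult_eq_reg_r with (sin (psi - phi)); [ | lra].
      transitivity (- (rho xi * (1 - cos (psi - phi)))); [ | field; lra].
      rewrite <- e, sin_minus. coords. lra. }
    rewrite ex, hx. apply injective_projections; coords; ring.
Qed.

Lemma weighted_radius (a b x y wx wy : R) : a <= x <= b -> a <= y <= b ->
  0 < wx -> 0 < wy ->
  exists z, a <= z <= b /\ rho x * wx + rho y * wy = rho z * (wx + wy).
Proof.
  intros hx hy hwx hwy.
  destruct (IVT_gen rho x y ((rho x * wx + rho y * wy) / (wx + wy))) as [z [hz e]].
  - intros t. apply continuity_pt_filterlim, (angular_continuous c rho hc).
  - set (q := (rho x * wx + rho y * wy) / (wx + wy)).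
    assert (E : rho x * wx + rho y * wy = q * (wx + wy)) by (unfold q; field; lra).
    clearbody q. unfold Rmin, Rmax. destruct (Rle_dec (rho x) (rho y)); split; nra.
  - exists z. split.
    + revert hz. unfold Rmin, Rmax. destruct (Rle_dec x y); lra.
    + rewrite e. field. lra.
Qed.

End Tangents.

(** * Stability of the envelope point *)

(** The composition rules below are stated for functions into the reals on an
    arbitrary space, so that they apply syntactically to functions of tuples. *)
Lemma continuous_fst_of {U V W : UniformSpace} (f : U -> V * W) (x : U) :
  continuous f x -> continuous (fun y => fst (f y)) x.
Proof.
  intros h. apply (continuous_comp f fst x h). destruct (f x) as [a b]. apply continuous_fst.
Qed.

Lemma continuous_snd_of {U V W : UniformSpace} (f : U -> V * W) (x : U) :
  continuous f x -> continuous (fun y => snd (f y)) x.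
Proof.
  intros h. apply (continuous_comp f snd x h). destruct (f x) as [a b]. apply continuous_snd.
Qed.

Lemma continuous_Rmult {U : UniformSpace} (f g : U -> R) (x : U) :
  continuous f x -> continuous g x -> continuous (fun y => f y * g y) x.
Proof. apply (continuous_mult (K := R_AbsRing)). Qed.

Lemma continuous_Rplus {U : UniformSpace} (f g : U -> R) (x : U) :
  continuous f x -> continuous g x -> continuous (fun y => f y + g y) x.
Proof. apply (continuous_plus (V := R_NormedModule)). Qed.

Lemma continuous_Rminus {U : UniformSpace} (f g : U -> R) (x : U) :
  continuous f x -> continuous g x -> continuous (fun y => f y - g y) x.
Proof. apply (continuous_minus (V := R_NormedModule)). Qed.

Lemma continuous_Rinv_of {U : UniformSpace} (f : U -> R) (x : U) :
  continuous f x -> f x <> 0 -> continuous (fun y => / f y) x.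
Proof. intros h hne. apply (continuous_comp f Rinv x h). now apply continuous_Rinv. Qed.

Ltac continuity_step :=
  match goal with
  | |- continuous (fun y => @?f y * @?g y) _ => apply (continuous_Rmult f g)
  | |- continuous (fun y => @?f y + @?g y) _ => apply (continuous_Rplus f g)
  | |- continuous (fun y => @?f y - @?g y) _ => apply (continuous_Rminus f g)
  | |- continuous (fun y => fst (@?f y)) _ => apply (continuous_fst_of f)
  | |- continuous (fun y => snd (@?f y)) _ => apply (continuous_snd_of f)
  | |- continuous (fun y => y) _ => apply continuous_id
  | |- continuous (fun _ => _) _ => apply continuous_const
  end.

Lemma continuous_radius {U : UniformSpace} (f : U -> R) (x : U) : continuous f x ->
  forall eps, 0 < eps -> exists eta : posreal, forall y, ball x eta y -> Rabs (f y - f x) < eps.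
Proof.
  intros h eps heps.
  destruct (proj1 (filterlim_locally _ _) h (mkposreal _ heps)) as [eta H].
  exists eta. intros y hy. exact (H y hy).
Qed.

Lemma envelope_continuous (a b da db : R * R) (eps : R) : 0 < weight a b da db -> 0 < eps ->
  exists eta, 0 < eta /\ forall a' b' da' db',
    Rabs (fst a' - fst a) < eta -> Rabs (snd a' - snd a) < eta ->
    Rabs (fst b' - fst b) < eta -> Rabs (snd b' - snd b) < eta ->
    Rabs (fst da' - fst da) < eta -> Rabs (snd da' - snd da) < eta ->
    Rabs (fst db' - fst db) < eta -> Rabs (snd db' - snd db) < eta ->
    0 < weight a' b' da' db' /\
    Rabs (fst (envelope_of a' b' da' db') - fst (envelope_of a b da db)) < eps /\
    Rabs (snd (envelope_of a' b' da' db') - snd (envelope_of a b da db)) < eps.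
Proof.
  intros hw heps.
  set (D := ((R * R) * (R * R) * ((R * R) * (R * R)))%type).
  set (x0 := (a, b, (da, db)) : D).
  set (W := fun x : D => weight (fst (fst x)) (snd (fst x)) (fst (snd x)) (snd (snd x))).
  set (Z := fun x : D => envelope_of (fst (fst x)) (snd (fst x)) (fst (snd x)) (snd (snd x))).
  assert (cW : continuous W x0).
  { apply continuous_ext with (fun x : D =>
      (fst (snd (fst x)) - fst (fst (fst x))) * (snd (snd (snd x)) - snd (fst (snd x))) -
      (snd (snd (fst x)) - snd (fst (fst x))) * (fst (snd (snd x)) - fst (fst (snd x)))).
    { reflexivity. }
    repeat continuity_step. }
  assert (cZ1 : continuous (fun x => fst (Z x)) x0).
  { apply continuous_ext with (fun x : D => / W x *
      (((fst (snd (fst x)) - fst (fst (fst x))) * snd (snd (snd x)) -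
        (snd (snd (fst x)) - snd (fst (fst x))) * fst (snd (snd x))) * fst (fst (fst x)) -
       ((fst (snd (fst x)) - fst (fst (fst x))) * snd (fst (snd x)) -
        (snd (snd (fst x)) - snd (fst (fst x))) * fst (fst (snd x))) * fst (snd (fst x)))).
    { reflexivity. }
    apply continuous_Rmult; [ | repeat continuity_step].
    apply continuous_Rinv_of; [exact cW | ]. unfold W, x0; simpl. lra. }
  assert (cZ2 : continuous (fun x => snd (Z x)) x0).
  { apply continuous_ext with (fun x : D => / W x *
      (((fst (snd (fst x)) - fst (fst (fst x))) * snd (snd (snd x)) -
        (snd (snd (fst x)) - snd (fst (fst x))) * fst (snd (snd x))) * snd (fst (fst x)) -
       ((fst (snd (fst x)) - fst (fst (fst x))) * snd (fst (snd x)) -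
        (snd (snd (fst x)) - snd (fst (fst x))) * fst (fst (snd x))) * snd (snd (fst x)))).
    { reflexivity. }
    apply continuous_Rmult; [ | repeat continuity_step].
    apply continuous_Rinv_of; [exact cW | ]. unfold W, x0; simpl. lra. }
  destruct (continuous_radius W x0 cW _ hw) as [e1 h1].
  destruct (continuous_radius _ x0 cZ1 _ heps) as [e2 h2].
  destruct (continuous_radius _ x0 cZ2 _ heps) as [e3 h3].
  pose proof (cond_pos e1); pose proof (cond_pos e2); pose proof (cond_pos e3).
  exists (Rmin e1 (Rmin e2 e3)). split; [repeat apply Rmin_glb_lt; assumption | ].
  intros a' b' da' db' k1 k2 k3 k4 k5 k6 k7 k8.
  assert (K : forall e : posreal, Rmin e1 (Rmin e2 e3) <= e ->
    ball x0 e ((a', b', (da', db')) : D)).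
  { intros e he. repeat split; eapply Rlt_le_trans; eassumption. }
  specialize (h1 (a', b', (da', db')) (K e1 (Rmin_l _ _))).
  specialize (h2 (a', b', (da', db')) (K e2 (Rle_trans _ _ _ (Rmin_r _ _) (Rmin_l _ _)))).
  specialize (h3 (a', b', (da', db')) (K e3 (Rle_trans _ _ _ (Rmin_r _ _) (Rmin_r _ _)))).
  split; [ | split; [exact h2 | exact h3]].
  apply Rabs_def2 in h1. unfold W, x0 in h1; simpl in h1. lra.
Qed.

(** [g] and [d] are the position and the velocity of a reflected point in the
    direction [t], up to replacing [alpha t] by the nearby angles [phi], [z] and
    [z'] in the formulas for the oval.  The error in the position is measured
    relative to a radius of curvature because that is how edges are bounded;
    [approximates_limit] removes the factor. *)
Definition approximates (c : R -> R * R) (rho : R -> R) (p : R * R) (alpha : R -> R)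
  (eta t : R) (g d : R * R) : Prop :=
  exists phi z z', Rabs (phi - alpha t) <= eta /\ Rabs (z - alpha t) <= eta /\
    Rabs (z' - alpha t) <= eta /\
    Rabs (fst g - fst (c (phi + PI))) <= rho (z' + PI) * eta /\
    Rabs (snd g - snd (c (phi + PI))) <= rho (z' + PI) * eta /\
    d = scal (- (rho (z' + PI) / rho z *
                 (height c p phi / (sin (phi - t) * sin (phi - t))))) (unit_vec phi).

Section Limit.

Variables (c : R -> R * R) (rho : R -> R) (p : R * R).
Hypothesis hc : angular_curve c rho.
Hypothesis hp : forall th, 0 < height c p th.

Variable alpha : R -> R.
Hypothesis alpha_range : forall t, t < alpha t < t + PI.
Hypothesis alpha_ray : forall t, c (alpha t) =
  plus p (scal (height c p (alpha t) / sin (alpha t - t)) (unit_vec t)).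
Hypothesis alpha_derive : forall t, is_derive alpha t
  (height c p (alpha t) / (rho (alpha t) * (sin (alpha t - t) * sin (alpha t - t)))).

Lemma approximates_mono (eta eta' t : R) (g d : R * R) : eta <= eta' ->
  approximates c rho p alpha eta t g d -> approximates c rho p alpha eta' t g d.
Proof.
  intros h (phi & z & z' & h1 & h2 & h3 & h4 & h5 & e).
  pose proof (angular_pos c rho hc (z' + PI)) as hr.
  assert (rho (z' + PI) * eta <= rho (z' + PI) * eta') by (apply Rmult_le_compat_l; lra).
  exists phi, z, z'. repeat split; try lra. exact e.
Qed.

Lemma approximates_limit (t0 eps : R) : 0 < eps ->
  exists eta, 0 < eta /\ forall t g d, Rabs (t - t0) < eta ->
    approximates c rho p alpha eta t g d ->
    Rabs (fst g - fst (reflected c alpha t0)) < eps /\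
    Rabs (snd g - snd (reflected c alpha t0)) < eps /\
    Rabs (fst d - fst (reflected_velocity c rho p alpha t0)) < eps /\
    Rabs (snd d - snd (reflected_velocity c rho p alpha t0)) < eps.
Proof.
  intros heps.
  assert (he2 : 0 < eps / 2) by lra.
  set (a := alpha t0).
  assert (cc1 : forall s, continuous (fun s => fst (c s)) s)
    by (intros s; eapply is_derive_continuous; apply (angular_x c rho hc)).
  assert (cc2 : forall s, continuous (fun s => snd (c s)) s)
    by (intros s; eapply is_derive_continuous; apply (angular_y c rho hc)).
  assert (cshift : forall (f : R -> R), (forall s, continuous f s) ->
    continuous (fun s => f (s + PI)) a).
  { intros f hf. apply (continuous_comp (fun s => s + PI) f); [repeat continuity_step | apply hf]. }
  destruct (continuous_radius _ a (cshift _ cc1) _ he2) as [e1 h1].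
  destruct (continuous_radius _ a (cshift _ cc2) _ he2) as [e2 h2].
  (* For the bound of the factor [rho (z' + PI)] by [M]. *)
  destruct (continuous_radius _ a (cshift _ (angular_continuous c rho hc)) _ Rlt_0_1) as [e3 h3].
  set (D := (R * R * (R * R))%type).
  set (V := fun x : D => - (rho (fst (snd x) + PI) / rho (snd (fst x)) *
    (height c p (fst (fst x)) / (sin (fst (fst x) - snd (snd x)) * sin (fst (fst x) - snd (snd x)))))).
  set (x0 := (a, a, (a, t0)) : D).
  assert (hs0 : 0 < sin (a - t0)) by (apply (alpha_sin alpha alpha_range)).
  assert (cV : continuous V x0).
  { unfold V, Rdiv.
    assert (cphi : continuous (fun x : D => fst (fst x)) x0) by repeat continuity_step.
    assert (cz : continuous (fun x : D => snd (fst x)) x0) by repeat continuity_step.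
    assert (cz' : continuous (fun x : D => fst (snd x) + PI) x0) by repeat continuity_step.
    assert (cs : continuous (fun x : D => sin (fst (fst x) - snd (snd x))) x0).
    { apply (continuous_comp (fun x : D => fst (fst x) - snd (snd x)) sin);
        [repeat continuity_step | apply continuous_sin]. }
    apply (continuous_opp (V := R_NormedModule)).
    apply continuous_Rmult; apply continuous_Rmult.
    - apply (continuous_comp (fun x : D => fst (snd x) + PI) rho);
        [exact cz' | apply (angular_continuous c rho hc)].
    - apply continuous_Rinv_of.
      + apply (continuous_comp (fun x : D => snd (fst x)) rho);
          [exact cz | apply (angular_continuous c rho hc)].
      + apply Rgt_not_eq, (angular_pos c rho hc).
    - apply (continuous_comp (fun x : D => fst (fst x)) (height c p));
        [exact cphi | apply (height_continuous c rho p hc)].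
    - apply continuous_Rinv_of; [now apply continuous_Rmult | ].
      apply Rgt_not_eq. simpl. now apply Rmult_lt_0_compat. }
  assert (cV1 : continuous (fun x : D => V x * cos (fst (fst x))) x0).
  { apply continuous_Rmult; [exact cV | ].
    apply (continuous_comp (fun x : D => fst (fst x)) cos);
      [repeat continuity_step | apply continuous_cos]. }
  assert (cV2 : continuous (fun x : D => V x * sin (fst (fst x))) x0).
  { apply continuous_Rmult; [exact cV | ].
    apply (continuous_comp (fun x : D => fst (fst x)) sin);
      [repeat continuity_step | apply continuous_sin]. }
  destruct (continuous_radius _ x0 cV1 _ heps) as [e4 h4].
  destruct (continuous_radius _ x0 cV2 _ heps) as [e5 h5].
  pose proof (angular_pos c rho hc (a + PI)) as hr.
  set (M := rho (a + PI) + 1). assert (hM : 0 < M) by (unfold M; lra).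
  pose proof (cond_pos e1). pose proof (cond_pos e2). pose proof (cond_pos e3).
  pose proof (cond_pos e4). pose proof (cond_pos e5).
  assert (hq : 0 < eps / (2 * M)) by (apply Rdiv_lt_0_compat; lra).
  set (e := Rmin (Rmin e1 (Rmin e2 e3)) (Rmin (Rmin e4 e5) (eps / (2 * M)))).
  assert (he : 0 < e) by (repeat apply Rmin_glb_lt; assumption).
  assert (hle : e <= e1 /\ e <= e2 /\ e <= e3 /\ e <= e4 /\ e <= e5 /\ e <= eps / (2 * M)).
  { unfold e.
    pose proof (Rmin_l (Rmin e1 (Rmin e2 e3)) (Rmin (Rmin e4 e5) (eps / (2 * M)))).
    pose proof (Rmin_r (Rmin e1 (Rmin e2 e3)) (Rmin (Rmin e4 e5) (eps / (2 * M)))).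
    pose proof (Rmin_l e1 (Rmin e2 e3)). pose proof (Rmin_r e1 (Rmin e2 e3)).
    pose proof (Rmin_l e2 e3). pose proof (Rmin_r e2 e3).
    pose proof (Rmin_l (Rmin e4 e5) (eps / (2 * M))).
    pose proof (Rmin_r (Rmin e4 e5) (eps / (2 * M))).
    pose proof (Rmin_l e4 e5). pose proof (Rmin_r e4 e5). lra. }
  assert (ca : continuous alpha t0) by (eapply is_derive_continuous; apply alpha_derive).
  assert (he' : 0 < e / 2) by lra.
  destruct (continuous_radius _ t0 ca _ he') as [e6 h6].
  pose proof (cond_pos e6).
  exists (Rmin e6 (e / 3)). split; [apply Rmin_glb_lt; lra | ].
  pose proof (Rmin_l e6 (e / 3)). pose proof (Rmin_r e6 (e / 3)).
  set (eta := Rmin e6 (e / 3)) in *.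
  intros t g d ht (phi & z & z' & k1 & k2 & k3 & k4 & k5 & ed).
  assert (ha : Rabs (alpha t - a) < e / 2).
  { apply h6. change (Rabs (t - t0) < e6). lra. }
  assert (near : forall y, Rabs (y - alpha t) <= eta -> Rabs (y - a) < e).
  { intros y hy. replace (y - a) with ((y - alpha t) + (alpha t - a)) by ring.
    pose proof (Rabs_triang (y - alpha t) (alpha t - a)). lra. }
  pose proof (near _ k1) as n1. pose proof (near _ k2) as n2. pose proof (near _ k3) as n3.
  assert (hrM : rho (z' + PI) * eta <= eps / 2).
  { assert (hr' : Rabs (rho (z' + PI) - rho (a + PI)) < 1).
    { apply h3. change (Rabs (z' - a) < e3). lra. }
    apply Rabs_def2 in hr'.
    apply Rle_trans with (M * (eps / (2 * M))); [ | right; field; lra].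
    pose proof (angular_pos c rho hc (z' + PI)).
    apply Rmult_le_compat; [lra | unfold eta; apply Rmin_glb; lra | unfold M; lra | lra]. }
  assert (hb : forall r : posreal, e <= r -> ball x0 r ((phi, z, (z', t)) : D)).
  { intros r hr'. repeat split;
      [change (Rabs (phi - a) < r) | change (Rabs (z - a) < r) | change (Rabs (z' - a) < r)
      | change (Rabs (t - t0) < r)]; lra. }
  split; [ | split; [ | split]].
  - assert (q : Rabs (fst (c (phi + PI)) - fst (c (a + PI))) < eps / 2).
    { apply h1. change (Rabs (phi - a) < e1). lra. }
    unfold reflected. fold a.
    replace (fst g - fst (c (a + PI))) with
      ((fst g - fst (c (phi + PI))) + (fst (c (phi + PI)) - fst (c (a + PI)))) by ring.
    eapply Rle_lt_trans; [apply Rabs_triang | lra].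
  - assert (q : Rabs (snd (c (phi + PI)) - snd (c (a + PI))) < eps / 2).
    { apply h2. change (Rabs (phi - a) < e2). lra. }
    unfold reflected. fold a.
    replace (snd g - snd (c (a + PI))) with
      ((snd g - snd (c (phi + PI))) + (snd (c (phi + PI)) - snd (c (a + PI)))) by ring.
    eapply Rle_lt_trans; [apply Rabs_triang | lra].
  - rewrite ed. exact (h4 (phi, z, (z', t)) (hb e4 ltac:(lra))).
  - rewrite ed. exact (h5 (phi, z, (z', t)) (hb e5 ltac:(lra))).
Qed.

Definition limit_envelope (t : R) : R * R :=
  envelope_of (reflected c alpha t) (reflected c alpha (t + PI))
    (reflected_velocity c rho p alpha t) (reflected_velocity c rho p alpha (t + PI)).

Lemma envelope_local (t0 eps : R) : 0 < eps ->
  exists eta, 0 < eta /\ forall t g1 g2 d1 d2, Rabs (t - t0) < eta ->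
    approximates c rho p alpha eta t g1 d1 -> approximates c rho p alpha eta (t + PI) g2 d2 ->
    0 < weight g1 g2 d1 d2 /\
    Rabs (fst (envelope_of g1 g2 d1 d2) - fst (limit_envelope t0)) < eps /\
    Rabs (snd (envelope_of g1 g2 d1 d2) - snd (limit_envelope t0)) < eps.
Proof.
  intros heps.
  destruct (envelope_continuous _ _ _ _ eps
    (reflected_weight c rho p hc hp alpha alpha_range t0) heps) as (e & he & H).
  destruct (approximates_limit t0 e he) as (e1 & he1 & H1).
  destruct (approximates_limit (t0 + PI) e he) as (e2 & he2 & H2).
  exists (Rmin e1 e2). split; [now apply Rmin_glb_lt | ].
  pose proof (Rmin_l e1 e2). pose proof (Rmin_r e1 e2).
  intros t g1 g2 d1 d2 ht k1 k2.
  destruct (H1 t g1 d1) as (q1 & q2 & q3 & q4); [lra | now apply approximates_mono with (Rmin e1 e2) | ].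
  destruct (H2 (t + PI) g2 d2) as (q5 & q6 & q7 & q8).
  { replace (t + PI - (t0 + PI)) with (t - t0) by ring. lra. }
  { now apply approximates_mono with (Rmin e1 e2). }
  apply H; assumption.
Qed.

Lemma limit_approximates (eta t : R) : 0 <= eta ->
  approximates c rho p alpha eta t (reflected c alpha t) (reflected_velocity c rho p alpha t).
Proof.
  intros h. exists (alpha t), (alpha t), (alpha t).
  pose proof (angular_pos c rho hc (alpha t + PI)).
  unfold reflected. rewrite !Rminus_diag, Rabs_R0.
  assert (0 <= rho (alpha t + PI) * eta) by (apply Rmult_le_pos; lra).
  repeat split; lra.
Qed.

(** [envelope_local] compares with the limit at the centre of a small interval.
    The oval itself satisfies [approximates] ([limit_approximates]), so its
    envelope at [t] is close to that centre too; compactness makes the radius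
    uniform. *)
Lemma envelope_uniform (lo hi eps : R) : 0 < eps ->
  exists eta, 0 < eta /\ forall t g1 g2 d1 d2, lo <= t <= hi ->
    approximates c rho p alpha eta t g1 d1 -> approximates c rho p alpha eta (t + PI) g2 d2 ->
    0 < weight g1 g2 d1 d2 /\
    norm (minus (envelope_of g1 g2 d1 d2) (limit_envelope t)) <= eps.
Proof.
  intros heps. assert (he : 0 < eps / 4) by lra.
  destruct (choice (fun t0 (eta : posreal) => forall t g1 g2 d1 d2, Rabs (t - t0) < eta ->
    approximates c rho p alpha eta t g1 d1 -> approximates c rho p alpha eta (t + PI) g2 d2 ->
    0 < weight g1 g2 d1 d2 /\
    Rabs (fst (envelope_of g1 g2 d1 d2) - fst (limit_envelope t0)) < eps / 4 /\
    Rabs (snd (envelope_of g1 g2 d1 d2) - snd (limit_envelope t0)) < eps / 4)) as [delta hd].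
  { intros t0. destruct (envelope_local t0 (eps / 4) he) as (eta & heta & H).
    now exists (mkposreal eta heta). }
  destruct (compactness_value_1d lo hi delta) as [eta heta].
  exists eta. split; [apply cond_pos | ].
  intros t g1 g2 d1 d2 ht k1 k2.
  destruct (NNPP _ (heta t ht)) as (t0 & ht0 & hclose & hle).
  destruct (hd t0 t g1 g2 d1 d2 hclose) as (hw & q1 & q2);
    [now apply approximates_mono with eta | now apply approximates_mono with eta | ].
  pose proof (cond_pos (delta t0)) as hdp.
  destruct (hd t0 t _ _ _ _ hclose (limit_approximates (delta t0) t ltac:(lra))
    (limit_approximates (delta t0) (t + PI) ltac:(lra))) as (_ & q3 & q4).
  fold (limit_envelope t) in q3, q4.
  split; [exact hw | ].
  rewrite norm_pair, fst_minus, snd_minus.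
  set (X := fst (envelope_of g1 g2 d1 d2)) in *. set (Y := snd (envelope_of g1 g2 d1 d2)) in *.
  apply Rabs_def2 in q1, q2, q3, q4.
  rewrite <- (sqrt_Rsqr eps) by lra. apply sqrt_le_1_alt. unfold Rsqr.
  set (u := X - fst (limit_envelope t)). set (v := Y - snd (limit_envelope t)).
  assert (- (eps / 2) < u < eps / 2) by (unfold u; lra).
  assert (- (eps / 2) < v < eps / 2) by (unfold v; lra).
  nra.
Qed.

End Limit.

(** * The envelope of the oval *)

Section OvalEnvelope.

Variables (C : C4_oval) (c : R -> R * R) (rho : R -> R) (p : R * R).
Hypothesis hc : angular_curve c rho.
Hypothesis hp : forall th, 0 < height c p th.
Hypothesis c_image : forall z, on_curve C z <-> exists th, z = c th.
Hypothesis c_antipode : forall th z, antipode C (c th) z <-> z = c (th + PI).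

Variable alpha : R -> R.
Hypothesis alpha_range : forall t, t < alpha t < t + PI.
Hypothesis alpha_ray : forall t, c (alpha t) =
  plus p (scal (height c p (alpha t) / sin (alpha t - t)) (unit_vec t)).
Hypothesis alpha_derive : forall t, is_derive alpha t
  (height c p (alpha t) / (rho (alpha t) * (sin (alpha t - t) * sin (alpha t - t)))).

Lemma oval_image (t : R) :
  image_is (Phi_oval C) (pencil p t) (reflected c alpha t) (reflected c alpha (t + PI)).
Proof.
  assert (hne : reflected c alpha t <> reflected c alpha (t + PI)).
  { eapply weight_distinct, Rgt_not_eq, (reflected_weight c rho p hc hp alpha alpha_range t). }
  split; [exact hne | ].
  assert (hr : forall s, 0 < height c p (alpha s) / sin (alpha s - s))
    by (apply (alpha_radius c p hp alpha alpha_range)).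
  assert (hits : forall x, on_line (pencil p t) x -> on_curve C x ->
    x = c (alpha t) \/ x = c (alpha (t + PI))).
  { intros x hx hC. apply on_pencil in hx. destruct hx as [r e].
    apply c_image in hC. destruct hC as [phi ->].
    destruct (Rtotal_order 0 r) as [h | [h | h]].
    - left. apply (radial_unique c rho p hc hp phi (alpha t) t r _ h (hr t) e (alpha_ray t)).
    - exfalso. pose proof (hp phi) as hh. unfold height in hh. rewrite e, <- h in hh. coords. lra.
    - right. rewrite opposite_ray in e.
      apply (radial_unique c rho p hc hp phi (alpha (t + PI)) (t + PI) (- r) _ ltac:(lra)
        (hr (t + PI)) e (alpha_ray (t + PI))). }
  assert (hX : on_line (pencil p t) (c (alpha t))).
  { apply on_pencil. eexists. apply alpha_ray. }
  assert (hY : on_line (pencil p t) (c (alpha (t + PI)))).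
  { apply on_pencil.
    exists (- (height c p (alpha (t + PI)) / sin (alpha (t + PI) - (t + PI)))).
    rewrite (opposite_ray p t), Ropp_involutive. apply alpha_ray. }
  intros m. split.
  - intros (x & y & x' & y' & hxy & cx & cy & lx & ly & ax & ay & hm & mx & my).
    destruct (hits x lx cx) as [-> | ->]; destruct (hits y ly cy) as [-> | ->]; try tauto;
      apply c_antipode in ax, ay; subst; unfold reflected; tauto.
  - intros (hm & h1 & h2).
    exists (c (alpha t)), (c (alpha (t + PI))), (reflected c alpha t), (reflected c alpha (t + PI)).
    repeat split; auto; try (now apply c_antipode); try (apply c_image; now eexists).
    intros e. destruct (angular_injective c rho hc _ _ e) as [k hk].
    pose proof (alpha_range t) as r1. pose proof (alpha_range (t + PI)) as r2.
    assert (hz : (0 < k < 1)%Z) by (split; apply lt_IZR; nra). lia.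
Qed.

(** The velocity is determined by the position as its derivative, so only the
    position has to be shown periodic. *)
Lemma limit_envelope_shift (t : R) (m : Z) :
  limit_envelope c rho p alpha (t + 2 * PI * IZR m) = limit_envelope c rho p alpha t.
Proof.
  assert (H1 : forall s, reflected c alpha (s + 2 * PI * IZR m) = reflected c alpha s).
  { intros s. unfold reflected.
    rewrite (alpha_shift c rho p hc hp alpha alpha_range alpha_ray).
    replace (alpha s + 2 * PI * IZR m + PI) with (alpha s + PI + 2 * PI * IZR m) by ring.
    apply (angular_shift c rho hc). }
  assert (H2 : forall s, reflected_velocity c rho p alpha (s + 2 * PI * IZR m) =
                         reflected_velocity c rho p alpha s).
  { intros s. 
    assert (e : fst (reflected_velocity c rho p alpha (s + 2 * PI * IZR m)) =
      fst (reflected_velocity c rho p alpha s) /\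
      snd (reflected_velocity c rho p alpha (s + 2 * PI * IZR m)) =
      snd (reflected_velocity c rho p alpha s)).
    { destruct (reflected_derive c rho p hc alpha alpha_range alpha_derive (s + 2 * PI * IZR m)) as [a1 a2].
      destruct (reflected_derive c rho p hc alpha alpha_range alpha_derive s) as [b1 b2].
      destruct (moves_shift (reflected c alpha) s (2 * PI * IZR m) _ (conj a1 a2)) as [d1 d2].
      split.
      - apply is_derive_unique in b1. rewrite <- b1. symmetry. apply is_derive_unique.
        revert d1. apply is_derive_ext. intros x. now rewrite H1.
      - apply is_derive_unique in b2. rewrite <- b2. symmetry. apply is_derive_unique.
        revert d2. apply is_derive_ext. intros x. now rewrite H1. }
    apply injective_projections; apply e. }
  unfold limit_envelope.
  replace (t + 2 * PI * IZR m + PI) with (t + PI + 2 * PI * IZR m) by ring.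
  now rewrite !H1, !H2.
Qed.

Lemma ART_oval_limit (z : R * R) :
  ART_oval C p z <-> exists t, z = limit_envelope c rho p alpha t.
Proof.
  assert (hm : forall t, moves (reflected c alpha) t (reflected_velocity c rho p alpha t))
    by apply (reflected_derive c rho p hc alpha alpha_range alpha_derive).
  assert (hm2 : forall t, moves (fun s => reflected c alpha (s + PI)) t
    (reflected_velocity c rho p alpha (t + PI))) by (intros t; apply moves_shift, hm).
  assert (hw : forall t, weight (reflected c alpha t) (reflected c alpha (t + PI))
    (reflected_velocity c rho p alpha t) (reflected_velocity c rho p alpha (t + PI)) <> 0)
    by (intros t; apply Rgt_not_eq, (reflected_weight c rho p hc hp alpha alpha_range)).
  split.
  - intros (l & t & hl & hz). exists t. apply two_sided_envelope in hz.
    apply (family_envelope (Phi_oval C) p (at_right t) l (reflected c alpha)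
      (fun s => reflected c alpha (s + PI)) t); auto.
    + apply at_right_le.
    + apply oval_image.
    + unfold image_along. apply filter_forall. apply oval_image.
  - intros [t ->].
    destruct (two_sided_envelope_exists (Phi_oval C) p) with (g1 := reflected c alpha)
      (g2 := fun s => reflected c alpha (s + PI)) (t := t)
      (d1 := reflected_velocity c rho p alpha t)
      (d2 := reflected_velocity c rho p alpha (t + PI)) as (l & hl & hz); auto.
    + intros s. eexists. apply (image_chord _ _ s 1 _ _ (oval_image s)), R1_neq_R0.
    + unfold image_along. apply filter_forall. apply oval_image.
    + now exists l, t.
Qed.

End OvalEnvelope.

(** * The circumscribed polygon *)

Section Polygon.

Variables (c : R -> R * R) (rho : R -> R) (p : R * R).
Hypothesis hc : angular_curve c rho.
Hypothesis hp : forall th, 0 < height c p th.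

Variables (n : nat) (th : nat -> R) (P : nat -> R * R) (d : R).
Hypothesis n_pos : (1 <= n)%nat.
Hypothesis d_le : d <= 1.
Hypothesis th_gap : forall i, th i < th (S i) <= th i + d.
Hypothesis th_half : forall i, th (i + n)%nat = th i + PI.
Hypothesis th_0 : th 0%nat < PI.
Hypothesis P_left : forall i, det (unit_vec (th i)) (minus (P i) (c (th i))) = 0.
Hypothesis P_right : forall i, det (unit_vec (th (S i))) (minus (P i) (c (th (S i)))) = 0.

(** A vertex lies beyond the contact point of one edge and before that of the
    next, at distances given by [tangents_meet]. *)
Lemma vertex_on_tangents (i : nat) :
  (exists xi, th i < xi < th (S i) /\
     P i = plus (c (th i)) (scal (rho xi * half_tan (th (S i) - th i)) (unit_vec (th i)))) /\
  (exists xi, th i < xi < th (S i) /\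
     P i = minus (c (th (S i)))
             (scal (rho xi * half_tan (th (S i) - th i)) (unit_vec (th (S i))))).
Proof.
  apply (tangents_meet c rho hc); auto. specialize (th_gap i). lra.
Qed.

(** An edge is cut off by the tangents at the two adjacent directions; this is the
    length that it would have on a circle of radius 1. *)
Definition breadth (i : nat) : R :=
  half_tan (th (S i) - th i) + half_tan (th (S (S i)) - th (S i)).

Lemma gap_half_tan (i : nat) : 0 < half_tan (th (S i) - th i) <= d.
Proof.
  specialize (th_gap i). pose proof (half_tan_bounds (th (S i) - th i)). lra.
Qed.

Lemma breadth_bounds (i : nat) : 0 < breadth i <= 2 * d.
Proof.
  unfold breadth. pose proof (gap_half_tan i). pose proof (gap_half_tan (S i)). lra.
Qed.

(** The contact point divides the edge in two parts, each with its own mean radius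
    of curvature; [weighted_radius] merges them. *)
Lemma edge_mean_radius (i : nat) : exists z, th i <= z <= th (S (S i)) /\
  edge P i = scal (rho z * breadth i) (unit_vec (th (S i))) /\
  exists x, 0 <= x <= rho z * breadth i /\
    P i = minus (c (th (S i))) (scal x (unit_vec (th (S i)))).
Proof.
  destruct (proj2 (vertex_on_tangents i)) as (xi & hxi & e1).
  destruct (proj1 (vertex_on_tangents (S i))) as (xi' & hxi' & e2).
  pose proof (gap_half_tan i) as h1. pose proof (gap_half_tan (S i)) as h2.
  destruct (weighted_radius c rho hc (th i) (th (S (S i))) xi xi'
    (half_tan (th (S i) - th i)) (half_tan (th (S (S i)) - th (S i)))) as (z & hz & e); try lra.
  exists z. split; [exact hz | ].
  fold (breadth i) in e. rewrite <- e. split.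
  - unfold edge. rewrite e1, e2. apply injective_projections; coords; ring.
  - exists (rho xi * half_tan (th (S i) - th i)). split; [ | exact e1].
    pose proof (angular_pos c rho hc xi). pose proof (angular_pos c rho hc xi').
    split; [nra | ].
    assert (0 < rho xi' * half_tan (th (S (S i)) - th (S i))) by (apply Rmult_lt_0_compat; lra).
    lra.
Qed.

Definition edge_length (i : nat) : R :=
  cos (th (S i)) * fst (edge P i) + sin (th (S i)) * snd (edge P i).

Lemma edge_length_spec (i : nat) : exists z, th i <= z <= th (S (S i)) /\
  edge_length i = rho z * breadth i /\ edge P i = scal (edge_length i) (unit_vec (th (S i))) /\
  exists x, 0 <= x <= edge_length i /\
    P i = minus (c (th (S i))) (scal x (unit_vec (th (S i)))).
Proof.
  destruct (edge_mean_radius i) as (z & hz & e & hx). exists z. split; [exact hz | ].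
  assert (hl : edge_length i = rho z * breadth i).
  { unfold edge_length. rewrite e. coords.
    pose proof (sin2_cos2 (th (S i))) as h1; unfold Rsqr in h1.
    transitivity (rho z * breadth i * (sin (th (S i)) * sin (th (S i)) + cos (th (S i)) * cos (th (S i))));
      [ring | rewrite h1; ring]. }
  rewrite hl. auto.
Qed.

Lemma edge_eq (i : nat) : edge P i = scal (edge_length i) (unit_vec (th (S i))).
Proof. destruct (edge_length_spec i) as (z & _ & _ & e & _). exact e. Qed.

Lemma vertex_succ (i : nat) : P (S i) = plus (P i) (edge P i).
Proof. unfold edge. apply injective_projections; coords; ring. Qed.

Lemma edge_length_pos (i : nat) : 0 < edge_length i.
Proof.
  destruct (edge_length_spec i) as (z & _ & -> & _).
  apply Rmult_lt_0_compat; [apply (angular_pos c rho hc) | apply breadth_bounds].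
Qed.

Lemma th_turn (i k : nat) : th (i + 2 * n * k)%nat = th i + 2 * PI * INR k.
Proof.
  induction k as [ | k IH].
  - replace (i + 2 * n * 0)%nat with i by lia. simpl INR. ring.
  - replace (i + 2 * n * S k)%nat with (i + 2 * n * k + n + n)%nat by lia.
    rewrite !th_half, IH, S_INR. ring.
Qed.

Lemma P_turn (i k : nat) : P (i + 2 * n * k)%nat = P i.
Proof.
  set (j := (i + 2 * n * k)%nat).
  assert (e1 : th j = th i + 2 * PI * IZR (Z.of_nat k))
    by (unfold j; rewrite th_turn, INR_IZR_INZ; ring).
  assert (e2 : th (S j) = th (S i) + 2 * PI * IZR (Z.of_nat k)).
  { unfold j. replace (S (i + 2 * n * k))%nat with (S i + 2 * n * k)%nat by lia.
    rewrite th_turn, INR_IZR_INZ; ring. }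
  pose proof (P_left j) as h1. pose proof (P_right j) as h2.
  pose proof (P_left i) as h3. pose proof (P_right i) as h4.
  rewrite e1, (angular_shift c rho hc) in h1. rewrite e2, (angular_shift c rho hc) in h2.
  coords.
  destruct (trig_shift (th i) (Z.of_nat k)) as [t1 t2].
  destruct (trig_shift (th (S i)) (Z.of_nat k)) as [t3 t4].
  rewrite t1, t2 in h1. rewrite t3, t4 in h2.
  assert (hs : 0 < sin (th (S i) - th i)).
  { specialize (th_gap i). pose proof PI2_1. apply sin_gt_0; lra. }
  rewrite sin_minus in hs.
  set (X := fst (P j) - fst (P i)). set (Y := snd (P j) - snd (P i)).
  assert (k1 : cos (th i) * Y = sin (th i) * X) by (unfold X, Y; lra).
  assert (k2 : cos (th (S i)) * Y = sin (th (S i)) * X) by (unfold X, Y; lra).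
  set (s := sin (th (S i)) * cos (th i) - cos (th (S i)) * sin (th i)) in *.
  assert (hX : s * X = 0).
  { unfold s. transitivity (cos (th i) * (sin (th (S i)) * X) - cos (th (S i)) * (sin (th i) * X)); [ring | ].
    rewrite <- k1, <- k2. ring. }
  assert (hY : s * Y = 0).
  { unfold s. transitivity (sin (th (S i)) * (cos (th i) * Y) - sin (th i) * (cos (th (S i)) * Y)); [ring | ].
    rewrite k1, k2. ring. }
  apply Rmult_integral in hX, hY. unfold X, Y in *.
  apply injective_projections; lra.
Qed.

Lemma edge_turn (i k : nat) : edge P (i + 2 * n * k) = edge P i.
Proof.
  unfold edge. replace (S (i + 2 * n * k))%nat with (S i + 2 * n * k)%nat by lia.
  now rewrite !P_turn.
Qed.

Lemma edge_length_turn (i k : nat) : edge_length (i + 2 * n * k) = edge_length i.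
Proof.
  unfold edge_length. rewrite edge_turn.
  replace (S (i + 2 * n * k))%nat with (S i + 2 * n * k)%nat by lia.
  rewrite th_turn, INR_IZR_INZ. now destruct (trig_shift (th (S i)) (Z.of_nat k)) as [-> ->].
Qed.

Lemma height_turn (i k : nat) : height c p (th (i + 2 * n * k)%nat) = height c p (th i).
Proof. rewrite th_turn, INR_IZR_INZ. apply (height_shift c rho p hc). Qed.

(** The polar angle [T] of a vertex is chosen in the window in which [p] is to the
    left of both edges. *)
Lemma vertex_polar (i : nat) : exists T r, th (S i) - PI < T < th i /\ 0 < r /\
  P i = plus p (scal r (unit_vec T)) /\
  height c p (th i) = r * sin (th i - T) /\ height c p (th (S i)) = r * sin (th (S i) - T).
Proof.
  pose proof (P_left i) as h1. pose proof (P_right i) as h2.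
  pose proof (hp (th i)) as k1. pose proof (hp (th (S i))) as k2.
  set (x := fst (P i) - fst p). set (y := snd (P i) - snd p).
  assert (H1 : height c p (th i) = sin (th i) * x - cos (th i) * y)
    by (unfold height, x, y; coords; lra).
  assert (H2 : height c p (th (S i)) = sin (th (S i)) * x - cos (th (S i)) * y)
    by (unfold height, x, y; coords; lra).
  assert (hpos : 0 < x * x + y * y).
  { assert (x <> 0 \/ y <> 0) as [h | h].
    { destruct (Req_dec x 0) as [e1 | ]; [ | tauto].
      destruct (Req_dec y 0) as [e2 | ]; [ | tauto].
      rewrite e1, e2 in H1. lra. }
    - pose proof (Rsqr_pos_lt _ h) as h'; unfold Rsqr in h'. nra.
    - pose proof (Rsqr_pos_lt _ h) as h'; unfold Rsqr in h'. nra. }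
  destruct (polar_angle x y (th i - 2 * PI) hpos) as (T & hT & ex & ey).
  pose proof (sqrt_lt_R0 _ hpos) as hr.
  set (r := sqrt (x * x + y * y)) in *. clearbody r.
  assert (G1 : height c p (th i) = r * sin (th i - T)) by (rewrite H1, ex, ey, sin_minus; ring).
  assert (G2 : height c p (th (S i)) = r * sin (th (S i) - T))
    by (rewrite H2, ex, ey, sin_minus; ring).
  assert (s1 : 0 < sin (th i - T)) by (apply Rmult_lt_reg_l with r; lra).
  assert (s2 : 0 < sin (th (S i) - T)) by (apply Rmult_lt_reg_l with r; lra).
  pose proof (th_gap i) as hg. pose proof PI2_1 as hpi.
  assert (h3 : T < th i).
  { destruct (Req_dec T (th i)) as [e | ne]; [ | lra].
    rewrite e, Rminus_diag, sin_0 in s1. lra. }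
  assert (h4 : th i - T < PI).
  { apply Rnot_le_lt. intros h. assert (sin (th i - T) <= 0); [ | lra].
    apply sin_le_0; lra. }
  assert (h5 : th (S i) - T < PI).
  { apply Rnot_le_lt. intros h. assert (sin (th (S i) - T) <= 0); [ | lra].
    apply sin_le_0; lra. }
  exists T, r. repeat split; auto; try lra.
  unfold x, y in ex, ey. apply injective_projections; coords; lra.
Qed.

Variables (T Rad : nat -> R).
Hypothesis T_spec : forall i, th (S i) - PI < T i < th i /\ 0 < Rad i /\
  P i = plus p (scal (Rad i) (unit_vec (T i))) /\
  height c p (th i) = Rad i * sin (th i - T i) /\
  height c p (th (S i)) = Rad i * sin (th (S i) - T i).

Lemma window_sin (i : nat) (t : R) : th (S i) - PI < t < th (S i) -> 0 < sin (th (S i) - t).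
Proof. intros h. apply sin_gt_0; lra. Qed.

Lemma T_window (i : nat) :
  th (S i) - PI < T i < th (S i) /\ th (S i) - PI < T (S i) < th (S i).
Proof.
  destruct (T_spec i) as [h _]. destruct (T_spec (S i)) as [h' _].
  pose proof (th_gap i). pose proof (th_gap (S i)). lra.
Qed.

(** The parameter on the edge [i] of its intersection with the ray of direction
    [t] from [p]. *)
Definition par (i : nat) (t : R) : R :=
  height c p (th (S i)) / (edge_length i * sin (th (S i) - T i)) *
  (sin (t - T i) / sin (th (S i) - t)).

Lemma par_coefficient_pos (i : nat) :
  0 < height c p (th (S i)) / (edge_length i * sin (th (S i) - T i)).
Proof.
  apply Rdiv_lt_0_compat; [apply hp | ]. apply Rmult_lt_0_compat; [apply edge_length_pos | ].
  apply window_sin, T_window.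
Qed.

Lemma par_lt (i : nat) (t t' : R) : th (S i) - PI < t -> t < t' -> t' < th (S i) ->
  par i t < par i t'.
Proof.
  intros h1 h2 h3. pose proof (par_coefficient_pos i) as hk. unfold par.
  set (k := height c p (th (S i)) / _) in *. clearbody k.
  pose proof (window_sin i t ltac:(lra)) as s1. pose proof (window_sin i t' ltac:(lra)) as s2.
  pose proof (window_sin i (T i) (proj1 (T_window i))) as s3.
  assert (s4 : 0 < sin (t' - t)) by (apply sin_gt_0; lra).
  assert (E : sin (t' - T i) / sin (th (S i) - t') - sin (t - T i) / sin (th (S i) - t) =
    sin (t' - t) * sin (th (S i) - T i) / (sin (th (S i) - t) * sin (th (S i) - t'))).
  { apply Rmult_eq_reg_r with (sin (th (S i) - t) * sin (th (S i) - t'));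
      [ | apply Rgt_not_eq; now apply Rmult_lt_0_compat].
    transitivity (sin (t' - T i) * sin (th (S i) - t) - sin (t - T i) * sin (th (S i) - t'));
      [field; lra | ].
    transitivity (sin (t' - t) * sin (th (S i) - T i)); [ | field; lra].
    rewrite !sin_minus. ring. }
  assert (0 < sin (t' - t) * sin (th (S i) - T i) / (sin (th (S i) - t) * sin (th (S i) - t'))).
  { apply Rdiv_lt_0_compat; now apply Rmult_lt_0_compat. }
  assert (0 < k * (sin (t' - T i) / sin (th (S i) - t') - sin (t - T i) / sin (th (S i) - t)));
    [ | lra].
  apply Rmult_lt_0_compat; lra.
Qed.

Lemma par_start (i : nat) : par i (T i) = 0.
Proof. unfold par. rewrite Rminus_diag, sin_0. unfold Rdiv. ring. Qed.

Lemma par_end (i : nat) : par i (T (S i)) = 1.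
Proof.
  destruct (T_window i) as [w1 w2].
  pose proof (window_sin _ _ w1) as s1. pose proof (window_sin _ _ w2) as s2.
  destruct (T_spec i) as (_ & hr & e & _ & e2). destruct (T_spec (S i)) as (_ & hr' & e' & _ & _).
  pose proof (edge_length_pos i) as hl.
  rewrite vertex_succ, e, edge_eq in e'.
  assert (K : edge_length i * sin (th (S i) - T (S i)) = Rad i * sin (T (S i) - T i)).
  { pose proof (f_equal fst e') as x1. pose proof (f_equal snd e') as x2. coords.
    rewrite !sin_minus.
    set (C1 := cos (T (S i))) in *. set (S1 := sin (T (S i))) in *.
    assert (y1 : S1 * (Rad i * cos (T i) + edge_length i * cos (th (S i))) = S1 * (Rad (S i) * C1))
      by (f_equal; lra).
    assert (y2 : C1 * (Rad i * sin (T i) + edge_length i * sin (th (S i))) = C1 * (Rad (S i) * S1))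
      by (f_equal; lra).
    lra. }
  unfold par. rewrite e2.
  transitivity (Rad i * sin (T (S i) - T i) / (edge_length i * sin (th (S i) - T (S i)))); [field; lra | ].
  rewrite <- K. field. lra.
Qed.

Lemma T_lt (i : nat) : T i < T (S i).
Proof.
  destruct (T_window i) as [w1 w2].
  destruct (Rtotal_order (T i) (T (S i))) as [h | [h | h]]; [exact h | | ]; exfalso.
  - pose proof (par_end i) as e. rewrite <- h, par_start in e. lra.
  - assert (h' : par i (T (S i)) < par i (T i)) by (apply par_lt; lra).
    rewrite par_start, par_end in h'. lra.
Qed.

(** [par i] increases, from [0] at the polar angle of [P i] to [1] at that of
    [P (S i)]. *)
Lemma par_bounds (i : nat) (t : R) : th (S i) - PI < t < th (S i) ->
  (T i <= t <= T (S i) <-> 0 <= par i t <= 1).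
Proof.
  intros h. destruct (T_window i) as [w1 w2]. rewrite <- (par_start i), <- (par_end i). split.
  - intros [h1 h2]. split.
    + destruct h1 as [h1 | ->]; [left; apply par_lt; lra | lra].
    + destruct h2 as [h2 | ->]; [left; apply par_lt; lra | lra].
  - intros [h1 h2]. split; apply Rnot_lt_le; intros hlt.
    + assert (par i t < par i (T i)) by (apply par_lt; lra). lra.
    + assert (par i (T (S i)) < par i t) by (apply par_lt; lra). lra.
Qed.

(** The point with parameter [par i t] on the edge [i + k]: for [k = 0] the point
    of the boundary in the direction [t], for [k = n] its image under the
    involution.  The two cases share the lemmas about overlaps and periodicity. *)
Definition trace (k i : nat) (t : R) : R * R :=
  plus (P (i + k)) (scal (par i t) (edge P (i + k))).

Lemma cell_window (i : nat) (t : R) : T i <= t <= T (S i) -> th (S i) - PI < t < th (S i).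
Proof. intros h. destruct (T_window i). lra. Qed.

Lemma trace_ray (i : nat) (t : R) : th (S i) - PI < t < th (S i) ->
  trace 0 i t = plus p (scal (height c p (th (S i)) / sin (th (S i) - t)) (unit_vec t)).
Proof.
  intros h. pose proof (window_sin i t h) as s1.
  pose proof (window_sin i _ (proj1 (T_window i))) as s2.
  destruct (T_spec i) as (_ & hr & e & _ & e2). pose proof (edge_length_pos i) as hl.
  unfold trace, par. rewrite Nat.add_0_r, e, edge_eq, e2.
  set (X := sin (th (S i) - T i)) in *. set (Y := sin (th (S i) - t)) in *.
  assert (K : forall u v w : R, Y * u + sin (t - T i) * v = X * w ->
    Rad i * u + Rad i * X / (edge_length i * X) * (sin (t - T i) / Y) * (edge_length i * v) = Rad i * X / Y * w).
  { intros u v w K. apply Rmult_eq_reg_r with Y; [ | lra].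
    transitivity (Rad i * (Y * u + sin (t - T i) * v)); [field; lra | ].
    rewrite K. field; lra. }
  apply injective_projections; coords; rewrite Rplus_assoc; f_equal; apply K;
    unfold X, Y; rewrite !sin_minus; ring.
Qed.

(** The direction of a boundary point is known modulo [2 * PI] only, hence the
    shift by [m]. *)
Lemma edge_hit (i : nat) (s r t : R) : 0 <= s <= 1 -> 0 < r ->
  plus (P i) (scal s (edge P i)) = plus p (scal r (unit_vec t)) ->
  exists m : Z, T i <= t + 2 * PI * IZR m <= T (S i) /\ s = par i (t + 2 * PI * IZR m).
Proof.
  intros hs hr e. destruct (shift_into t (th (S i) - 2 * PI)) as [m hm]. exists m.
  assert (e' : plus (P i) (scal s (edge P i)) =
    plus p (scal r (unit_vec (t + 2 * PI * IZR m)))).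
  { rewrite e. unfold unit_vec. now destruct (trig_shift t m) as [-> ->]. }
  clear e. set (t' := t + 2 * PI * IZR m) in *. clearbody t'. clear t m.
  destruct (T_spec i) as (_ & hRad & eP & _ & e2).
  rewrite eP, edge_eq in e'.
  pose proof (f_equal fst e') as x1. pose proof (f_equal snd e') as x2. coords. clear e'.
  pose proof (edge_length_pos i) as hl.
  pose proof (window_sin i _ (proj1 (T_window i))) as s2.
  pose proof (hp (th (S i))) as hh.
  assert (hs1 : height c p (th (S i)) = r * sin (th (S i) - t')).
  { rewrite e2, !sin_minus.
    assert (y1 : sin (th (S i)) * (Rad i * cos (T i) + s * (edge_length i * cos (th (S i)))) =
                 sin (th (S i)) * (r * cos t')) by (f_equal; lra).
    assert (y2 : cos (th (S i)) * (Rad i * sin (T i) + s * (edge_length i * sin (th (S i)))) =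
                 cos (th (S i)) * (r * sin t')) by (f_equal; lra).
    lra. }
  assert (s1 : 0 < sin (th (S i) - t')) by (apply Rmult_lt_reg_l with r; lra).
  assert (w : th (S i) - PI < t' < th (S i)).
  { assert (th (S i) - t' < PI).
    { apply Rnot_le_lt. intros h. assert (sin (th (S i) - t') <= 0); [ | lra].
      apply sin_le_0; lra. }
    destruct (Req_dec t' (th (S i))) as [q | q]; [ | lra].
    rewrite q, Rminus_diag, sin_0 in s1. lra. }
  assert (K : s * (edge_length i * sin (th (S i) - t')) = Rad i * sin (t' - T i)).
  { rewrite !sin_minus.
    assert (y1 : sin t' * (Rad i * cos (T i) + s * (edge_length i * cos (th (S i)))) =
                 sin t' * (r * cos t')) by (f_equal; lra).
    assert (y2 : cos t' * (Rad i * sin (T i) + s * (edge_length i * sin (th (S i)))) =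
                 cos t' * (r * sin t')) by (f_equal; lra).
    lra. }
  assert (hpar : s = par i t').
  { unfold par. rewrite e2.
    transitivity (s * (edge_length i * sin (th (S i) - t')) / (edge_length i * sin (th (S i) - t')));
      [field; lra | ].
    rewrite K. field; lra. }
  split; [ | exact hpar]. apply par_bounds; [exact w | ]. now rewrite <- hpar.
Qed.

(** Both angles are polar angles of the same vertex, and their windows correspond
    under the shift. *)
Lemma T_turn (i k : nat) : T (i + 2 * n * k)%nat = T i + 2 * PI * INR k.
Proof.
  destruct (T_spec i) as (w & hr & e & _). destruct (T_spec (i + 2 * n * k)) as (w' & hr' & e' & _).
  rewrite P_turn, e in e'.
  replace (S (i + 2 * n * k))%nat with (S i + 2 * n * k)%nat in w' by lia.
  rewrite !th_turn in w'.
  set (t' := T (i + 2 * n * k)%nat) in *. set (r' := Rad (i + 2 * n * k)%nat) in *.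
  pose proof (f_equal fst e') as x1. pose proof (f_equal snd e') as x2. coords.
  assert (K : Rad i * sin (t' - T i) = 0).
  { rewrite sin_minus.
    assert (y1 : sin t' * (Rad i * cos (T i)) = sin t' * (r' * cos t')) by (f_equal; lra).
    assert (y2 : cos t' * (Rad i * sin (T i)) = cos t' * (r' * sin t')) by (f_equal; lra).
    lra. }
  assert (K' : sin (t' - 2 * PI * INR k - T i) = 0).
  { rewrite INR_IZR_INZ.
    replace (t' - 2 * PI * IZR (Z.of_nat k) - T i)
      with (t' - T i + 2 * PI * IZR (- Z.of_nat k)) by (rewrite opp_IZR; ring).
    destruct (trig_shift (t' - T i) (- Z.of_nat k)) as [_ ->].
    apply Rmult_integral in K. destruct K; [lra | assumption]. }
  pose proof (th_gap i) as hg.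
  destruct (Rtotal_order (t' - 2 * PI * INR k) (T i)) as [h | [h | h]]; [ | lra | ]; exfalso.
  - assert (sin (T i - (t' - 2 * PI * INR k)) > 0) by (apply sin_gt_0; lra).
    replace (t' - 2 * PI * INR k - T i) with (- (T i - (t' - 2 * PI * INR k))) in K' by ring.
    rewrite sin_neg in K'. lra.
  - assert (sin (t' - 2 * PI * INR k - T i) > 0) by (apply sin_gt_0; lra). lra.
Qed.

Lemma trace_turn (k i j : nat) (t : R) :
  trace k (i + 2 * n * j) (t + 2 * PI * INR j) = trace k i t.
Proof.
  unfold trace, par.
  replace (i + 2 * n * j + k)%nat with (i + k + 2 * n * j)%nat by lia.
  replace (S (i + 2 * n * j))%nat with (S i + 2 * n * j)%nat by lia.
  rewrite P_turn, edge_turn, height_turn, edge_length_turn, T_turn, th_turn.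
  do 2 f_equal. f_equal; [do 3 f_equal; ring | f_equal; f_equal; ring].
Qed.

Lemma T_mono (i j : nat) : (i < j)%nat -> T i < T j.
Proof.
  induction 1 as [ | j _ IH]; [apply T_lt | ]. pose proof (T_lt j). lra.
Qed.

(** Distinct intervals [T i <= t <= T (S i)] meet only at the polar angle of a
    common vertex. *)
Lemma trace_agree (k a b : nat) (t : R) :
  T a <= t <= T (S a) -> T b <= t <= T (S b) -> trace k a t = trace k b t.
Proof.
  assert (H : forall a b, (a < b)%nat -> T a <= t <= T (S a) -> T b <= t <= T (S b) ->
    trace k a t = trace k b t).
  { clear a b. intros a b hab ha hb.
    assert (b = S a) as ->.
    { destruct (Nat.eq_dec b (S a)) as [ | ne]; [assumption | ].
      assert (T (S a) < T b) by (apply T_mono; lia). lra. }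
    assert (t = T (S a)) as -> by lra.
    unfold trace. rewrite par_end, par_start.
    change (S a + k)%nat with (S (a + k)). rewrite vertex_succ.
    apply injective_projections; coords; ring. }
  intros ha hb. destruct (Nat.lt_total a b) as [h | [-> | h]]; auto. symmetry; auto.
Qed.

(** The image under the involution does not depend on the edge that is used to
    represent [x], by [trace_agree] and [trace_turn]. *)
Lemma boundary_hit (x x' : R * R) (i : nat) (r t : R) :
  boundary_involution n P x x' -> 0 < r -> x = plus p (scal r (unit_vec t)) ->
  T i <= t <= T (S i) -> x = trace 0 i t /\ x' = trace n i t.
Proof.
  intros (j & s & _ & hs & -> & ->) hr e hi.
  destruct (edge_hit j s r t hs hr e) as (m & hm & ->).
  assert (K : forall k, trace k j (t + 2 * PI * IZR m) = trace k i t).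
  { intros k. destruct (Z_le_gt_dec 0 m) as [h | h].
    - rewrite <- (Z2Nat.id m h), <- INR_IZR_INZ in hm |- *.
      set (q := Z.to_nat m) in *.
      rewrite <- (trace_turn k i q). apply trace_agree; [exact hm | ].
      change (S (i + 2 * n * q)) with (S i + 2 * n * q)%nat. rewrite !T_turn. lra.
    - replace (IZR m) with (- INR (Z.to_nat (- m))) in hm |- *
        by (rewrite INR_IZR_INZ, Z2Nat.id, opp_IZR by lia; ring).
      set (q := Z.to_nat (- m)) in *.
      rewrite <- (trace_turn k j q).
      replace (t + 2 * PI * - INR q + 2 * PI * INR q) with t by ring.
      apply trace_agree; [ | exact hi].
      change (S (j + 2 * n * q)) with (S j + 2 * n * q)%nat. rewrite !T_turn. lra. }
  split; [rewrite <- K | rewrite <- K]; unfold trace; now rewrite ?Nat.add_0_r.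
Qed.

Lemma trace_involution (i : nat) (t : R) : T i <= t <= T (S i) ->
  boundary_involution n P (trace 0 i t) (trace n i t).
Proof.
  intros h. exists (i mod (2 * n))%nat, (par i t).
  assert (hn : (2 * n <> 0)%nat) by lia.
  assert (ei : (i = i mod (2 * n) + 2 * n * (i / (2 * n)))%nat)
    by (rewrite (Nat.div_mod i (2 * n) hn) at 1; lia).
  set (a := (i mod (2 * n))%nat) in *. set (k := (i / (2 * n))%nat) in *.
  split; [now apply Nat.mod_upper_bound | ].
  split; [apply par_bounds; [now apply cell_window | exact h] | ].
  unfold trace. rewrite Nat.add_0_r. split.
  - rewrite <- (P_turn a k), <- (edge_turn a k), <- ei. reflexivity.
  - rewrite <- (P_turn (a + n) k), <- (edge_turn (a + n) k).
    replace (a + n + 2 * n * k)%nat with (i + n)%nat by lia. reflexivity.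
Qed.

Lemma polygon_image (i j : nat) (t : R) :
  T i <= t <= T (S i) -> T j <= t + PI <= T (S j) -> trace n i t <> trace n j (t + PI) ->
  image_is (Phi_polygon n P) (pencil p t) (trace n i t) (trace n j (t + PI)).
Proof.
  intros hi hj hne. split; [exact hne | ].
  assert (hits : forall x x', on_line (pencil p t) x -> boundary_involution n P x x' ->
    (x = trace 0 i t /\ x' = trace n i t) \/ (x = trace 0 j (t + PI) /\ x' = trace n j (t + PI))).
  { intros x x' hx hb. apply on_pencil in hx. destruct hx as [r hr].
    destruct (Rtotal_order 0 r) as [h | [h | h]].
    - left. now apply (boundary_hit x x' i r t).
    - exfalso. rewrite <- h in hr. destruct hb as (k & s & _ & hs & e & _).
      (* [r = 0] would put [p] on an edge, where its height vanishes. *)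
      pose proof (hp (th (S k))) as hh. pose proof (P_right k) as hk.
      rewrite hr, edge_eq in e.
      pose proof (f_equal fst e) as x1. pose proof (f_equal snd e) as x2.
      unfold height in hh. coords.
      assert (y1 : sin (th (S k)) * (fst p) = sin (th (S k)) * (fst (P k) + s * (edge_length k * cos (th (S k)))))
        by (f_equal; lra).
      assert (y2 : cos (th (S k)) * (snd p) = cos (th (S k)) * (snd (P k) + s * (edge_length k * sin (th (S k)))))
        by (f_equal; lra).
      lra.
    - right. apply (boundary_hit x x' j (- r) (t + PI)); auto; [lra | ].
      now rewrite <- opposite_ray. }
  assert (hX : on_line (pencil p t) (trace 0 i t)).
  { apply on_pencil. rewrite trace_ray by now apply cell_window. now eexists. }
  assert (hY : on_line (pencil p t) (trace 0 j (t + PI))).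
  { apply on_pencil. rewrite trace_ray by now apply cell_window.
    exists (- (height c p (th (S j)) / sin (th (S j) - (t + PI)))).
    rewrite (opposite_ray p t), Ropp_involutive. reflexivity. }
  intros m. split.
  - intros (_ & x & y & x' & y' & hxy & hx & hy & bx & by' & hm & mx & my).
    destruct (hits x x' hx bx) as [[ex ex'] | [ex ex']];
      destruct (hits y y' hy by') as [[ey ey'] | [ey ey']]; subst; tauto.
  - intros (hm & h1 & h2). split.
    + exists p. split.
      * intros k _. rewrite edge_eq. pose proof (edge_length_pos k) as hl. pose proof (hp (th (S k))) as hh.
        pose proof (P_right k) as hk. unfold height in hh. coords.
        set (z := cos (th (S k)) * (snd p - snd (P k)) - sin (th (S k)) * (fst p - fst (P k))).
        assert (hz : 0 < z) by (unfold z; lra).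
        assert (0 < edge_length k * z) by (now apply Rmult_lt_0_compat). unfold z in *. lra.
      * apply on_pencil. exists 0. apply injective_projections; coords; ring.
    + exists (trace 0 i t), (trace 0 j (t + PI)), (trace n i t), (trace n j (t + PI)).
      repeat split; auto using trace_involution.
      rewrite !trace_ray by now apply cell_window. intros e.
      pose proof (window_sin i t (cell_window _ _ hi)) as s1.
      pose proof (window_sin j _ (cell_window _ _ hj)) as s2.
      pose proof (hp (th (S i))) as k1. pose proof (hp (th (S j))) as k2.
      assert (r1 : 0 < height c p (th (S i)) / sin (th (S i) - t)) by now apply Rdiv_lt_0_compat.
      assert (r2 : 0 < height c p (th (S j)) / sin (th (S j) - (t + PI))) by now apply Rdiv_lt_0_compat.
      set (u := height c p (th (S i)) / _) in *. set (v := height c p (th (S j)) / _) in *.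
      clearbody u v.
      pose proof (f_equal fst e) as x1. pose proof (f_equal snd e) as x2. coords.
      rewrite neg_cos in x1. rewrite neg_sin in x2.
      pose proof (sin2_cos2 t) as q; unfold Rsqr in q.
      assert (y1 : (u + v) * cos t = 0) by lra. assert (y2 : (u + v) * sin t = 0) by lra.
      apply Rmult_integral in y1, y2.
      assert (cos t = 0) as z1 by lra. assert (sin t = 0) as z2 by lra.
      rewrite z1, z2 in q. lra.
Qed.

Lemma T_unbounded (t : R) : exists N, t < T N.
Proof.
  destruct (INR_unbounded ((t - T 0) / (2 * PI))) as [k hk].
  exists (0 + 2 * n * k)%nat. rewrite T_turn. pose proof PI_RGT_0 as hpi.
  assert (t - T 0%nat < 2 * PI * INR k); [ | lra].
  apply Rmult_lt_reg_r with (/ (2 * PI)); [apply Rinv_0_lt_compat; lra | ].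
  replace (2 * PI * INR k * / (2 * PI)) with (INR k) by (field; lra). exact hk.
Qed.

Lemma locate_right (t : R) : T 0%nat <= t -> exists i, T i <= t < T (S i).
Proof.
  intros h0. destruct (T_unbounded t) as [N hN].
  induction N as [ | N IH]; [lra | ].
  destruct (Rle_dec (T N) t) as [h | h]; [now exists N | apply IH; lra].
Qed.

Lemma locate_left (t : R) : T 0%nat < t -> exists i, T i < t <= T (S i).
Proof.
  intros h0. destruct (T_unbounded t) as [N hN]. apply Rlt_le in hN.
  induction N as [ | N IH]; [lra | ].
  destruct (Rlt_dec (T N) t) as [h | h]; [now exists N | apply IH; lra].
Qed.

Lemma first_polar_angle_lt : T 0%nat < PI.
Proof. destruct (T_spec 0) as [h _]. lra. Qed.

Lemma vertex_corner (i : nat) (t r : R) :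
  P i = plus p (scal r (unit_vec t)) -> corner n P p t.
Proof.
  intros e. exists (i mod (2 * n))%nat.
  assert (hn : (2 * n <> 0)%nat) by lia.
  split; [now apply Nat.mod_upper_bound | ].
  rewrite <- (P_turn _ (i / (2 * n))).
  replace (i mod (2 * n) + 2 * n * (i / (2 * n)))%nat with i
    by (rewrite (Nat.div_mod i (2 * n) hn) at 1; lia).
  apply on_pencil. now exists r.
Qed.

(** Off the corners, [t] and [t + PI] are interior to their cells, and the family
    is smooth on both sides of [t]. *)
Lemma corner_at_T (i : nat) (t : R) : T i = t \/ T i = t + PI -> corner n P p t.
Proof.
  destruct (T_spec i) as (_ & _ & e & _). intros [h | h]; rewrite h in e.
  - eapply vertex_corner; exact e.
  - apply (vertex_corner i t (- Rad i)). rewrite e.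
    apply injective_projections; coords; rewrite ?neg_cos, ?neg_sin; ring.
Qed.

Definition trace_velocity (i : nat) (t : R) : R * R :=
  scal (- (edge_length (i + n) / edge_length i *
    (height c p (th (S i)) / (sin (th (S i) - t) * sin (th (S i) - t))))) (unit_vec (th (S i))).

Lemma opposite_edge (i : nat) :
  edge P (i + n) = scal (- edge_length (i + n)) (unit_vec (th (S i))).
Proof.
  rewrite edge_eq. change (S (i + n)) with (S i + n)%nat. rewrite th_half.
  apply injective_projections; coords; rewrite ?neg_cos, ?neg_sin; ring.
Qed.

(** Rests on [sin (th - T) = cos (t - T) * sin (th - t) + sin (t - T) * cos (th - t)]. *)
Lemma par_derive (i : nat) (t : R) : th (S i) - PI < t < th (S i) ->
  is_derive (par i) t
    (height c p (th (S i)) / (edge_length i * (sin (th (S i) - t) * sin (th (S i) - t)))).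
Proof.
  intros h. pose proof (window_sin i t h) as s1.
  pose proof (window_sin i _ (proj1 (T_window i))) as s2. pose proof (edge_length_pos i) as hl.
  unfold par.
  set (H := height c p (th (S i))). set (L := edge_length i) in *.
  set (a := th (S i)) in *. set (b := T i) in *.
  auto_derive.
  { unfold Rminus in s1. lra. }
  assert (E : sin (a - b) = cos (t - b) * sin (a - t) + sin (t - b) * cos (a - t)).
  { replace (a - b) with ((t - b) + (a - t)) by ring. rewrite sin_plus. ring. }
  rewrite E in *. unfold Rminus in *.
  field. lra.
Qed.

Lemma trace_moves (i : nat) (t : R) : th (S i) - PI < t < th (S i) ->
  moves (trace n i) t (trace_velocity i t).
Proof.
  intros h. pose proof (par_derive i t h) as hd. pose proof (edge_length_pos i) as hl.
  pose proof (window_sin i t h) as s1.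
  assert (K : forall u v : R, is_derive (fun s => u + par i s * v) t
    (height c p (th (S i)) / (edge_length i * (sin (th (S i) - t) * sin (th (S i) - t))) * v)).
  { intros u v. apply is_derive_ext with (fun s => v * par i s + u).
    { intros s. change (v * par i s + u = u + par i s * v :> R). ring. }
    eapply is_derive_value.
    - apply (is_derive_plus (fun s => v * par i s) (fun _ => u)).
      + apply (is_derive_scal (par i)), hd.
      + instantiate (1 := 0). auto_derive; [exact I | ring].
    - unfold plus; simpl. ring. }
  split; (eapply is_derive_value; [apply K | ]);
    rewrite opposite_edge; unfold trace_velocity; coords; field; lra.
Qed.

Variable alpha : R -> R.
Hypothesis alpha_range : forall t, t < alpha t < t + PI.
Hypothesis alpha_ray : forall t, c (alpha t) =
  plus p (scal (height c p (alpha t) / sin (alpha t - t)) (unit_vec t)).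

(** The ray of direction [t] crosses the edge [i], so the contact point of the edge
    before it is to the right of the ray, and that of the edge after it to the
    left. *)
Lemma cell_alpha (i : nat) (t : R) : T i <= t <= T (S i) ->
  th i <= alpha t <= th (S (S i)).
Proof.
  intros h. destruct (T_spec i) as (w & hr & e & _). destruct (T_spec (S i)) as (w' & hr' & e' & _).
  pose proof (th_gap i) as g1. pose proof (th_gap (S i)) as g2. specialize (alpha_range t) as ha.
  split.
  - destruct (Rle_dec (th i) t) as [hle | hgt]; [lra | ].
    apply (le_alpha c rho p hc alpha alpha_range alpha_ray); [lra | ].
    destruct (proj1 (vertex_on_tangents i)) as (xi & _ & E).
    pose proof (angular_pos c rho hc xi). pose proof (gap_half_tan i).
    set (x := rho xi * half_tan (th (S i) - th i)) in *.
    assert (hx : 0 < x) by (apply Rmult_lt_0_compat; lra). clearbody x.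
    rewrite e in E.
    assert (s1 : 0 <= sin (t - T i)) by (apply sin_ge_0; lra).
    assert (s2 : 0 <= sin (th i - t)) by (apply sin_ge_0; lra).
    pose proof (Rmult_le_pos _ _ (Rlt_le _ _ hr) s1) as q1.
    pose proof (Rmult_le_pos _ _ (Rlt_le _ _ hx) s2) as q2.
    rewrite sin_minus in q1, q2.
    pose proof (f_equal fst E) as x1. pose proof (f_equal snd E) as x2. coords.
    assert (y1 : sin t * (fst p + Rad i * cos (T i)) = sin t * (fst (c (th i)) + x * cos (th i)))
      by (f_equal; exact x1).
    assert (y2 : cos t * (snd p + Rad i * sin (T i)) = cos t * (snd (c (th i)) + x * sin (th i)))
      by (f_equal; exact x2).
    lra.
  - destruct (Rle_dec (t + PI) (th (S (S i)))) as [hle | hgt]; [lra | ].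
    apply (alpha_le c rho p hc alpha alpha_range alpha_ray); [lra | ].
    destruct (proj2 (vertex_on_tangents (S i))) as (xi & _ & E).
    pose proof (angular_pos c rho hc xi). pose proof (gap_half_tan (S i)).
    set (x := rho xi * half_tan (th (S (S i)) - th (S i))) in *.
    assert (hx : 0 < x) by (apply Rmult_lt_0_compat; lra). clearbody x.
    rewrite e' in E.
    assert (s1 : 0 <= sin (T (S i) - t)) by (apply sin_ge_0; lra).
    assert (s2 : 0 <= sin (th (S (S i)) - t)) by (apply sin_ge_0; lra).
    pose proof (Rmult_le_pos _ _ (Rlt_le _ _ hr') s1) as q1.
    pose proof (Rmult_le_pos _ _ (Rlt_le _ _ hx) s2) as q2.
    rewrite sin_minus in q1, q2.
    pose proof (f_equal fst E) as x1. pose proof (f_equal snd E) as x2. coords.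
    assert (y1 : sin t * (fst p + Rad (S i) * cos (T (S i))) =
      sin t * (fst (c (th (S (S i)))) - x * cos (th (S (S i))))) by (f_equal; exact x1).
    assert (y2 : cos t * (snd p + Rad (S i) * sin (T (S i))) =
      cos t * (snd (c (th (S (S i)))) - x * sin (th (S (S i))))) by (f_equal; exact x2).
    lra.
Qed.

(** By [edge_mean_radius] the ratio of the opposite edges is a ratio of radii of
    curvature, the two breadths being equal. *)
Lemma cell_approximates (i : nat) (t : R) : T i <= t <= T (S i) ->
  approximates c rho p alpha (2 * d) t (trace n i t) (trace_velocity i t).
Proof.
  intros h. pose proof (cell_alpha i t h) as ha.
  pose proof (th_gap i) as g1. pose proof (th_gap (S i)) as g2.
  destruct (edge_length_spec i) as (z & hz & ez & _).
  destruct (edge_length_spec (i + n)) as (z' & hz' & ez' & _ & x & hx & ex).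
  pose proof (proj1 (par_bounds i t (cell_window i t h)) h) as hpar.
  pose proof (opposite_edge i) as eo.
  change (S (S (i + n))) with (S (S i) + n)%nat in hz'.
  change (S (i + n)) with (S i + n)%nat in ex.
  rewrite !th_half in hz'. rewrite th_half in ex.
  assert (hb : breadth (i + n) = breadth i).
  { unfold breadth. change (S (S (i + n))) with (S (S i) + n)%nat.
    change (S (i + n)) with (S i + n)%nat. rewrite !th_half. do 2 f_equal; ring. }
  pose proof (breadth_bounds i) as hbb.
  exists (th (S i)), z, (z' - PI).
  replace (z' - PI + PI) with z' by ring.
  pose proof (angular_pos c rho hc z) as r1. pose proof (angular_pos c rho hc z') as r2.
  assert (hl : edge_length (i + n) <= rho z' * (2 * d)).
  { rewrite ez', hb. apply Rmult_le_compat_l; lra. }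
  assert (hl0 := edge_length_pos (i + n)).
  (* the trace stays on the opposite edge, which contains the contact point *)
  assert (K : forall w, Rabs w <= 1 ->
    Rabs (x * w + par i t * (- edge_length (i + n) * w)) <= rho z' * (2 * d)).
  { intros w hw. replace (x * w + par i t * (- edge_length (i + n) * w))
      with ((x - par i t * edge_length (i + n)) * w) by ring.
    rewrite Rabs_mult.
    assert (Rabs (x - par i t * edge_length (i + n)) <= edge_length (i + n)).
    { apply Rabs_le. nra. }
    pose proof (Rabs_pos w). pose proof (Rabs_pos (x - par i t * edge_length (i + n))). nra. }
  repeat split; try (apply Rabs_le; lra).
  - unfold trace. rewrite eo, ex. coords. rewrite neg_cos.
    eapply Rle_trans; [ | apply (K (cos (th (S i)))); apply Rabs_le, COS_bound].
    right. f_equal. ring.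
  - unfold trace. rewrite eo, ex. coords. rewrite neg_sin.
    eapply Rle_trans; [ | apply (K (sin (th (S i)))); apply Rabs_le, SIN_bound].
    right. f_equal. ring.
  - unfold trace_velocity. do 3 f_equal. rewrite ez, ez', hb. field. lra.
Qed.

Variable eps : R.
Hypothesis close : forall t g1 g2 d1 d2, PI <= t <= 5 * PI ->
  approximates c rho p alpha (2 * d) t g1 d1 ->
  approximates c rho p alpha (2 * d) (t + PI) g2 d2 ->
  0 < weight g1 g2 d1 d2 /\
  norm (minus (envelope_of g1 g2 d1 d2) (limit_envelope c rho p alpha t)) <= eps.

(** What is needed at [t] on the side described by [F].  The angle [s] is [t] up to
    a multiple of [2 * PI]: cells are enumerated by natural numbers, so that only
    large enough angles are covered directly. *)
Record piece (F : (R -> Prop) -> Prop) (t s : R) (g1 g2 : R -> R * R) (d1 d2 : R * R) : Prop := {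
  piece_moves1 : moves g1 t d1;
  piece_moves2 : moves g2 t d2;
  piece_weight : weight (g1 t) (g2 t) d1 d2 <> 0;
  piece_close : norm (minus (envelope_of (g1 t) (g2 t) d1 d2) (limit_envelope c rho p alpha s)) <= eps;
  piece_image : image_is (Phi_polygon n P) (pencil p t) (g1 t) (g2 t);
  piece_along : image_along (Phi_polygon n P) p F g1 g2 }.

Lemma cell_image (i j : nat) (t : R) : PI <= t <= 5 * PI ->
  T i <= t <= T (S i) -> T j <= t + PI <= T (S j) ->
  0 < weight (trace n i t) (trace n j (t + PI)) (trace_velocity i t) (trace_velocity j (t + PI)) /\
  norm (minus (envelope_of (trace n i t) (trace n j (t + PI))
    (trace_velocity i t) (trace_velocity j (t + PI))) (limit_envelope c rho p alpha t)) <= eps /\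
  image_is (Phi_polygon n P) (pencil p t) (trace n i t) (trace n j (t + PI)).
Proof.
  intros ht hi hj.
  destruct (close t _ _ _ _ ht (cell_approximates i t hi) (cell_approximates j (t + PI) hj))
    as [hw hc'].
  split; [exact hw | split; [exact hc' | ]].
  apply polygon_image; auto. eapply weight_distinct, Rgt_not_eq, hw.
Qed.

Lemma cell_piece (F : (R -> Prop) -> Prop) {FF : Filter F} (i j : nat) (t : R) :
  2 * PI <= t <= 4 * PI -> filter_le F (locally t) ->
  T i <= t <= T (S i) -> T j <= t + PI <= T (S j) ->
  F (fun s => (T i <= s <= T (S i)) /\ (T j <= s + PI <= T (S j))) ->
  exists g1 g2 d1 d2, piece F t t g1 g2 d1 d2.
Proof.
  intros ht hF hi hj hs. pose proof PI_RGT_0 as hpi.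
  destruct (cell_image i j t ltac:(lra) hi hj) as (hw & hn & him).
  exists (trace n i), (fun s => trace n j (s + PI)), (trace_velocity i t), (trace_velocity j (t + PI)).
  constructor; auto.
  - now apply trace_moves, cell_window.
  - now apply moves_shift, trace_moves, cell_window.
  - now apply Rgt_not_eq.
  - assert (hnear : F (fun s => PI <= s <= 5 * PI)).
    { apply hF. exists (mkposreal PI hpi). intros s h. change (Rabs (s - t) < PI) in h.
      apply Rabs_def2 in h. lra. }
    unfold image_along. generalize (filter_and _ _ hs hnear). apply filter_imp.
    intros s [[h1 h2] h3]. now apply cell_image.
Qed.

Lemma near_right (t a b : R) : a <= t < b -> at_right t (fun s => a <= s <= b).
Proof.
  intros h. assert (hd : 0 < b - t) by lra. exists (mkposreal _ hd).
  intros s hs hlt. change (Rabs (s - t) < b - t) in hs. apply Rabs_def2 in hs. lra.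
Qed.

Lemma near_left (t a b : R) : a < t <= b -> at_left t (fun s => a <= s <= b).
Proof.
  intros h. assert (hd : 0 < t - a) by lra. exists (mkposreal _ hd).
  intros s hs hlt. change (Rabs (s - t) < t - a) in hs. apply Rabs_def2 in hs. lra.
Qed.

Lemma near_both (t a b : R) : a < t < b -> locally t (fun s => a <= s <= b).
Proof.
  intros h. assert (hd : 0 < Rmin (t - a) (b - t)) by (apply Rmin_glb_lt; lra).
  exists (mkposreal _ hd). intros s hs. change (Rabs (s - t) < Rmin (t - a) (b - t)) in hs.
  pose proof (Rmin_l (t - a) (b - t)). pose proof (Rmin_r (t - a) (b - t)).
  apply Rabs_def2 in hs. lra.
Qed.

(** The window starts after the first cell, and leaves room on both sides for the
    angles near [t] in the range of uniform approximation. *)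
Lemma pieces (t : R) : 2 * PI <= t <= 4 * PI ->
  (exists g1 g2 d1 d2, piece (at_left t) t t g1 g2 d1 d2) /\
  (exists g1 g2 d1 d2, piece (at_right t) t t g1 g2 d1 d2) /\
  (~ corner n P p t -> exists g1 g2 d1 d2, piece (locally t) t t g1 g2 d1 d2).
Proof.
  intros ht. pose proof PI_RGT_0 as hpi. pose proof first_polar_angle_lt as h0.
  split; [ | split].
  - destruct (locate_left t ltac:(lra)) as [i hi].
    destruct (locate_left (t + PI) ltac:(lra)) as [j hj].
    apply (cell_piece (at_left t) i j); auto; try lra.
    + intros Q hQ. now apply at_left_le, punctured_le.
    + apply filter_and; [now apply near_left | ].
      apply (at_left_shift t PI (fun s => T j <= s <= T (S j))). now apply near_left.
  - destruct (locate_right t ltac:(lra)) as [i hi].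
    destruct (locate_right (t + PI) ltac:(lra)) as [j hj].
    apply (cell_piece (at_right t) i j); auto; try lra.
    + intros Q hQ. now apply at_right_le, punctured_le.
    + apply filter_and; [now apply near_right | ].
      apply (at_right_shift t PI (fun s => T j <= s <= T (S j))). now apply near_right.
  - intros hcor.
    destruct (locate_right t ltac:(lra)) as [i hi].
    destruct (locate_right (t + PI) ltac:(lra)) as [j hj].
    assert (hi' : T i <> t) by (intros e; apply hcor, (corner_at_T i); tauto).
    assert (hj' : T j <> t + PI) by (intros e; apply hcor, (corner_at_T j); tauto).
    apply (cell_piece (locally t) i j); auto; try lra.
    + intros Q hQ. exact hQ.
    + apply filter_and; [apply near_both; lra | ].
      apply (locally_shift t PI (fun s => T j <= s <= T (S j))). apply near_both; lra.
Qed.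

Lemma piece_shift (F G : (R -> Prop) -> Prop) (t : R) (m : Z)
  (g1 g2 : R -> R * R) (d1 d2 : R * R) :
  (forall Q, F Q -> G (fun s => Q (s + 2 * PI * IZR m))) ->
  piece F (t + 2 * PI * IZR m) (t + 2 * PI * IZR m) g1 g2 d1 d2 ->
  piece G t (t + 2 * PI * IZR m) (fun s => g1 (s + 2 * PI * IZR m))
    (fun s => g2 (s + 2 * PI * IZR m)) d1 d2.
Proof.
  intros hFG [h1 h2 h3 h4 h5 h6]. constructor; auto.
  - now apply moves_shift.
  - now apply moves_shift.
  - now rewrite pencil_shift in h5.
  - apply hFG in h6. unfold image_along.
    assert (E : (fun s => image_is (Phi_polygon n P) (pencil p s) (g1 (s + 2 * PI * IZR m)) (g2 (s + 2 * PI * IZR m))) =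
      (fun s => image_is (Phi_polygon n P) (pencil p (s + 2 * PI * IZR m)) (g1 (s + 2 * PI * IZR m)) (g2 (s + 2 * PI * IZR m)))).
    { apply functional_extensionality. intros s. now rewrite pencil_shift. }
    rewrite E. exact h6.
Qed.

Lemma all_pieces (t : R) : exists s, 2 * PI <= s <= 4 * PI /\
  (exists g1 g2 d1 d2, piece (at_left t) t s g1 g2 d1 d2) /\
  (exists g1 g2 d1 d2, piece (at_right t) t s g1 g2 d1 d2) /\
  (~ corner n P p t -> exists g1 g2 d1 d2, piece (locally t) t s g1 g2 d1 d2).
Proof.
  destruct (shift_into t (2 * PI)) as [m hm].
  exists (t + 2 * PI * IZR m). split; [lra | ].
  destruct (pieces (t + 2 * PI * IZR m) ltac:(lra)) as (h1 & h2 & h3).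
  split; [ | split].
  - destruct h1 as (g1 & g2 & d1 & d2 & h). do 4 eexists.
    exact (piece_shift _ _ t m _ _ _ _ (at_left_shift t _) h).
  - destruct h2 as (g1 & g2 & d1 & d2 & h). do 4 eexists.
    exact (piece_shift _ _ t m _ _ _ _ (at_right_shift t _) h).
  - intros hcor. destruct h3 as (g1 & g2 & d1 & d2 & h).
    { intros (i & hi & hl). apply hcor. exists i. split; [exact hi | ].
      now rewrite pencil_shift in hl. }
    do 4 eexists. exact (piece_shift _ _ t m _ _ _ _ (locally_shift t _) h).
Qed.

Lemma Phi_polygon_total (t : R) : exists m, Phi_polygon n P (pencil p t) m.
Proof.
  destruct (all_pieces t) as (s & _ & _ & (g1 & g2 & d1 & d2 & h) & _).
  eexists. apply (image_chord _ _ t 1 _ _ (piece_image _ _ _ _ _ _ _ h)), R1_neq_R0.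
Qed.

(** Balls are convex, so at a corner the segment between the two one-sided envelope
    points is as close to the limit as its ends. *)
Lemma ART_polygon_near (z : R * R) : ART_polygon n P p z ->
  exists s, 2 * PI <= s <= 4 * PI /\ norm (minus z (limit_envelope c rho p alpha s)) <= eps.
Proof.
  intros (l & t & hl & h).
  destruct (all_pieces t) as (s & hs & (al & bl & ul & vl & hL) & (ar & br & ur & vr & hR) & hB).
  exists s. split; [exact hs | ].
  assert (right_envelope : forall w, envelope_point (at_right t) l t w ->
    norm (minus w (limit_envelope c rho p alpha s)) <= eps).
  { intros w hw. destruct hR as [q1 q2 q3 q4 q5 q6].
    rewrite (family_envelope (Phi_polygon n P) p (at_right t) l ar br t ur vr w (at_right_le t)); auto. }
  assert (left_envelope : forall w, envelope_point (at_left t) l t w ->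
    norm (minus w (limit_envelope c rho p alpha s)) <= eps).
  { intros w hw. destruct hL as [q1 q2 q3 q4 q5 q6].
    rewrite (family_envelope (Phi_polygon n P) p (at_left t) l al bl t ul vl w (at_left_le t)); auto. }
  destruct h as [[hcor hz] | (hcor & z1 & z2 & x & hz1 & hz2 & hx & e)].
  - now apply right_envelope, two_sided_envelope.
  - specialize (left_envelope _ hz1). specialize (right_envelope _ hz2).
    set (w := limit_envelope c rho p alpha s) in *.
    assert (E : minus z w = plus (scal (1 - x) (minus z1 w)) (scal x (minus z2 w)) :> R * R).
    { rewrite e. apply injective_projections; coords; ring. }
    rewrite E. eapply Rle_trans; [apply (norm_triangle (scal (1 - x) (minus z1 w)) (scal x (minus z2 w))) | ].
    assert (hsc : forall (y : R) (v : R * R), 0 <= y -> norm (scal y v) = y * norm v).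
    { intros y v hy. rewrite !norm_pair, !fst_scal, !snd_scal.
      replace (y * fst v * (y * fst v) + y * snd v * (y * snd v))
        with (y * y * (fst v * fst v + snd v * snd v)) by ring.
      rewrite sqrt_mult_alt by nra. now rewrite sqrt_square. }
    rewrite !hsc by lra. nra.
Qed.

(** At a corner the left envelope point is used, as the end [0] of its segment. *)
Lemma near_ART_polygon (t : R) : 2 * PI <= t <= 4 * PI ->
  exists z, ART_polygon n P p z /\ norm (minus z (limit_envelope c rho p alpha t)) <= eps.
Proof.
  intros ht. destruct (pieces t ht) as ((al & bl & ul & vl & hL) & (ar & br & ur & vr & hR) & hB).
  destruct (classic (corner n P p t)) as [hcor | hcor].
  - destruct hL as [l1 l2 l3 l4 l5 l6]. destruct hR as [r1 r2 r3 r4 r5 r6].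
    destruct (one_sided_envelopes (Phi_polygon n P) p Phi_polygon_total al bl ar br t ul vl ur vr)
      as (l & hl & e1 & e2); auto.
    eexists. split; [ | exact l4]. exists l, t. split; [exact hl | right].
    split; [exact hcor | ]. do 2 eexists. exists 0.
    split; [exact e1 | split; [exact e2 | split; [lra | ]]].
    apply injective_projections; coords; ring.
  - destruct (hB hcor) as (g1 & g2 & d1 & d2 & [q1 q2 q3 q4 q5 q6]).
    destruct (two_sided_envelope_exists (Phi_polygon n P) p Phi_polygon_total g1 g2 t d1 d2)
      as (l & hl & e); auto.
    eexists. split; [ | exact q4]. exists l, t. split; [exact hl | left].
    split; [exact hcor | exact e].
Qed.

End Polygon.

(** * Sampled directions *)

Lemma Sorted_nth (l : list R) (i : nat) : Sorted Rlt l -> (S i < length l)%nat ->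
  nth i l 0 < nth (S i) l 0.
Proof.
  intros hs. revert i. induction hs as [ | a l hs IH hd]; intros i hi; [simpl in hi; lia | ].
  destruct i as [ | i].
  - destruct hd as [ | b l hb]; [simpl in hi; lia | exact hb].
  - apply IH. simpl in hi. lia.
Qed.

Section Directions.

Variable nu : list R.
Hypothesis hnu : direction_set nu.

Lemma direction_half (i : nat) : direction nu (i + length nu) = direction nu i + PI.
Proof.
  destruct hnu as (_ & _ & hn). unfold direction.
  replace (i + length nu)%nat with (i + 1 * length nu)%nat by lia.
  rewrite Nat.Div0.mod_add, Nat.div_add by lia.
  rewrite plus_INR. simpl (INR 1). ring.
Qed.

Lemma direction_bounds (j : nat) : (j < length nu)%nat -> 0 <= nth j nu 0 < PI.
Proof.
  intros hj. destruct hnu as (_ & hf & _). rewrite Forall_forall in hf.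
  apply hf. now apply nth_In.
Qed.

Lemma direction_lt (i : nat) : direction nu i < direction nu (S i).
Proof.
  destruct hnu as (hs & _ & hn). unfold direction.
  set (m := length nu) in *. assert (hm : m <> 0%nat) by lia.
  pose proof (Nat.mod_upper_bound i m hm) as hr.
  pose proof (Nat.div_mod i m hm) as hi.
  set (r := (i mod m)%nat) in *. set (q := (i / m)%nat) in *.
  destruct (Nat.eq_dec (S r) m) as [e | ne].
  - assert (hS : S i = (0 + (S q) * m)%nat) by lia.
    rewrite hS, Nat.Div0.mod_add, Nat.div_add by lia.
    rewrite Nat.Div0.mod_0_l, Nat.Div0.div_0_l, plus_INR, S_INR. simpl (INR 0).
    pose proof (direction_bounds r ltac:(fold m; lia)).
    pose proof (direction_bounds 0 ltac:(fold m; lia)). lra.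
  - assert (hS : S i = (S r + q * m)%nat) by lia.
    rewrite hS, Nat.Div0.mod_add, Nat.div_add by lia.
    rewrite Nat.mod_small, Nat.div_small by lia.
    pose proof (Sorted_nth nu r hs ltac:(fold m; lia)). simpl (0 + q)%nat. lra.
Qed.

(** The list of gaps covers one turn; the other gaps repeat these. *)
Lemma direction_gap_le_mesh (i : nat) : direction nu (S i) <= direction nu i + mesh nu.
Proof.
  destruct hnu as (_ & _ & hn).
  set (m := length nu) in *. assert (hm : m <> 0%nat) by lia.
  assert (hk : forall q r, direction nu (r + q * m) = direction nu r + INR q * PI).
  { induction q as [ | q IH]; intros r.
    - simpl INR. replace (r + 0 * m)%nat with r by lia. ring.
    - replace (r + S q * m)%nat with (r + q * m + m)%nat by lia.
      unfold m at 2. rewrite direction_half, IH, S_INR. ring. }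
  pose proof (Nat.mod_upper_bound i m hm) as hr.
  pose proof (Nat.div_mod i m hm) as hi.
  set (r := (i mod m)%nat) in *. set (q := (i / m)%nat) in *.
  replace i with (r + q * m)%nat by lia.
  change (S (r + q * m)) with (S r + q * m)%nat. rewrite !hk.
  assert (direction nu (S r) - direction nu r <= mesh nu); [ | lra].
  apply MaxRlist_P1. unfold gaps.
  apply (in_map (fun i => direction nu (S i) - direction nu i)).
  apply in_seq. fold m. lia.
Qed.

Lemma direction_0 : direction nu 0 < PI.
Proof.
  destruct hnu as (_ & _ & hn). unfold direction.
  rewrite Nat.Div0.mod_0_l, Nat.Div0.div_0_l. simpl (INR 0).
  pose proof (direction_bounds 0 ltac:(lia)). lra.
Qed.

End Directions.

(** * Convergence *)

Lemma hausdorff_dist_lt (A B : R * R -> Prop) (r eps : R) : 0 <= r -> r < eps ->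
  (forall a, A a -> exists b, B b /\ norm (minus a b) <= r) ->
  (forall b, B b -> exists a, A a /\ norm (minus a b) <= r) ->
  Rbar_lt (hausdorff_dist A B) (Finite eps).
Proof.
  intros hr hlt h1 h2. apply Rbar_le_lt_trans with (Finite r); [ | exact hlt].
  apply (proj1 (Glb_Rbar_correct _)). auto.
Qed.

Theorem theorem6p35 (C : C4_oval) (p : R * R) (nu : nat -> list R)
  (P : nat -> nat -> R * R)
  (hp : inside C p)
  (hnu : forall k : nat, direction_set (nu k))
  (hP : forall k : nat, PPOS C (nu k) (P k))
  (hquasi : quasi_uniform nu)
  (hmesh : is_lim_seq (fun k : nat => mesh (nu k)) (Finite 0)) :
  forall eps : R, 0 < eps ->
    eventually (fun k : nat =>
      Rbar_lt (hausdorff_dist (ART_polygon (length (nu k)) (P k) p) (ART_oval C p))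
              (Finite eps)).
Proof.
  intros eps heps.
  destruct (oval_angular C) as (c & rho & hc & hon & hanti & htan & hin).
  assert (hh : forall th, 0 < height c p th) by (apply hin, hp).
  destruct (radial_angle c rho p hc hh) as (alpha & ha1 & ha2 & ha3).
  assert (he : 0 < eps / 2) by lra.
  destruct (envelope_uniform c rho p hc hh alpha ha1 ha3 PI (5 * PI) (eps / 2) he)
    as (eta & heta & close).
  assert (hd : 0 < Rmin (eta / 2) 1) by (apply Rmin_glb_lt; lra).
  apply is_lim_seq_spec in hmesh.
  generalize (hmesh (mkposreal _ hd)). apply filter_imp. intros k hk.
  change (Rabs (mesh (nu k) - 0) < Rmin (eta / 2) 1) in hk. rewrite Rminus_0_r in hk. apply Rabs_def2 in hk. destruct hk as [hk _].
  pose proof (Rmin_l (eta / 2) 1). pose proof (Rmin_r (eta / 2) 1).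
  pose proof (hnu k) as hnuk.
  set (th := direction (nu k)). set (n := length (nu k)).
  assert (hn : (1 <= n)%nat) by (destruct hnuk as (_ & _ & h); unfold n; lia).
  assert (hgap : forall i, th i < th (S i) <= th i + mesh (nu k)).
  { intros i. split; [now apply direction_lt | now apply direction_gap_le_mesh]. }
  assert (hhalf : forall i, th (i + n)%nat = th i + PI) by (intros; now apply direction_half).
  assert (h0 : th 0%nat < PI) by now apply direction_0.
  assert (hleft : forall i, det (unit_vec (th i)) (minus (P k i) (c (th i))) = 0)
    by (intros i; apply htan, (hP k i)).
  assert (hright : forall i, det (unit_vec (th (S i))) (minus (P k i) (c (th (S i)))) = 0)
    by (intros i; apply htan, (hP k i)).
  assert (hd1 : mesh (nu k) <= 1) by lra.
  destruct (choice _ (vertex_polar c p hh th (P k) _ hd1 hgap hleft hright)) as [T hT].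
  destruct (choice _ hT) as [Rad T_spec]. clear hT.
  assert (close' : forall t g1 g2 d1 d2, PI <= t <= 5 * PI ->
    approximates c rho p alpha (2 * mesh (nu k)) t g1 d1 ->
    approximates c rho p alpha (2 * mesh (nu k)) (t + PI) g2 d2 ->
    0 < weight g1 g2 d1 d2 /\
    norm (minus (envelope_of g1 g2 d1 d2) (limit_envelope c rho p alpha t)) <= eps / 2).
  { intros t g1 g2 d1 d2 ht k1 k2.
    apply close; [exact ht | |];
      (apply (approximates_mono c rho p hc alpha (2 * mesh (nu k))); [lra | assumption]). }
  apply hausdorff_dist_lt with (eps / 2); [lra | lra | | ].
  - intros z hz.
    destruct (ART_polygon_near c rho p hc hh n th (P k) (mesh (nu k)) hn hd1 hgap hhalf h0
      hleft hright T Rad T_spec alpha ha1 ha2 (eps / 2) close' z hz) as (s & _ & hs).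
    exists (limit_envelope c rho p alpha s). split; [ | exact hs].
    apply (ART_oval_limit C c rho p hc hh hon hanti alpha ha1 ha2 ha3). now exists s.
  - intros z hz.
    apply (ART_oval_limit C c rho p hc hh hon hanti alpha ha1 ha2 ha3) in hz.
    destruct hz as [t ->]. destruct (shift_into t (2 * PI)) as [m hm].
    rewrite <- (limit_envelope_shift c rho p hc hh alpha ha1 ha2 ha3 t m).
    apply (near_ART_polygon c rho p hc hh n th (P k) (mesh (nu k)) hn hd1 hgap hhalf h0
      hleft hright T Rad T_spec alpha ha1 ha2 (eps / 2) close'). lra.
Qed.
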